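(* Let $\Bbbk$ be an algebraically closed field of characteristic zero. Let $(H,C,\mathrm{tr})$ be an affine Cayley-Hamilton Hopf algebra over $\Bbbk$ such that $H$ is a prime ring. Then the following conditions are equivalent. (1) $H$ has the Chevalley property; (2) all the discriminant ideals of $(H,C,\mathrm{tr})$ are trivial, i.e. each $D_k(H/C;\mathrm{tr})$, $k\ge 1$, is $0$ or $C$; (3) the square dimension function $\mathrm{Sd}:\mathrm{maxSpec}\,C\to\mathbb{N}$ is constant; (4) all the fiber algebras $H/\mathfrak{m}H$, $\mathfrak{m}\in\mathrm{maxSpec}\,C$, are semisimple; (5) the identity fiber algebra $H/\mathfrak{m}_{\overline{\varepsilon}}H$ is semisimple; (6) $H$ is commutative.
   Context: Affine means that $H$ is finitely generated as a $\Bbbk$-algebra. Algebra with trace: a triple $(A,C,\mathrm{tr})$ where $A$ is a $\Bbbk$-algebra, $C$ a central subalgebra and $\mathrm{tr}:A\to C$ a $C$-linear map with $\mathrm{tr}(ab)=\mathrm{tr}(ba)$ for all $a,b\in A$. For $a\in A$ and $k\ge 1$ define $c_k(a)=\frac{1}{k!}\det M_k(a)\in C$, where $M_k(a)$ is the $k\times k$ matrix with entries $(M_k)_{ij}=\mathrm{tr}(a^{i-j+1})$ for $j\le i$, $(M_k)_{i,i+1}=i$, and $0$ for $j>i+1$. The $n$-th characteristic polynomial of $a$ is $p_{n,a}(t)=t^n-c_1(a)t^{n-1}+\cdots+(-1)^n c_n(a)\in C[t]$. $(A,C,\mathrm{tr})$ is a Cayley-Hamilton algebra of degree $n$ if $p_{n,a}(a)=0$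 for all $a\in A$ and $\mathrm{tr}(1)=n$. A Cayley-Hamilton Hopf algebra is a Cayley-Hamilton algebra $(H,C,\mathrm{tr})$ (of some degree) such that $H$ is a Hopf algebra and $C$ is a central Hopf subalgebra of $H$. For an affine Cayley-Hamilton algebra, $A$ is a finitely generated $C$-module and $C$ is an affine $\Bbbk$-algebra. $\overline{\varepsilon}=\varepsilon|_C$ is the restriction to $C$ of the counit $\varepsilon$ of $H$ and $\mathfrak{m}_{\overline{\varepsilon}}=\mathrm{Ker}\,\overline{\varepsilon}\in\mathrm{maxSpec}\,C$. A Hopf algebra has the Chevalley property if the tensor product of any two of its finite-dimensional irreducible modules is completely reducible. For a positive integer $k$, $D_k(H/C;\mathrm{tr})$ is the ideal of $C$ generated by all $\det(\mathrm{tr}(a_ia_j))_{i,j=1}^k$ with $(a_1,\dots,a_k)\in H^k$. The square dimension function is $\mathrm{Sd}(\mathfrak{m})=\sum_{[V]\in\mathrm{Irr}(H/\mathfrak{m}H)}(\dim_{\Bbbk}V)^2$, where $\mathrm{Irr}(A)$ is the set of isomorphism classes of irreducible $A$-modules. *)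

(* Defs.v *)
From HB Require Import structures.
From mathcomp Require Import all_boot all_order all_algebra generic_quotient.
From mathcomp Require Import boolp classical_sets.

Set Implicit Arguments.
Unset Strict Implicit.
Unset Printing Implicit Defensive.
Set Warnings "-notation-overridden,-ambiguous-paths".

Import GRing.Theory.
Local Open Scope ring_scope.
Local Open Scope quotient_scope.
Local Open Scope classical_set_scope.

(* All modules are left modules, not necessarily finite dimensional. *)

Definition irreducible (R : pzRingType) (M : lmodType R) : Prop :=
  (exists x : M, x != 0) /\
  forall N : {pred M}, GRing.submod_closed N ->
    (forall x, x \in N -> x = 0) \/ (forall x, x \in N).

Definition completely_reducible (R : pzRingType) (M : lmodType R) : Prop :=
  forall N : {pred M}, GRing.submod_closed N ->
    exists N' : {pred M},
      [/\ GRing.submod_closed N',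
          forall x, x \in N -> x \in N' -> x = 0
        & forall x, exists y z, [/\ y \in N, z \in N' & x = y + z]].

Definition module_iso (R : pzRingType) (M N : lmodType R) : Prop :=
  exists f : {linear M -> N}, bijective f.

Definition has_dim (k : fieldType) (V : lmodType k) (d : nat) : Prop :=
  exists f : {linear V -> 'rV[k]_d}, bijective f.

Definition semisimple (R : pzRingType) : Prop :=
  @completely_reducible R R^o.

Definition restr (K R : pzRingType) (phi : {rmorphism K -> R})
  (V : lmodType R) : Type := V.

Section Restriction.
Variables (K R : pzRingType) (phi : {rmorphism K -> R}) (V : lmodType R).

HB.instance Definition _ := GRing.Zmodule.on (restr phi V).

Let scale (a : K) (v : restr phi V) : restr phi V := phi a *: (v : V).

Fact restr_scaleA a b v : scale a (scale b v) = scale (a * b) v.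
Proof. by rewrite /scale scalerA rmorphM. Qed.

Fact restr_scale1 : left_id 1 scale.
Proof. by move=> v; rewrite /scale rmorph1 scale1r. Qed.

Fact restr_scaleDr : right_distributive scale +%R.
Proof. by move=> a u v; rewrite /scale scalerDr. Qed.

Fact restr_scaleDl v : {morph scale^~ v : a b / a + b}.
Proof. by move=> a b; rewrite /scale rmorphD scalerDl. Qed.

HB.instance Definition _ :=
  GRing.Zmodule_isLmodule.Build K (restr phi V)
    restr_scaleA restr_scale1 restr_scaleDr restr_scaleDl.
End Restriction.

Definition ideal (R : pzRingType) (I : set R) : Prop :=
  [/\ I 0, forall x y, I x -> I y -> I (x + y)
    & forall a x, I x -> I (a * x) /\ I (x * a)].

Definition ideal_gen (R : pzRingType) (X : set R) : set R :=
  [set x | forall I, ideal I -> X `<=` I -> I x].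

Definition maxSpec (R : pzRingType) : set (set R) :=
  [set m | [/\ ideal m, m <> setT
    & forall J, ideal J -> m `<=` J -> J = m \/ J = setT]].

Arguments maxSpec R : clear implicits.

Definition prime_ring (R : pzRingType) : Prop :=
  (1 : R) != 0 /\
  forall a b : R, (forall x, a * x * b = 0) -> a = 0 \/ b = 0.

Lemma ideal_gen_ideal (R : pzRingType) (X : set R) : ideal (ideal_gen X).
Proof.
split=> [I [] //|x y Ix Iy I hI XI|a x Ix].
  by have [_ hD _] := hI; apply: hD; [apply: Ix|apply: Iy].
by split=> I hI XI; have [_ _ hM] := hI; have [] := hM a x (Ix I hI XI).
Qed.

Section QuotientRing.
Variables (R : pzRingType) (X : set R).

Definition quo_rel (x y : R) : bool := `[< ideal_gen X (x - y) >].

Let I0 : ideal_gen X 0. Proof. by have [] := ideal_gen_ideal X. Qed.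
Let ID x y : ideal_gen X x -> ideal_gen X y -> ideal_gen X (x + y).
Proof. by have [_ h _] := ideal_gen_ideal X; apply: h. Qed.
Let IMl a x : ideal_gen X x -> ideal_gen X (a * x).
Proof. by have [_ _ h] := ideal_gen_ideal X => /(h a) []. Qed.
Let IMr a x : ideal_gen X x -> ideal_gen X (x * a).
Proof. by have [_ _ h] := ideal_gen_ideal X => /(h a) []. Qed.
Let IN x : ideal_gen X x -> ideal_gen X (- x).
Proof. by rewrite -mulN1r; apply: IMl. Qed.

Fact quo_rel_refl : reflexive quo_rel.
Proof. by move=> x; apply/asboolP; rewrite subrr. Qed.
Fact quo_rel_sym : symmetric quo_rel.
Proof.
by move=> x y; apply/asboolP/asboolP => /IN; rewrite opprB.
Qed.
Fact quo_rel_trans : transitive quo_rel.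
Proof.
move=> y x z /asboolP hxy /asboolP hyz; apply/asboolP.
by have := ID hxy hyz; rewrite addrA subrK.
Qed.

Canonical quo_equiv := EquivRel quo_rel quo_rel_refl quo_rel_sym quo_rel_trans.

Definition quo : Type := {eq_quot quo_equiv}.

HB.instance Definition _ := Choice.on quo.
HB.instance Definition _ := Quotient.on quo.

Definition quo_pi (x : R) : quo := \pi_{eq_quot quo_equiv} x.

Lemma quo_piP x y : quo_pi x = quo_pi y <-> ideal_gen X (x - y).
Proof.
split=> [/eqmodP /= /asboolP //|h].
by apply/eqmodP; apply/asboolP.
Qed.

Lemma quo_reprK (x : quo) : quo_pi (repr x) = x.
Proof. exact: reprK. Qed.

Let qadd (x y : quo) : quo := quo_pi (repr x + repr y).
Let qopp (x : quo) : quo := quo_pi (- repr x).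
Let qmul (x y : quo) : quo := quo_pi (repr x * repr y).

Let qaddE x y : qadd (quo_pi x) (quo_pi y) = quo_pi (x + y).
Proof.
have /quo_piP hx := quo_reprK (quo_pi x).
have /quo_piP hy := quo_reprK (quo_pi y).
by apply/quo_piP; rewrite opprD addrACA; apply: ID.
Qed.
Let qoppE x : qopp (quo_pi x) = quo_pi (- x).
Proof.
have /quo_piP hx := quo_reprK (quo_pi x).
by apply/quo_piP; rewrite -opprD; apply: IN.
Qed.
Let qmulE x y : qmul (quo_pi x) (quo_pi y) = quo_pi (x * y).
Proof.
have /quo_piP hx := quo_reprK (quo_pi x).
have /quo_piP hy := quo_reprK (quo_pi y).
apply/quo_piP; move: (repr _) hx (repr _) hy => a ha b hb.
have -> : a * b - x * y = (a - x) * b + x * (b - y).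
  by rewrite mulrBl mulrBr addrA subrK.
exact: ID (IMr _ ha) (IMl _ hb).
Qed.

Let qW (P : quo -> Prop) : (forall x, P (quo_pi x)) -> forall x, P x.
Proof. by move=> h x; rewrite -(quo_reprK x). Qed.

Fact quo_addA : associative qadd.
Proof.
by elim/qW=> x; elim/qW=> y; elim/qW=> z; rewrite !qaddE addrA.
Qed.
Fact quo_addC : commutative qadd.
Proof. by elim/qW=> x; elim/qW=> y; rewrite !qaddE addrC. Qed.
Fact quo_add0 : left_id (quo_pi 0) qadd.
Proof. by elim/qW=> x; rewrite !qaddE add0r. Qed.
Fact quo_addN : left_inverse (quo_pi 0) qopp qadd.
Proof. by elim/qW=> x; rewrite qoppE qaddE addNr. Qed.

HB.instance Definition _ :=
  GRing.isZmodule.Build quo quo_addA quo_addC quo_add0 quo_addN.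

Fact quo_mulA : associative qmul.
Proof.
by elim/qW=> x; elim/qW=> y; elim/qW=> z; rewrite !qmulE mulrA.
Qed.
Fact quo_mul1 : left_id (quo_pi 1) qmul.
Proof. by elim/qW=> x; rewrite !qmulE mul1r. Qed.
Fact quo_mulr1 : right_id (quo_pi 1) qmul.
Proof. by elim/qW=> x; rewrite !qmulE mulr1. Qed.
Fact quo_mulDl : left_distributive qmul +%R.
Proof.
elim/qW=> x; elim/qW=> y; elim/qW=> z.
by rewrite [_ + _]qaddE !qmulE [RHS]qaddE mulrDl.
Qed.
Fact quo_mulDr : right_distributive qmul +%R.
Proof.
elim/qW=> x; elim/qW=> y; elim/qW=> z.
by rewrite [_ + _]qaddE !qmulE [RHS]qaddE mulrDr.
Qed.

HB.instance Definition _ :=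
  GRing.Zmodule_isPzRing.Build quo
    quo_mulA quo_mul1 quo_mulr1 quo_mulDl quo_mulDr.

Fact quo_pi_zmod_morphism : zmod_morphism quo_pi.
Proof. by move=> x y; rewrite [- quo_pi y]qoppE [RHS]qaddE. Qed.
Fact quo_pi_monoid_morphism : monoid_morphism quo_pi.
Proof. by split=> // x y; rewrite [RHS]qmulE. Qed.

HB.instance Definition _ :=
  GRing.isZmodMorphism.Build R quo quo_pi quo_pi_zmod_morphism.
HB.instance Definition _ :=
  GRing.isMonoidMorphism.Build R quo quo_pi quo_pi_monoid_morphism.
End QuotientRing.

(* The tensor product over k: formal sums of pairs (v, w), two of them being
   identified when no bilinear map separates them.  The scalars of a formal
   linear combination of pairs are absorbed in the first component. *)

Definition bilin (k : fieldType) (V W U : lmodType k) (f : V -> W -> U) : Prop :=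
  (forall v, linear (f v)) /\ (forall w, linear (f^~ w)).

Section Tensor.
Variables (k : fieldType) (V W : lmodType k).
Implicit Types (s t : seq (V * W)) (U : lmodType k).

Definition formal_sum U (f : V -> W -> U) s : U := \sum_(p <- s) f p.1 p.2.

Definition tens_rel s t : bool :=
  `[< forall U (f : V -> W -> U), bilin f -> formal_sum f s = formal_sum f t >].

Fact tens_rel_refl : reflexive tens_rel.
Proof. by move=> s; apply/asboolP. Qed.
Fact tens_rel_sym : symmetric tens_rel.
Proof. by move=> s t; apply/asboolP/asboolP => h U f hf; rewrite h. Qed.
Fact tens_rel_trans : transitive tens_rel.
Proof.
move=> t s u /asboolP h1 /asboolP h2; apply/asboolP => U f hf.
by rewrite h1 ?h2.
Qed.

Canonical tens_equiv :=
  EquivRel tens_rel tens_rel_refl tens_rel_sym tens_rel_trans.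

Definition tens : Type := {eq_quot tens_equiv}.

HB.instance Definition _ := Choice.on tens.
HB.instance Definition _ := Quotient.on tens.

Definition tens_pi s : tens := \pi_{eq_quot tens_equiv} s.

Definition pure (v : V) (w : W) : tens := tens_pi [:: (v, w)].

(* The linear map induced by f; meaningful when f is bilinear. *)
Definition tlift U (f : V -> W -> U) (x : tens) : U := formal_sum f (repr x).

Lemma tens_piP s t : tens_pi s = tens_pi t <->
  forall U (f : V -> W -> U), bilin f -> formal_sum f s = formal_sum f t.
Proof.
split=> [/eqmodP /= /asboolP //|h].
by apply/eqmodP; apply/asboolP.
Qed.

Lemma tens_reprK (x : tens) : tens_pi (repr x) = x.
Proof. exact: reprK. Qed.

Lemma tlift_pi U (f : V -> W -> U) s :
  bilin f -> tlift f (tens_pi s) = formal_sum f s.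
Proof. by move=> hf; apply: (tens_piP _ _).1 hf; apply: tens_reprK. Qed.

Let tadd (x y : tens) : tens := tens_pi (repr x ++ repr y).
Let topp (x : tens) : tens := tens_pi [seq (- p.1, p.2) | p <- repr x].
Let tscale (a : k) (x : tens) : tens :=
  tens_pi [seq (a *: p.1, p.2) | p <- repr x].

Lemma tensP (x y : tens) :
  (forall U (f : V -> W -> U), bilin f -> tlift f x = tlift f y) -> x = y.
Proof.
move=> h; rewrite -(tens_reprK x) -(tens_reprK y).
by apply/tens_piP => U f hf; apply: h.
Qed.

Lemma bilin_scalel U (f : V -> W -> U) a v w :
  bilin f -> f (a *: v) w = a *: f v w.
Proof.
move=> [_ hf].
have f0 : f 0 w = 0.
  have /= := hf w 1 0 0; rewrite !scale1r addr0 => e.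
  by apply: (addrI (f 0 w)); rewrite -e addr0.
by have /= := hf w a v 0; rewrite f0 !addr0.
Qed.

Let tlift_add U (f : V -> W -> U) x y :
  bilin f -> tlift f (tadd x y) = tlift f x + tlift f y.
Proof. by move=> hf; rewrite tlift_pi // /formal_sum big_cat. Qed.
Let tlift_scale U (f : V -> W -> U) a x :
  bilin f -> tlift f (tscale a x) = a *: tlift f x.
Proof.
move=> hf; rewrite tlift_pi // /tlift /formal_sum big_map scaler_sumr.
by apply: eq_bigr => p _; rewrite /= bilin_scalel.
Qed.
Let tlift_opp U (f : V -> W -> U) x :
  bilin f -> tlift f (topp x) = - tlift f x.
Proof.
move=> hf; rewrite tlift_pi // /tlift /formal_sum big_map -sumrN.
by apply: eq_bigr => p _; rewrite /= -scaleN1r bilin_scalel // scaleN1r.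
Qed.
Let tlift_zero U (f : V -> W -> U) : bilin f -> tlift f (tens_pi [::]) = 0.
Proof. by move=> hf; rewrite tlift_pi // /formal_sum big_nil. Qed.

Fact tens_addA : associative tadd.
Proof.
by move=> x y z; apply: tensP => U f hf; rewrite !tlift_add // addrA.
Qed.
Fact tens_addC : commutative tadd.
Proof. by move=> x y; apply: tensP => U f hf; rewrite !tlift_add // addrC. Qed.
Fact tens_add0 : left_id (tens_pi [::]) tadd.
Proof.
by move=> x; apply: tensP => U f hf; rewrite tlift_add // tlift_zero // add0r.
Qed.
Fact tens_addN : left_inverse (tens_pi [::]) topp tadd.
Proof.
move=> x; apply: tensP => U f hf.
by rewrite tlift_add // tlift_opp // tlift_zero // addNr.
Qed.

HB.instance Definition _ :=
  GRing.isZmodule.Build tens tens_addA tens_addC tens_add0 tens_addN.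

Fact tens_scaleA a b x : tscale a (tscale b x) = tscale (a * b) x.
Proof. by apply: tensP => U f hf; rewrite !tlift_scale // scalerA. Qed.
Fact tens_scale1 : left_id 1 tscale.
Proof. by move=> x; apply: tensP => U f hf; rewrite tlift_scale // scale1r. Qed.
Fact tens_scaleDr : right_distributive tscale +%R.
Proof.
move=> a x y; apply: tensP => U f hf.
by rewrite tlift_scale // !tlift_add // !tlift_scale // scalerDr.
Qed.
Fact tens_scaleDl x : {morph tscale^~ x : a b / a + b}.
Proof.
move=> a b; apply: tensP => U f hf.
by rewrite tlift_add // !tlift_scale // scalerDl.
Qed.

HB.instance Definition _ :=
  GRing.Zmodule_isLmodule.Build k tens
    tens_scaleA tens_scale1 tens_scaleDr tens_scaleDl.

Lemma tliftP U (f : V -> W -> U) : bilin f -> linear (tlift f).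
Proof.
move=> hf a x y.
by rewrite [tlift _ _]tlift_add // [tlift _ (_ *: _)]tlift_scale.
Qed.

Lemma tlift_pure U (f : V -> W -> U) v w : bilin f -> tlift f (pure v w) = f v w.
Proof. by move=> hf; rewrite tlift_pi // /formal_sum big_seq1. Qed.

Lemma pure_bilin : bilin pure.
Proof.
split=> [v a w w'|w a v v']; apply: tensP => U f hf;
  rewrite tliftP // !tlift_pure //; case: hf => h1 h2;
  [exact: h1|exact: h2].
Qed.

Lemma tens_piE s : tens_pi s = \sum_(p <- s) pure p.1 p.2.
Proof.
elim: s => [|[v w] s IH]; first by rewrite big_nil.
rewrite big_cons -IH; apply: tensP => U f hf.
rewrite -[_ + tens_pi s]/(tadd _ _) tlift_add // tlift_pure // !tlift_pi //.
by rewrite /formal_sum big_cons.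
Qed.

Lemma tens_ind (P : tens -> Prop) :
  P 0 -> (forall v w x, P x -> P (pure v w + x)) -> forall x, P x.
Proof.
move=> P0 PD x; rewrite -(tens_reprK x) tens_piE.
by elim: (repr x) => [|p s IH]; rewrite ?big_nil ?big_cons //; apply: PD.
Qed.
End Tensor.

Definition tmap (k : fieldType) (V W V' W' : lmodType k)
  (f : V -> V') (g : W -> W') : tens V W -> tens V' W' :=
  tlift (fun v w => pure (f v) (g w)).

Definition tassoc (k : fieldType) (U V W : lmodType k) :
    tens (tens U V) W -> tens U (tens V W) :=
  tlift (fun x w => tlift (fun u v => pure u (pure v w)) x).

(* For modules V over A and W over B, the A (x) B-module V (x) W, with
   (a (x) b) (v (x) w) = av (x) bw; A (x) B itself is the special case of the
   regular modules. *)

Section TensorAction.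
Variables (k : fieldType) (A B : algType k) (V W : lmodType k).
Variables (fA : A -> V -> V) (fB : B -> W -> W).
Hypotheses (fAl : bilin fA) (fBl : bilin fB).

Definition tact (z : tens A B) (x : tens V W) : tens V W :=
  tlift (fun a b => tmap (fA a) (fB b) x) z.

Let pl (x : V) (a : k) (w w' : W) :
  pure x (a *: w + w') = a *: pure x w + pure x w'.
Proof. exact: (pure_bilin V W).1. Qed.
Let pr (w : W) (a : k) (x x' : V) :
  pure (a *: x + x') w = a *: pure x w + pure x' w.
Proof. exact: (pure_bilin V W).2. Qed.

Lemma tact_bilin_in a b : bilin (fun v w => pure (fA a v) (fB b w)).
Proof.
split=> [v c w w'|w c v v'] /=.
  by rewrite fBl.1 pl.
by rewrite fAl.1 pr.
Qed.

Lemma tact_bilin_out x : bilin (fun a b => tmap (fA a) (fB b) x).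
Proof.
have h a b := tact_bilin_in a b.
have lin a b := tliftP (h a b).
split=> [a c b b'|b c a a'] /=; elim/tens_ind: x => [|v w x IH].
- have z a1 b1 : tmap (fA a1) (fB b1) (0 : tens V W) = 0.
    by have := lin a1 b1 (-1) 0 0; rewrite scaler0 addr0 scaleN1r addNr.
  by rewrite !z scaler0 addr0.
- have D a1 b1 : tmap (fA a1) (fB b1) (pure v w + x) =
      pure (fA a1 v) (fB b1 w) + tmap (fA a1) (fB b1) x.
    by have := lin a1 b1 1 (pure v w) x; rewrite !scale1r tlift_pure.
  by rewrite !D IH (fBl.2 w) pl scalerDr addrACA.
- have z a1 b1 : tmap (fA a1) (fB b1) (0 : tens V W) = 0.
    by have := lin a1 b1 (-1) 0 0; rewrite scaler0 addr0 scaleN1r addNr.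
  by rewrite !z scaler0 addr0.
- have D a1 b1 : tmap (fA a1) (fB b1) (pure v w + x) =
      pure (fA a1 v) (fB b1 w) + tmap (fA a1) (fB b1) x.
    by have := lin a1 b1 1 (pure v w) x; rewrite !scale1r tlift_pure.
  by rewrite !D IH (fAl.2 v) pr scalerDr addrACA.
Qed.

Lemma tact_pure a b v w :
  tact (pure a b) (pure v w) = pure (fA a v) (fB b w).
Proof.
rewrite /tact tlift_pure; last exact: tact_bilin_out.
by rewrite /tmap tlift_pure //; apply: tact_bilin_in.
Qed.

Lemma tactDl x : {morph tact^~ x : z z' / z + z'}.
Proof.
move=> z z'; have := tliftP (tact_bilin_out x) 1 z z'.
by rewrite !scale1r.
Qed.

Lemma tact0l x : tact 0 x = 0.
Proof. by apply: (addrI (tact 0 x)); rewrite -tactDl !addr0. Qed.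

Lemma tactDr z : {morph tact z : x y / x + y}.
Proof.
move=> x y; elim/tens_ind: z => [|a b z IH]; first by rewrite !tact0l addr0.
rewrite !tactDl IH addrACA; congr (_ + _).
rewrite /tact !tlift_pure; try exact: tact_bilin_out.
by have := tliftP (tact_bilin_in a b) 1 x y; rewrite !scale1r.
Qed.

Lemma tact0r z : tact z 0 = 0.
Proof. by apply: (addrI (tact z 0)); rewrite -tactDr !addr0. Qed.
End TensorAction.

Section TensorAlgebra.
Variables (k : fieldType) (A B : algType k).

Lemma mul_bilin (R : algType k) : bilin (fun x y : R => x * y).
Proof.
split=> [x a y y'|y a x x'] /=; first by rewrite mulrDr scalerAr.
by rewrite mulrDl scalerAl.
Qed.

(* (a (x) b) (c (x) d) = ac (x) bd *)
Definition tmul : tens A B -> tens A B -> tens A B := tact *%R *%R.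

Let mA := mul_bilin A.
Let mB := mul_bilin B.
Let mp a b c d : tmul (pure a b) (pure c d) = pure (a * c) (b * d).
Proof. exact: tact_pure. Qed.
Let mDl x y z : tmul (x + y) z = tmul x z + tmul y z.
Proof. exact: tactDl. Qed.
Let mDr x y z : tmul x (y + z) = tmul x y + tmul x z.
Proof. exact: tactDr. Qed.
Let m0l x : tmul 0 x = 0. Proof. exact: tact0l. Qed.
Let m0r x : tmul x 0 = 0. Proof. exact: tact0r. Qed.

Fact tens_mulA : associative tmul.
Proof.
move=> x y z; elim/tens_ind: x => [|a b x IH]; first by rewrite !m0l.
rewrite !mDl {}IH; congr (_ + _); clear x.
elim/tens_ind: y => [|c d y IH]; first by rewrite !(m0l,m0r).
rewrite !(mDl,mDr) {}IH; congr (_ + _); clear y.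
elim/tens_ind: z => [|e f z IH]; first by rewrite !m0r.
by rewrite !mDr {}IH !mp !mulrA.
Qed.
Fact tens_mul1l : left_id (pure 1 1) tmul.
Proof.
elim/tens_ind=> [|a b x IH]; first exact: m0r.
by rewrite mDr IH mp !mul1r.
Qed.
Fact tens_mul1r : right_id (pure 1 1) tmul.
Proof.
elim/tens_ind=> [|a b x IH]; first exact: m0l.
by rewrite mDl IH mp !mulr1.
Qed.

HB.instance Definition _ :=
  GRing.Zmodule_isPzRing.Build (tens A B)
    tens_mulA tens_mul1l tens_mul1r mDl mDr.
End TensorAlgebra.

Definition outer_tens (k : fieldType) (A B : algType k)
  (V : lmodType A) (W : lmodType B) : Type :=
  tens (restr (in_alg A) V) (restr (in_alg B) W).

Section OuterTensor.
Variables (k : fieldType) (A B : algType k) (V : lmodType A) (W : lmodType B).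

HB.instance Definition _ := GRing.Zmodule.on (outer_tens V W).

Lemma act_bilin (R : algType k) (M : lmodType R) :
  bilin (fun (x : R) (v : restr (in_alg R) M) =>
           (x *: (v : M)) : restr (in_alg R) M).
Proof.
split=> [x a v v'|v a x x'] /=.
  rewrite scalerDr; congr (_ + _).
  by rewrite [LHS]scalerA [RHS]scalerA /= -scalerAr mulr1 -scalerAl mul1r.
rewrite scalerDl; congr (_ + _).
by rewrite [RHS]scalerA /= -scalerAl mul1r.
Qed.

Definition outer_act : tens A B -> outer_tens V W -> outer_tens V W :=
  tact (fun (a : A) (v : restr (in_alg A) V) => a *: (v : V))
       (fun (b : B) (w : restr (in_alg B) W) => b *: (w : W)).

Let aA := act_bilin V.
Let aB := act_bilin W.
Let ap (a : A) (b : B) (v : V) (w : W) :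
  outer_act (pure a b)
    (pure (v : restr (in_alg A) V) (w : restr (in_alg B) W)) =
  pure (a *: v : restr (in_alg A) V) (b *: w : restr (in_alg B) W).
Proof. exact: (tact_pure aA aB). Qed.
Let aDl (y : outer_tens V W) : {morph outer_act^~ y : z z' / z + z'}.
Proof. exact: (tactDl aA aB). Qed.
Let a0l (y : outer_tens V W) : outer_act 0 y = 0.
Proof. exact: (tact0l aA aB). Qed.
Let aDr z : {morph outer_act z : x y / x + y}.
Proof. exact: (tactDr aA aB). Qed.
Let a0r z : outer_act z 0 = 0. Proof. exact: (tact0r aA aB). Qed.

Fact outer_actA x y z : outer_act x (outer_act y z) = outer_act (x * y) z.
Proof.
elim/tens_ind: x => [|a b x IH]; first by rewrite mul0r !a0l.
rewrite mulrDl !aDl {}IH; congr (_ + _); clear x.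
elim/tens_ind: y => [|c d y IH]; first by rewrite mulr0 !(a0l,a0r).
rewrite mulrDr !(aDl,aDr) {}IH; congr (_ + _); clear y.
elim/tens_ind: z => [|v w z IH]; first by rewrite !a0r.
rewrite !aDr {}IH; congr (_ + _); rewrite !ap !scalerA.
have -> : pure a b * pure c d = pure (a * c) (b * d) :> tens A B.
  by apply: tact_pure; apply: mul_bilin.
by rewrite ap.
Qed.
Fact outer_act1 : left_id 1 outer_act.
Proof.
elim/tens_ind=> [|v w x IH]; first exact: a0r.
by rewrite aDr IH ap !scale1r.
Qed.

HB.instance Definition _ :=
  GRing.Zmodule_isLmodule.Build (tens A B) (outer_tens V W)
    outer_actA outer_act1 aDr aDl.
End OuterTensor.

HB.mixin Record Algebra_isHopf (k : fieldType) H of GRing.Algebra k H := {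
  comul : H -> tens H H;
  counit : H -> k;
  antipode : H -> H;
  comul_linear : linear comul;
  comul_monoid_morphism : monoid_morphism comul;
  counit_scalar : scalar counit;
  counit_monoid_morphism : monoid_morphism counit;
  antipode_linear : linear antipode;
  comulA : forall h, tassoc (tmap comul id (comul h)) = tmap id comul (comul h);
  counitl : forall h, tlift (fun a b : H => counit a *: b) (comul h) = h;
  counitr : forall h, tlift (fun a b : H => counit b *: a) (comul h) = h;
  antipodel : forall h,
    tlift (fun a b : H => antipode a * b) (comul h) = (counit h)%:A;
  antipoder : forall h,
    tlift (fun a b : H => a * antipode b) (comul h) = (counit h)%:A
}.

#[short(type="hopfAlgType")]
HB.structure Definition HopfAlgebra (k : fieldType) :=
  { H of Algebra_isHopf k H & GRing.Algebra k H }.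

Section HopfModules.
Variables (k : fieldType) (H : hopfAlgType k).

HB.instance Definition _ :=
  GRing.isLinear.Build k H (tens H H) *:%R (@comul k H) (@comul_linear k H).
HB.instance Definition _ :=
  GRing.isMonoidMorphism.Build H (tens H H) (@comul k H)
    (@comul_monoid_morphism k H).

(* V (x) W, on which h acts as the sum of the h_(1) (x) h_(2) *)
Definition hopf_tens (V W : lmodType H) : lmodType H :=
  restr (@comul k H) (outer_tens V W).

Definition finite_dim (V : lmodType H) : Prop :=
  exists d, has_dim (restr (in_alg H) V) d.

Definition chevalley_property : Prop :=
  forall V W : lmodType H,
    irreducible V -> finite_dim V -> irreducible W -> finite_dim W ->
    completely_reducible (hopf_tens V W).
End HopfModules.

Definition affine (k : fieldType) (A : algType k) : Prop :=
  exists s : seq A, forall B : {pred A},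
    GRing.subalg_closed B -> {subset s <= B} -> forall x, x \in B.

(* The central subalgebra C of A is given by its inclusion iota : C -> A. *)

Section CayleyHamilton.
Variables (k : fieldType) (A : algType k) (C : comAlgType k).
Variables (iota : {lrmorphism C -> A}) (tr : A -> C).

Definition algebra_with_trace : Prop :=
  [/\ injective iota,
      forall c a, iota c * a = a * iota c,
      forall a b, tr (a + b) = tr a + tr b,
      forall c a, tr (iota c * a) = c * tr a
    & forall a b, tr (a * b) = tr (b * a)].

(* The row and column indices start at 0. *)
Definition newton_mx (j : nat) (a : A) : 'M[C]_j :=
  \matrix_(r < j, s < j)
    if (s <= r)%N then tr (a ^+ (r - s).+1)
    else if s == r.+1 :> nat then r.+1%:R else 0.

Definition ch_coef (j : nat) (a : A) : C :=
  (j`!%:R : k)^-1 *: \det (newton_mx j a).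

Definition ch_poly (n : nat) (a : A) : {poly C} :=
  \sum_(j < n.+1) ((-1) ^+ j * ch_coef j a) *: 'X^(n - j).

Definition cayley_hamilton (n : nat) : Prop :=
  [/\ algebra_with_trace,
      forall a, (map_poly iota (ch_poly n a)).[a] = 0
    & tr 1 = n%:R].

Definition discriminant_ideal (j : nat) : set C :=
  ideal_gen [set d | exists a : 'I_j -> A,
                       d = \det (\matrix_(r < j, s < j) tr (a r * a s))].

(* The fiber algebra A/mA: as iota(C) is central, mA is the two-sided ideal
   generated by iota(m). *)
Definition fiber (m : set C) : pzRingType := quo (iota @` m).

Definition fiber_scalar (m : set C) : {rmorphism k -> fiber m} :=
  @quo_pi A (iota @` m) \o in_alg A.

Definition is_square_dim (m : set C) (N : nat) : Prop :=
  exists (n : nat) (V : 'I_n -> lmodType (fiber m)) (d : 'I_n -> nat),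
    [/\ forall i, irreducible (V i),
        forall i j, module_iso (V i) (V j) -> i = j,
        forall M : lmodType (fiber m),
          irreducible M -> exists i, module_iso M (V i),
        forall i, has_dim (restr (fiber_scalar m) (V i)) (d i)
      & N = (\sum_i d i ^ 2)%N].

(* The value 0 is a default, which is not used when A/mA is finite
   dimensional. *)
Definition square_dim (m : set C) : nat := xget 0%N [set N | is_square_dim m N].
End CayleyHamilton.

Section CayleyHamiltonHopf.
Variables (k : fieldType) (H : hopfAlgType k) (C : comAlgType k).
Variables (iota : {lrmorphism C -> H}) (tr : H -> C).

Definition hopf_subalgebra : Prop :=
  (forall c, exists x : tens C C, comul (iota c) = tmap iota iota x) /\
  (forall c, exists d, antipode (iota c) = iota d).

Definition cayley_hamilton_hopf : Prop :=
  (exists n, cayley_hamilton iota tr n) /\ hopf_subalgebra.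

Definition counit_ideal : set C := [set c | counit (iota c) = 0].
End CayleyHamiltonHopf.

(* Main.v *)
Require Import Defs.
From HB Require Import structures.
From mathcomp Require Import all_boot all_order all_algebra generic_quotient.
From mathcomp Require Import boolp classical_sets.
From mathcomp Require Import ring zify.

Set Implicit Arguments.
Unset Strict Implicit.
Unset Printing Implicit Defensive.

Import GRing.Theory.
Local Open Scope ring_scope.
Local Open Scope classical_set_scope.

(** Read H as an algebra over C through iota. A character chi of C turns the
    trace into the k-valued form (x, y) |-> chi (tr (x y)) on H, and everything
    happens by comparing its radical T(chi) with m(chi) H, where m(chi) is the
    kernel of chi. One always has m(chi) H <= T(chi). An element of T(chi) has
    all its powers of trace 0 at chi, so that its characteristic polynomial is
    t^n at chi: hence T(chi) is nil of bounded index modulo m(chi) H, and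
    nilpotent by the Nagata-Higman theorem. So H / T(chi) is the largest
    semisimple quotient of the fiber H / m(chi) H. It is a product of matrix
    algebras, whose dimension is at the same time the value of the square
    dimension at m(chi), the rank of the form, and the largest size N(chi) of a
    tuple whose discriminant is not killed by chi ([square_dim_rank]).

    Since H is prime, C is a domain, the trace form is nondegenerate over C, and
    a tuple a of the largest size N with d = disc a nonzero has a dual tuple b,
    for which d h = \sum_i tr (h b_i) a_i ([dual_expansion]). The key point is
    [commutative_of_central_integral]: if the counit does not kill d, then H is
    commutative. Indeed u = \sum_i eps(a_i) b_i is then an integral of the
    identity fiber, x u = u x = eps(x) u modulo m(eps) H, and
    z = \sum_i a_i u b_i is a central element of H with eps(z) nonzero which
    multiplies the augmentation ideal into m(eps) H. Cayley's determinant trick,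
    over the polynomials in z, gives a central element outside the kernel of eps
    that annihilates all commutators; it is not a zero divisor, as H is prime.

    Each of the other conditions provides such a tuple. If the N-th discriminant
    ideal is C, it is not contained in m(eps). If the square dimension is
    constant, its value N at a generic character is also its value at m(eps). If
    T(eps) = m(eps) H, a basis of the identity fiber lifts by Nakayama's lemma to
    a tuple that spans H locally at m(eps)
    ([dual_expansion_at_character]); this happens when the identity fiber is
    semisimple, because T(eps) is nilpotent modulo m(eps) H. It also happens
    under the Chevalley property ([chevalley_radical]): for a generic chi, the
    fibers over chi and over its convolution inverse chi o S are semisimple,
    their tensor products V (x) W are modules over the identity fiber, and T(eps)
    acts on these nilpotently, hence by zero when they are completely reducible;
    an element x that acts by zero on all of them can be recovered from its
    coproduct by the antipode, and lies in m(eps) H.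

    Conversely, let H be commutative. Its finite-dimensional irreducible modules
    are one-dimensional, which gives the Chevalley property, hence
    T(eps) = m(eps) H. Every maximal ideal of C is the kernel of the restriction
    of a character theta of H, and h |-> \sum theta(h_1) h_2 is an automorphism
    of H that carries the fiber over it to the identity fiber. So
    T(chi) = m(chi) H and N(chi) = N for all characters chi of C, which gives the
    remaining conditions. *)

(** * Nil rings of bounded index are nilpotent *)

(** Vandermonde elimination without division: a polynomial in m with
    coefficients h i, multiplied by 2 ^ n and diminished by its value at 2 m,
    loses its leading coefficient. It is stated for a subgroup I that is
    saturated for multiplication by positive integers, because in the
    applications the coefficients are only known modulo such a subgroup. *)
Lemma poly_values_coef (V : zmodType) (I : set V) n (h : nat -> V) :
  (forall x y, I x -> I y -> I (x - y)) ->
  (forall x m, I (x *+ m.+1) -> I x) ->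
  (forall m, I (\sum_(i < n) h i *+ m ^ i)) -> forall i, (i < n)%N -> I (h i).
Proof.
move=> IB Isat; elim: n h => [|n IH] h hS //.
have I0 : I 0 by have /= := IB _ _ (hS 0%N) (hS 0%N); rewrite subrr.
have ID x y : I x -> I y -> I (x + y).
  by move=> Ix Iy; rewrite -[y]opprK -[- y]sub0r; apply: (IB) => //; apply: IB.
have Imul x m : I x -> I (x *+ m).
  by move=> Ix; elim: m => [|m Im]; rewrite ?mulr0n // mulrS; apply: ID.
have low i : (i < n)%N -> I (h i).
  move=> ltin; suff: I (h i *+ (2 ^ n - 2 ^ i)).
    have: (0 < 2 ^ n - 2 ^ i)%N by rewrite subn_gt0 ltn_exp2l.
    by case: (_ - _)%N => // m _; apply: Isat.
  move: i ltin; apply: IH => m.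
  rewrite (_ : \sum_(i < n) _ = (\sum_(i < n.+1) h i *+ m ^ i) *+ 2 ^ n
                 - \sum_(i < n.+1) h i *+ (2 * m) ^ i); last first.
    rewrite !big_ord_recr /= mulrnDl opprD addrACA expnMn -[h n *+ _ *+ _]mulrnA (mulnC (m ^ n)%N).
    rewrite subrr addr0 -sumrMnl -sumrB; apply: eq_bigr => i _.
    rewrite expnMn -!mulrnA -mulrnBr; last by rewrite mulnC leq_mul // leq_exp2l // ltnW.
    by congr (_ *+ _); rewrite mulnBl [(_ * 2 ^ n)%N]mulnC.
  by apply: IB => //; apply: Imul.
move=> i; rewrite ltnS leq_eqVlt => /orP [/eqP -> |]; last exact: low.
have -> : h n = (\sum_(i < n.+1) h i *+ 1 ^ i) - \sum_(i < n) h i.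
  rewrite big_ord_recr /= exp1n mulr1n.
  under eq_bigr do rewrite exp1n mulr1n.
  by rewrite addrAC subrr add0r.
apply: IB => //; elim/big_ind: _ => // j _; exact: low.
Qed.

(** The expansion of a power of x + m y with respect to the integer m, for
    noncommuting x and y; only the linear coefficient is made explicit, since it
    is what the linearization of x ^ N = 0 produces. *)
Lemma exp_linear_coef (A : nzRingType) (x y : A) N :
  exists h : nat -> A,
    (forall m, (x + y *+ m) ^+ N = \sum_(i < N.+1) h i *+ m ^ i) /\
    h 1%N = \sum_(i < N) x ^+ i * y * x ^+ (N.-1 - i).
Proof.
suff [h [h1 h2 h3 h4]] : exists h : nat -> A,
  [/\ forall m, (x + y *+ m) ^+ N = \sum_(i < N.+1) h i *+ m ^ i,
      h 1%N = \sum_(i < N) x ^+ i * y * x ^+ (N.-1 - i),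
      h 0%N = x ^+ N & h N.+1 = 0] by exists h.
elim: N => [|N [h [h1 h2 h3 h4]]].
  exists (fun i => if i is 0%N then 1 else 0); split=> //; last first.
    by rewrite big_ord0.
  by move=> m; rewrite big_ord1.
pose g i := if (i <= N)%N then h i else 0.
have gE i : (i <= N)%N -> g i = h i by rewrite /g => ->.
have gN : g N.+1 = 0 by rewrite /g ltnn.
exists (fun i => x * g i + if i is j.+1 then y * g j else 0); split.
- move=> m; rewrite exprS h1 mulrDl !mulr_sumr.
  under [RHS]eq_bigr do rewrite mulrnDl.
  rewrite big_split /= [X in _ = X + _]big_ord_recr /= gN mulr0 mul0rn addr0; congr (_ + _).
    by apply: eq_bigr => i _; rewrite gE ?mulrnAr // -ltnS.
  rewrite [RHS]big_ord_recl /= mul0rn add0r; apply: eq_bigr => i _.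
  rewrite /bump /= add0n gE; last by rewrite -ltnS.
  by rewrite expnS mulnC mulrnA mulrnAl mulrnAr.
- rewrite big_ord_recl /= expr0 mul1r subn0 (gE 0%N) // h3 addrC; congr (_ + _).
  case: N h2 {h1 h3 h4} @g gE gN => [|N] h2 g gE gN.
    by rewrite big_ord0 gN mulr0.
  rewrite gE // h2 mulr_sumr; apply: eq_bigr => i _.
  by rewrite /bump /= add1n exprS !mulrA subSS.
- by rewrite /= gE // h3 addr0 exprS.
- by rewrite gN mulr0 addr0 /g ltnNge leqnSn mulr0.
Qed.

(** The Nagata-Higman theorem, in Higman's form of the proof. Linearizing x ^ n
    = 0 gives the vanishing of the sums of x ^ i y x ^ (n - 1 - i), from which x
    ^ (n - 1) z y ^ (n - 1) = 0 follows by computing a double sum in two ways.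
    Then induction applies on both sides of z: to the annihilator of all z y ^
    (n - 1), and then to the annihilator of all products of the previous step.
    Nilpotency is expressed by a pair I of R of sets instead of a quotient ring,
    so that I may be a fiber ideal or a piece of a filtration. *)
Lemma nagata_higman (A : nzRingType) (n : nat) : exists M : nat,
  forall R I : set A,
    (forall x y, R x -> R y -> R (x + y)) ->
    (forall x y, R x -> R y -> R (x * y)) ->
    (forall x y, I x -> I y -> I (x - y)) ->
    (forall x y, R x -> I y -> I (x * y) /\ I (y * x)) ->
    (forall x m, I (x *+ m.+1) -> I x) ->
    (forall x, R x -> I (x ^+ n)) ->
    forall s : seq A, size s = M -> (forall x, x \in s -> R x) ->
      I (\prod_(x <- s) x).
Proof.
elim: n => [|n [M IH]].
  exists 1%N => R I _ _ _ IM _ I1 [|x [|]] //= _ sR.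
  have Rx : R x by apply: sR; rewrite inE.
  by have [+ _] := IM _ _ Rx (I1 x Rx); rewrite big_seq1 expr0 mulr1.
case: n IH => [|n] IH.
  exists 1%N => R I _ _ _ _ _ I1 [|x [|]] //= _ sR.
  by rewrite big_seq1 -[x]expr1; apply: I1; apply: sR; rewrite inE.
exists (M + M.+1)%N => R I RD RM IB IM Isat In.
have RX x m : R x -> R (x ^+ m.+1).
  by move=> Rx; elim: m => // m Rm; rewrite exprS; apply: RM.
have Rn x y m : R x -> R y -> R (x + y *+ m).
  by move=> Rx Ry; elim: m => [|m Rm]; rewrite ?addr0 // mulrSr addrA; apply: RD.
have IMX x y m : I x -> R y -> I (x * y ^+ m).
  by case: m => [|m] Ix Ry; rewrite ?mulr1 //; apply: (IM _ _ (RX _ m Ry) Ix).2.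
have lin x y : R x -> R y -> I (\sum_(i < n.+2) x ^+ i * y * x ^+ (n.+1 - i)).
  move=> Rx Ry; have [h [h1 h2]] := exp_linear_coef x y n.+2.
  rewrite -[I _]/(I (\sum_(i < n.+2) x ^+ i * y * x ^+ (n.+2.-1 - i))) -h2.
  apply: (poly_values_coef (n := n.+3)) IB Isat _ _ _ => // m.
  by rewrite -h1; apply: In; apply: Rn.
have I0 x : I x -> I 0 by move=> Ix; rewrite -(subrr x); apply: IB.
have ID x y : I x -> I y -> I (x + y).
  move=> Ix Iy; rewrite -[y]opprK -[- y]sub0r; apply: (IB) => //; apply: (IB) => //.
  exact: I0 Ix.
have key x z y : R x -> R z -> R y -> I (x ^+ n.+1 * z * y ^+ n.+1).
  move=> Rx Rz Ry; apply: (Isat _ n.+1).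
  have Iz : I 0 by apply: I0 (In x Rx).
  (* Summing F over i first gives linearized powers of x. Summing over j
     first gives linearized powers of y, except for i = 0, where the n + 2
     terms coincide. *)
  pose F (i j : 'I_n.+2) := x ^+ (n.+1 - i) * z * y ^+ j * x ^+ i * y ^+ (n.+1 - j).
  have FI : I (\sum_i \sum_j F i j).
    rewrite exchange_big /=; elim/big_ind: _ => // j _.
    have -> : \sum_(i < n.+2) F i j =
        (\sum_(i < n.+2) x ^+ i * (z * y ^+ j) * x ^+ (n.+1 - i)) * y ^+ (n.+1 - j).
      rewrite (reindex_inj rev_ord_inj) /= mulr_suml; apply: eq_bigr => i _.
      by rewrite /F /= subSS subKn ?mulrA // -ltnS.
    apply: IMX => //; apply: lin => //.
    case: j => [[|j] /= _]; first by rewrite mulr1.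
    by apply: RM => //; apply: RX.
  have FI' : I (\sum_(i < n.+1) \sum_j F (lift ord0 i) j).
    elim/big_ind: _ => // i _.
    have -> : \sum_(j < n.+2) F (lift ord0 i) j = x ^+ (n.+1 - lift ord0 i) * z *
        \sum_(j < n.+2) y ^+ j * x ^+ i.+1 * y ^+ (n.+1 - j).
      by rewrite mulr_sumr; apply: eq_bigr => j _; rewrite /F !mulrA.
    apply: (IM _ _ _ (lin _ _ Ry (RX _ _ Rx))).1.
    case: (_ - _)%N => [|m]; first by rewrite mul1r.
    by apply: RM => //; apply: RX.
  move: FI; rewrite big_ord_recl => FI.
  have := IB _ _ FI FI'; rewrite addrK; congr I.
  rewrite -[n.+2 in RHS]card_ord -sumr_const; apply: eq_bigr => j _.
  rewrite /F /= subn0 expr0 mulr1 -mulrA -exprD subnKC //.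
  by rewrite -ltnS.
pose I1 := [set a | forall z y, R z -> R y -> I (a * z * y ^+ n.+1)].
pose I2 := [set b | forall p z, R z -> size p = M -> (forall x, x \in p -> R x) ->
                    I ((\prod_(x <- p) x) * z * b)].
have PI1 p : size p = M -> (forall x, x \in p -> R x) -> I1 (\prod_(x <- p) x).
  apply: (IH R I1 RD RM).
  - by move=> a b Ia Ib z y Rz Ry; rewrite !mulrBl; apply: IB; [exact: Ia|exact: Ib].
  - move=> r a Rr Ia; split=> z y Rz Ry.
      by rewrite -!mulrA; apply: (IM _ _ Rr _).1; rewrite mulrA; apply: Ia.
    by rewrite -(mulrA a); apply: Ia => //; apply: RM.
  - move=> a m Ia z y Rz Ry; apply: (Isat _ m).
    by rewrite -!mulrnAl; apply: Ia.
  - by move=> x Rx z y Rz Ry; apply: key.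
have PI2 p : size p = M -> (forall x, x \in p -> R x) -> I2 (\prod_(x <- p) x).
  apply: (IH R I2 RD RM).
  - by move=> a b Ia Ib q z Rz sq Rq; rewrite mulrBr; apply: IB; [exact: Ia|exact: Ib].
  - move=> r a Rr Ia; split=> q z Rz sq Rq.
      by rewrite mulrA -(mulrA _ z); apply: Ia => //; apply: RM.
    by rewrite mulrA; apply: (IM _ _ Rr _).2; apply: Ia.
  - by move=> a m Ia q z Rz sq Rq; apply: (Isat _ m); rewrite -mulrnAr; apply: Ia.
  - by move=> y Ry q z Rz sq Rq; apply: PI1.
move=> s ss sR; rewrite -(cat_take_drop M s) big_cat /=.
have : size (drop M s) = M.+1 by rewrite size_drop ss addKn.
case E: (drop M s) => [|z p] //= [sp]; rewrite big_cons mulrA.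
have subs x : x \in z :: p -> R x by move=> xs; apply: sR; have := @mem_drop M _ s x; rewrite E; apply.
apply: PI2 => //.
- by move=> x xp; apply: subs; rewrite inE xp orbT.
- by apply: subs; rewrite inE eqxx.
- by rewrite size_take ss ifT // addnS ltnS leq_addr.
- by move=> x xs; apply: sR; apply: mem_take xs.
Qed.

(** * Cayley-Hamilton algebras are finite over their base *)

Lemma natr_neq0 (k : fieldType) (char0 : [pchar k] =i pred0) m :
  m.+1%:R != 0 :> k.
Proof. by rewrite (pcharf0P k).1. Qed.

Lemma field_domain (k : fieldType) (x y : k) : x * y = 0 -> x = 0 \/ y = 0.
Proof. by move/eqP; rewrite mulf_eq0 => /orP [] /eqP; [left|right]. Qed.

Lemma mulrSn_eq0 (k : fieldType) (V : lmodType k) (char0 : [pchar k] =i pred0)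
  (x : V) m : x *+ m.+1 = 0 -> x = 0.
Proof.
rewrite -scaler_nat => /eqP; rewrite scaler_eq0 (negPf (natr_neq0 char0 m)).
by move/eqP.
Qed.

Section TraceBasics.
Variables (k : closedFieldType) (A : algType k) (C : comAlgType k).
Variables (iota : {lrmorphism C -> A}) (tr : A -> C) (n : nat).
Hypothesis char0 : [pchar k] =i pred0.
Hypothesis CH : cayley_hamilton iota tr n.

Lemma iota_inj : injective iota. Proof. by case: CH => [[]]. Qed.
Lemma iotaC c a : iota c * a = a * iota c. Proof. by case: CH => [[]]. Qed.
Lemma trD a b : tr (a + b) = tr a + tr b. Proof. by case: CH => [[]]. Qed.
Lemma trZ c a : tr (iota c * a) = c * tr a. Proof. by case: CH => [[]]. Qed.
Lemma tr_mulC a b : tr (a * b) = tr (b * a). Proof. by case: CH => [[]]. Qed.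
Lemma tr_one : tr 1 = n%:R. Proof. by case: CH. Qed.
Lemma tr0 : tr 0 = 0. Proof. by apply: (addrI (tr 0)); rewrite -trD !addr0. Qed.
Lemma trN a : tr (- a) = - tr a.
Proof. by apply: (addrI (tr a)); rewrite -trD !subrr tr0. Qed.
Lemma trB a b : tr (a - b) = tr a - tr b. Proof. by rewrite trD trN. Qed.
Lemma tr_sum (I : Type) (r : seq I) (P : pred I) (F : I -> A) :
  tr (\sum_(i <- r | P i) F i) = \sum_(i <- r | P i) tr (F i).
Proof. exact: (big_morph tr trD tr0). Qed.
Lemma iota_alg (a : k) : iota a%:A = a%:A.
Proof. by rewrite linearZ /= rmorph1. Qed.
Lemma tr_scale (a : k) x : tr (a *: x) = a *: tr x.
Proof. by rewrite -mulr_algl -iota_alg trZ mulr_algl. Qed.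

Lemma ch_eq x : \sum_(j < n.+1) iota ((-1) ^+ j * ch_coef tr j x) * x ^+ (n - j) = 0.
Proof.
have [_ /(_ x) h _] := CH; rewrite -[RHS]h /ch_poly rmorph_sum horner_sum.
by apply: eq_bigr => j _ /=; rewrite map_polyZ hornerZ map_polyXn hornerXn.
Qed.

Lemma ch_coef0 x : ch_coef tr 0 x = 1.
Proof. by rewrite /ch_coef det_mx00 fact0 invr1 scale1r. Qed.

Lemma ch_degree_gt0 : (0 < n)%N.
Proof.
move: (ch_eq 1); case: (n) => // /eqP.
by rewrite big_ord1 expr0 mul1r ch_coef0 rmorph1 mul1r expr0 oner_eq0.
Qed.

Lemma ch_degree_neq0 : n%:R != 0 :> k.
Proof. by have := ch_degree_gt0; case: (n) => // n' _; apply: natr_neq0. Qed.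

Lemma ch_eq_lead x : x ^+ n =
  - \sum_(j < n) iota ((-1) ^+ j.+1 * ch_coef tr j.+1 x) * x ^+ (n - j.+1).
Proof.
apply/eqP; rewrite -subr_eq0 opprK; apply/eqP; rewrite -[RHS](ch_eq x).
by rewrite big_ord_recl /= expr0 ch_coef0 mul1r rmorph1 mul1r subn0.
Qed.

(** The first column of the Newton matrix consists of the traces of the powers
    of x, so a ring morphism that kills all of these kills the determinant. *)
Lemma ch_coef_morph0 (K : comNzRingType) (f : {rmorphism C -> K}) j x :
  (forall i, f (tr (x ^+ i.+1)) = 0) -> f (ch_coef tr j.+1 x) = 0.
Proof.
move=> tr0; rewrite /ch_coef -mulr_algl rmorphM -det_map_mx.
rewrite (expand_det_col _ ord0) big1 ?mulr0 // => i _.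
by rewrite !mxE /= subn0 tr0 mul0r.
Qed.
End TraceBasics.

Section FiniteModule.
Variables (k : closedFieldType) (A : algType k) (C : comAlgType k).
Variables (iota : {lrmorphism C -> A}) (tr : A -> C) (n : nat).
Hypothesis char0 : [pchar k] =i pred0.
Hypothesis CH : cayley_hamilton iota tr n.

Let ptr (f : {poly A}) : {poly C} := map_poly tr f.

Let ptr_horner f m : (ptr f).[m%:R] = tr f.[m%:R].
Proof.
rewrite (@horner_coef_wide _ (size f)) ?size_poly // horner_coef (tr_sum CH).
apply: eq_bigr => i _; rewrite coef_map_id0 ?(tr0 CH) //.
by rewrite -!natrX !mulr_natr -!scaler_nat (tr_scale CH).
Qed.

Let pnewton j f : 'M[{poly C}]_j :=
  \matrix_(r < j, s < j)
    if (s <= r)%N then ptr (f ^+ (r - s).+1)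
    else if s == r.+1 :> nat then r.+1%:R else 0.
Let pcoef j f : {poly C} := ((j`!%:R : k)^-1)%:A%:P * \det (pnewton j f).

Let comm_nat (p : {poly A}) m : comm_poly p m%:R.
Proof. by rewrite /comm_poly mulr_natl mulr_natr. Qed.

Let pcoef_horner j f m : (pcoef j f).[m%:R] = ch_coef tr j f.[m%:R].
Proof.
rewrite /pcoef hornerM hornerC mulr_algl; congr (_ *: _).
rewrite -[LHS]/(horner_eval m%:R (\det (pnewton j f))) -det_map_mx.
congr determinant; apply/matrixP => r s; rewrite !mxE /=.
rewrite /horner_eval; case: ifP => _; first by rewrite ptr_horner horner_exp_comm.
by case: ifP => _; rewrite ?hornerC // -polyC_natr hornerC.
Qed.

(** Both sides are polynomials over A that agree at every natural number, which
    determines their coefficients in characteristic 0. *)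
Let poly_ch f : f ^+ n = - \sum_(j < n)
  map_poly iota ((-1) ^+ j.+1 * pcoef j.+1 f) * f ^+ (n - j.+1).
Proof.
apply/eqP; rewrite -subr_eq0; set p := _ - _; apply/eqP/polyP => i.
rewrite coef0; case: (ltnP i (size p)) => [|/leq_sizeP -> //]; move: i.
apply: (poly_values_coef (I := [set x : A | x = 0])) => [x y -> ->|x m|m] /=.
- by rewrite subrr.
- exact: mulrSn_eq0.
have -> : \sum_(i < size p) p`_i *+ m ^ i = p.[m%:R].
  by rewrite horner_coef; apply: eq_bigr => i _; rewrite -natrX mulr_natr.
rewrite /p hornerD !hornerN horner_exp_comm // (ch_eq_lead CH) horner_sum.
apply/eqP; rewrite opprK addrC subr_eq0; apply/eqP/eq_bigr => j _.
rewrite hornerM_comm // horner_exp_comm //; congr (_ * _).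
by rewrite -[m%:R](rmorph_nat iota) horner_map /= hornerM pcoef_horner horner_exp
  hornerN hornerC rmorph_nat.
Qed.

Variable h : seq A.

(** The C-span of the products of at most l elements of h, defined by adding one
    factor on the right. *)
Fixpoint words (l : nat) : set A :=
  if l is l'.+1 then
    [set x | exists y (z : nat -> A),
       [/\ words l' y, forall i, words l' (z i) & x = y + \sum_(i < size h) z i * h`_i]]
  else range iota.

Let wordsD l x y : words l x -> words l y -> words l (x + y).
Proof.
elim: l x y => [|l IH] x y /=.
  by move=> [c _ <-] [d _ <-]; exists (c + d) => //; rewrite rmorphD.
move=> [a [z [wa wz ->]]] [a' [z' [wa' wz' ->]]].
exists (a + a'), (fun i => z i + z' i); split=> [|i|]; try exact: IH.
by rewrite addrACA -big_split /=; congr (_ + _); apply: eq_bigr => i _; rewrite mulrDl.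
Qed.
Let wordsZ l c x : words l x -> words l (iota c * x).
Proof.
elim: l x => [|l IH] x /=.
  by move=> [d _ <-]; exists (c * d) => //; rewrite rmorphM.
move=> [a [z [wa wz ->]]].
exists (iota c * a), (fun i => iota c * z i); split=> [|i|]; try exact: IH.
by rewrite mulrDr mulr_sumr; congr (_ + _); apply: eq_bigr => i _; rewrite mulrA.
Qed.
Let words0 l : words l 0.
Proof.
elim: l => [|l IH]; first by exists 0 => //; rewrite rmorph0.
by exists 0, (fun _ => 0); split=> //; rewrite add0r big1 // => i _; rewrite mul0r.
Qed.
Let wordsS l x : words l x -> words l.+1 x.
Proof.
move=> wx; exists x, (fun _ => 0); split=> //; rewrite big1 ?addr0 // => i _.
by rewrite mul0r.
Qed.
Let words_le l m x : (l <= m)%N -> words l x -> words m x.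
Proof. by move/subnK <-; elim: (m - l)%N => // p IH /IH /wordsS. Qed.
Let words_sum l I (r : seq I) (P : pred I) (F : I -> A) :
  (forall i, P i -> words l (F i)) -> words l (\sum_(i <- r | P i) F i).
Proof. by move=> wF; elim/big_ind: _ => //; exact: wordsD. Qed.
Let wordsM l m x y : words l x -> words m y -> words (l + m) (x * y).
Proof.
move=> wx; elim: m y => [|m IH] y /=.
  by move=> [c _ <-]; rewrite addn0 -(iotaC CH); apply: wordsZ.
rewrite addnS; move=> [a [z [wa wz ->]]].
exists (x * a), (fun i => x * z i); split=> [|i|]; try exact: IH.
by rewrite mulrDr mulr_sumr; congr (_ + _); apply: eq_bigr => i _; rewrite mulrA.
Qed.
Let wordsN l x : words l x -> words l (- x).
Proof. by move/(wordsZ (-1)); rewrite rmorphN rmorph1 mulN1r. Qed.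
Let words1 l : words l 1.
Proof. by apply: (@words_le 0) => //; exists 1 => //; rewrite rmorph1. Qed.
Let words_gen i : (i < size h)%N -> words 1 h`_i.
Proof.
move=> lti; exists 0, (fun j => (j == i)%:R); split=> [|j|]; first exact: words0.
  by case: eqP => _; [exact: words1 | exact: words0].
rewrite add0r (bigD1 (Ordinal lti)) //= eqxx mul1r big1 ?addr0 // => j.
by rewrite -val_eqE /= => /negPf ->; rewrite mul0r.
Qed.
Let words_sat l x m : words l (x *+ m.+1) -> words l x.
Proof.
move=> /(wordsZ (m.+1%:R^-1)%:A); rewrite iota_alg mulr_algl -scaler_nat scalerA.
by rewrite mulVf ?scale1r // natr_neq0.
Qed.

(** A Rees algebra: the coefficient in degree l of an element of R lies in the
    span of the words of length at most l, and of length less than l for an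
    element of I. The n-th power of an element of R lies in I by the Cayley-
    Hamilton identity, as the characteristic coefficients have no constant term,
    and the Nagata-Higman theorem then shortens all long words. *)
Let filt (d : nat) (f : {poly A}) := forall l, words (l - d) f`_l.
Let R : set {poly A} := [set f : {poly A} | f`_0 = 0 /\ filt 0 f].
Let I : set {poly A} := [set f : {poly A} | f`_0 = 0 /\ filt 1 f].

Let filtM0 (f g : {poly A}) : filt 0 f -> filt 0 g -> filt 0 (f * g).
Proof.
move=> ff fg l; rewrite coefM subn0; apply: words_sum => i _.
have := wordsM (ff i) (fg (l - i)%N).
by rewrite !subn0 subnKC // -ltnS.
Qed.
Let filtX (f : {poly A}) i : filt 0 f -> filt 0 (f ^+ i).
Proof.
move=> ff; elim: i => [|i IH]; last by rewrite exprS; apply: filtM0.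
by move=> l; rewrite coef1; case: eqP => _; [exact: words1 | exact: words0].
Qed.
Let filtM1 (f g : {poly A}) :
  filt 0 f -> g`_0 = 0 -> filt 1 g -> filt 1 (f * g) /\ filt 1 (g * f).
Proof.
move=> ff g0 fg; split=> l; [rewrite coefM | rewrite coefMr]; apply: words_sum => i _.
  have [ltil|] := ltnP i l.
    by have := wordsM (ff i) (fg (l - i)%N); apply: words_le; lia.
  by rewrite -subn_eq0 => /eqP ->; rewrite g0 mulr0.
have [ltil|] := ltnP i l.
  by have := wordsM (fg (l - i)%N) (ff i); apply: words_le; lia.
by rewrite -subn_eq0 => /eqP ->; rewrite g0 mul0r.
Qed.

Let ch_filt f : R f -> I (f ^+ n).
Proof.
move=> [f0 ff]; have f00 : f.[0%:R] = 0 by rewrite horner_coef0.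
split.
  rewrite -horner_coef0 -[0]/(0%:R : A) horner_exp_comm // f00 expr0n.
  by rewrite gtn_eqF // (ch_degree_gt0 CH).
rewrite poly_ch => l; rewrite coefN coef_sum; apply: wordsN; apply: words_sum => j _.
rewrite coefM; apply: words_sum => i _; rewrite coef_map /=.
case: i => [[|i] /= lti]; last first.
  apply: wordsZ; have := filtX (n - j.+1) ff (l - i.+1)%N.
  by apply: words_le; rewrite subn0 leq_sub2l.
have -> : ((-1) ^+ j.+1 * pcoef j.+1 f)`_0 = 0; last by rewrite rmorph0 mul0r.
rewrite -horner_coef0 hornerM (pcoef_horner _ _ 0) f00.
rewrite (_ : ch_coef _ _ _ = 0) ?mulr0 //.
apply: (@ch_coef_morph0 _ _ _ tr _ idfun) => i.
by rewrite expr0n (tr0 CH).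
Qed.

(** A word of length M is a combination of shorter words, because the
    corresponding product of the polynomials h i X lies in the ideal of the Rees
    filtration. *)
Lemma words_stable : exists L, forall l x, words l x -> words L x.
Proof.
have [M NH] := nagata_higman {poly A} n.
have Rg i : (i < size h)%N -> R ((h`_i)%:P * 'X).
  move=> lti; split=> [|l]; rewrite coefMX //.
  case: l => [|[|l]]; first exact: (words0 0).
    by rewrite coefC; apply: words_gen.
  by rewrite coefC; apply: (words0 l.+2).
have prodE (s : seq nat) : \prod_(f <- [seq (h`_i)%:P * 'X | i <- s]) f =
    (\prod_(i <- s) h`_i)%:P * 'X^(size s) :> {poly A}.
  elim: s => [|i s IH]; first by rewrite !big_nil mul1r.
  rewrite !big_cons IH exprS polyCM -!mulrA; congr (_ * _).
  by rewrite !mulrA; congr (_ * _); rewrite commr_polyX.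
have IP s : size s = M -> (forall i, i \in s -> (i < size h)%N) ->
    I ((\prod_(i <- s) h`_i)%:P * 'X^M).
  move=> sM sh; rewrite -sM -prodE; apply: (NH R I).
  - move=> f g [f0 ff] [g0 fg]; split; first by rewrite coefD f0 g0 addr0.
    by move=> l; rewrite coefD; apply: wordsD.
  - move=> f g [f0 ff] [g0 fg]; split; last exact: filtM0.
    by rewrite coefM big_ord1 f0 mul0r.
  - move=> f g [f0 ff] [g0 fg]; split; first by rewrite coefB f0 g0 subrr.
    by move=> l; rewrite coefB; apply: wordsD => //; apply: wordsN.
  - move=> f g [f0 ff] [g0 fg]; have [fg1 fg2] := filtM1 ff g0 fg.
    by split; split; rewrite ?coefM ?big_ord1 ?f0 ?g0 ?mulr0 ?mul0r.
  - move=> f m [f0 ff]; split; first by apply: (mulrSn_eq0 char0 (m := m)); rewrite -coefMn.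
    by move=> l; apply: (words_sat (m := m)); rewrite -coefMn.
  - exact: ch_filt.
  - by rewrite size_map.
  - by move=> f /mapP [i /sh lti ->]; apply: Rg.
have IW s : size s = M -> (forall i, i \in s -> (i < size h)%N) ->
    words (M - 1) (\prod_(i <- s) h`_i).
  move=> sM sh; have [_ /(_ M)] := IP s sM sh.
  by rewrite coefMXn ltnn subnn coefC.
case: M {NH} IP IW => [|L] IP IW.
  have [] := IP [::] erefl (fun _ (e : false) => match e with end).
  by rewrite big_nil mul1r coefXn => /eqP; rewrite oner_eq0.
exists L; rewrite subSS subn0 in IW.
(* The words are read from their right ends, p collecting the factors already
   split off. *)
have absorb l : (l <= L.+1)%N -> forall z p, words l z ->
    size p = (L.+1 - l)%N -> (forall i, i \in p -> (i < size h)%N) ->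
    words L (z * \prod_(i <- p) h`_i).
  elim: l => [|l IH] ltl z p /=.
    by move=> [c _ <-] sp ph; apply: wordsZ; apply: IW; rewrite ?subn0 in sp *.
  move=> [y [w [wy ww ->]]] sp ph; rewrite mulrDl mulr_suml; apply: wordsD.
    have wp : words (L - l) (\prod_(i <- p) h`_i).
      rewrite -subSS -sp {sp}; elim: p ph => [|i p IHp] ph; first by rewrite big_nil.
      rewrite big_cons; apply: (@wordsM 1); first by apply: words_gen; rewrite ph ?inE ?eqxx.
      by apply: IHp => j jp; apply: ph; rewrite inE jp orbT.
    by have := wordsM wy wp; rewrite subnKC.
  apply: words_sum => i _; rewrite -mulrA.
  have := IH (ltnW ltl) (w i) ((i : nat) :: p) (ww i).
  rewrite big_cons; apply; first by rewrite /= sp; lia.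
  by move=> j; rewrite inE => /orP [/eqP -> //|/ph].
have base x : words L.+1 x -> words L x.
  move=> wx; have := absorb L.+1 (leqnn _) x [::] wx.
  by rewrite big_nil mulr1 subnn; apply.
elim=> [|l IH] x.
  by move=> w0; exact: (words_le (leq0n L) w0).
move=> [y [w [wy ww ->]]]; apply: base.
by exists y, w; split=> [|i|//]; apply: IH; [exact: wy | exact: ww].
Qed.

Let span (g : seq A) : set A :=
  [set x | exists c : nat -> C, x = \sum_(i < size g) iota (c i) * g`_i].

Let spanD g x y : span g x -> span g y -> span g (x + y).
Proof.
move=> [c ->] [d ->]; exists (fun i => c i + d i); rewrite -big_split /=.
by apply: eq_bigr => i _; rewrite rmorphD mulrDl.
Qed.
Let spanZ g c x : span g x -> span g (iota c * x).
Proof.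
move=> [d ->]; exists (fun i => c * d i); rewrite mulr_sumr.
by apply: eq_bigr => i _; rewrite rmorphM mulrA.
Qed.
Let span0 g : span g 0.
Proof. by exists (fun _ => 0); rewrite big1 // => i _; rewrite rmorph0 mul0r. Qed.
Let span_sum g (J : Type) (r : seq J) (P : pred J) (F : J -> A) :
  (forall i, P i -> span g (F i)) -> span g (\sum_(i <- r | P i) F i).
Proof. by move=> wF; elim/big_ind: _ => //; exact: spanD. Qed.
Let span_mem g x : x \in g -> span g x.
Proof.
move=> xg; have lti : (index x g < size g)%N by rewrite index_mem.
exists (fun j => (j == index x g)%:R).
rewrite (bigD1 (Ordinal lti)) //= eqxx rmorph1 mul1r nth_index // big1 ?addr0 // => j.
by rewrite -val_eqE /= => /negPf ->; rewrite rmorph0 mul0r.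
Qed.
Let span_trans g g' x : (forall y, y \in g -> span g' y) -> span g x -> span g' x.
Proof.
move=> gg' [c ->]; apply: span_sum => i _; apply: spanZ; apply: gg'.
exact: mem_nth.
Qed.

Let words_span l : exists g, forall x, words l x -> span g x.
Proof.
elim: l => [|l [g IH]].
  exists [:: 1] => x [c _ <-]; exists (fun _ => c).
  by rewrite big_ord1 mulr1.
exists (g ++ [seq a * b | a <- g, b <- h]) => x [y [z [wy wz ->]]].
apply: spanD.
  by apply: span_trans (IH _ wy) => a ag; apply: span_mem; rewrite mem_cat ag.
apply: span_sum => i _; have [c ->] := IH _ (wz i); rewrite mulr_suml.
apply: span_sum => j _; rewrite -mulrA; apply: spanZ; apply: span_mem.
rewrite mem_cat; apply/orP; right; apply/allpairsP; exists (g`_j, h`_i).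
by split=> //; apply: mem_nth.
Qed.

(** By the stabilization of the word filtration its last term is a subalgebra,
    which contains the generators. *)
Lemma finite_module :
  (forall B : {pred A}, GRing.subalg_closed B -> {subset h <= B} -> forall x, x \in B) ->
  exists (s : nat) (g : 'I_s -> A),
    forall x, exists c : 'I_s -> C, x = \sum_i iota (c i) * g i.
Proof.
move=> hgen; have [L HL] := words_stable; have [g Hg] := words_span L.
exists (size g), (fun i => g`_i) => x.
suff /Hg [c ->] : words L x by exists (fun i => c i).
pose B : {pred A} := fun x => `[< words L x >].
suff: x \in B by move/asboolP.
apply: hgen => [|y].
  split; first by apply/asboolP; apply: words1.
    move=> a u v /asboolP wu /asboolP wv; apply/asboolP; apply: wordsD => //.
    by rewrite -mulr_algl -(iota_alg iota); apply: wordsZ.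
  move=> u v /asboolP wu /asboolP wv; apply/asboolP.
  by apply: (HL (L + L)%N); apply: wordsM.
move=> /(nthP 0) [i lti <-]; apply/asboolP; apply: (HL 1%N).
exact: words_gen.
Qed.
End FiniteModule.

(** * Trace forms and their radicals *)

Section IdealGen.
Variables (R : pzRingType) (X : set R).
Lemma igen_sub x : X x -> ideal_gen X x.
Proof. by move=> Xx I _; apply. Qed.
Lemma igen0 : ideal_gen X 0. Proof. by case: (ideal_gen_ideal X). Qed.
Lemma igenD x y : ideal_gen X x -> ideal_gen X y -> ideal_gen X (x + y).
Proof. by case: (ideal_gen_ideal X) => _ + _; apply. Qed.
Lemma igenMl a x : ideal_gen X x -> ideal_gen X (a * x).
Proof. by case: (ideal_gen_ideal X) => _ _ h /(h a) []. Qed.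
Lemma igenMr a x : ideal_gen X x -> ideal_gen X (x * a).
Proof. by case: (ideal_gen_ideal X) => _ _ h /(h a) []. Qed.
Lemma igenN x : ideal_gen X x -> ideal_gen X (- x).
Proof. by rewrite -mulN1r; apply: igenMl. Qed.
Lemma igenB x y : ideal_gen X x -> ideal_gen X y -> ideal_gen X (x - y).
Proof. by move=> Ix Iy; apply: igenD => //; apply: igenN. Qed.
Lemma igen_sum I (r : seq I) (P : pred I) (F : I -> R) :
  (forall i, P i -> ideal_gen X (F i)) -> ideal_gen X (\sum_(i <- r | P i) F i).
Proof. by move=> IF; elim/big_ind: _ => //; [exact: igen0 | exact: igenD]. Qed.
End IdealGen.

Section TraceForm.
Variables (k : fieldType) (A : algType k).

Definition radical (tau : A -> k) : set A := [set x | forall h, tau (x * h) = 0].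

(** The properties of the trace form at a character of the base that determine
    its structure: it is symmetric, it vanishes on the elements that are
    nilpotent modulo its radical, and every element is algebraic modulo its
    radical. They are stated for an arbitrary function tau, so that they also
    apply to the forms induced on quotients and on blocks of the algebra. *)
Record trace_form (tau : A -> k) : Prop := TraceForm {
  tfD : forall x y, tau (x + y) = tau x + tau y;
  tfZ : forall a x, tau (a *: x) = a * tau x;
  tfC : forall x y, tau (x * y) = tau (y * x);
  tf_nil : forall x q, radical tau (x ^+ q) -> tau x = 0;
  tf_alg : forall x, exists2 g : {poly k}, g != 0 & radical tau (horner_alg x g) }.

Variable tau : A -> k.
Hypothesis tf : trace_form tau.

Lemma tf0 : tau 0 = 0. Proof. by rewrite -(scale0r 0) (tfZ tf) mul0r. Qed.
Lemma tfN x : tau (- x) = - tau x.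
Proof. by rewrite -scaleN1r (tfZ tf) mulN1r. Qed.
Lemma tfB x y : tau (x - y) = tau x - tau y.
Proof. by rewrite (tfD tf) tfN. Qed.
Lemma tf_sum (I : Type) (r : seq I) (P : pred I) (F : I -> A) :
  tau (\sum_(i <- r | P i) F i) = \sum_(i <- r | P i) tau (F i).
Proof. exact: (big_morph tau (tfD tf) tf0). Qed.

Local Notation T := (radical tau).
Lemma rad0 : T 0. Proof. by move=> h; rewrite mul0r tf0. Qed.
Lemma radD x y : T x -> T y -> T (x + y).
Proof. by move=> Tx Ty h; rewrite mulrDl (tfD tf) Tx Ty addr0. Qed.
Lemma radN x : T x -> T (- x).
Proof. by move=> Tx h; rewrite mulNr tfN Tx oppr0. Qed.
Lemma radB x y : T x -> T y -> T (x - y).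
Proof. by move=> Tx Ty; apply: radD => //; apply: radN. Qed.
Lemma radMr a x : T x -> T (x * a).
Proof. by move=> Tx h; rewrite -mulrA. Qed.
Lemma radMl a x : T x -> T (a * x).
Proof. by move=> Tx h; rewrite -mulrA (tfC tf) -mulrA. Qed.
Lemma rad_tau x : T x -> tau x = 0. Proof. by move=> /(_ 1); rewrite mulr1. Qed.
End TraceForm.

Section CharacterTrace.
Variables (k : closedFieldType) (A : algType k) (C : comAlgType k).
Variables (iota : {lrmorphism C -> A}) (tr : A -> C) (n : nat).
Hypothesis char0 : [pchar k] =i pred0.
Hypothesis CH : cayley_hamilton iota tr n.
Variable chi : {rmorphism C -> k}.
Hypothesis chi_alg : forall a, chi a%:A = a.

Lemma chiZ a c : chi (a *: c) = a * chi c.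
Proof. by rewrite -mulr_algl rmorphM chi_alg. Qed.

Definition chi_ker : set C := [set c | chi c = 0].
Local Notation tau := (chi \o tr).
Local Notation T := (radical tau).
Local Notation mA := (ideal_gen (iota @` chi_ker)).

Lemma fiber_ker c : chi c = 0 -> mA (iota c).
Proof. by move=> c0; apply: igen_sub; exists c. Qed.

Lemma fiber_chi c x : mA (iota c * x - chi c *: x).
Proof.
rewrite -mulr_algl -(iota_alg iota) -mulrBl -rmorphB; apply: igenMr.
by apply: fiber_ker; rewrite rmorphB chi_alg subrr.
Qed.

Let tauD x y : tau (x + y) = tau x + tau y.
Proof. by rewrite /= (trD CH) rmorphD. Qed.
Let tauZ a x : tau (a *: x) = a * tau x.
Proof. by rewrite /= (tr_scale CH) chiZ. Qed.
Let tauC x y : tau (x * y) = tau (y * x).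
Proof. by rewrite /= (tr_mulC CH). Qed.

Lemma fiber_radical x : mA x -> T x.
Proof.
apply => [|_ [c c0 <-] h]; last by rewrite /= (trZ CH) rmorphM c0 mul0r.
split=> [h|y z Ty Tz h|a y Ty]; first by rewrite mul0r /= (tr0 CH) rmorph0.
  by rewrite mulrDl tauD Ty Tz addr0.
by split=> h; rewrite -mulrA // tauC -mulrA.
Qed.

(** All powers of x have trace 0 at chi, so the identity of Cayley and Hamilton
    for x reduces to x ^ n modulo the fiber ideal. *)
Lemma radical_nil x : T x -> mA (x ^+ n).
Proof.
move=> Tx; rewrite (ch_eq_lead CH); apply: igenN; apply: igen_sum => j _.
apply: igenMr; apply: fiber_ker; rewrite rmorphM ch_coef_morph0 ?mulr0 // => i.
by have := Tx (x ^+ i); rewrite -exprS.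
Qed.

Lemma tau1_neq0 : tau 1 != 0.
Proof.
by rewrite /= (tr_one CH) rmorph_nat (ch_degree_neq0 char0 CH).
Qed.

Lemma radical_proper : ~ T 1.
Proof. by move=> /(_ 1); rewrite mulr1 => /eqP; rewrite (negPf tau1_neq0). Qed.

(** When the higher powers of x have trace 0, the Newton matrix becomes
    triangular. *)
Let ch_coef_lead j x : (forall i, tau (x ^+ i.+2) = 0) ->
  chi (ch_coef tr j x) = (j`!%:R)^-1 * tau x ^+ j.
Proof.
move=> x0; rewrite /ch_coef chiZ -det_map_mx -det_tr det_trig; last first.
  apply/is_trig_mxP => r s ltrs; rewrite !mxE ltnNge in ltrs *.
  rewrite /= ltnW ?ltnNge // -[(s - r)%N]prednK ?subn_gt0 ?ltnNge //; exact: x0.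
rewrite (eq_bigr (fun _ => tau x)) ?prodr_const ?card_ord // => i _.
by rewrite !mxE leqnn subnn expr1.
Qed.

(** By descending induction on the exponent, let y be a power of x with tau y
    nonzero, all of whose higher powers have trace 0. At chi, the j-th
    characteristic coefficient of y is then tau(y) ^ j / j!, so the constant
    coefficient is invertible. The Cayley-Hamilton identity multiplied by y ^ e
    shows that y ^ e lies in the radical as soon as y ^ (e + 1) does, down to 1,
    which is impossible. *)
Lemma tau_nilpotent x q : T (x ^+ q) -> tau x = 0.
Proof.
move=> Txq.
have T0 : T 0 by apply: fiber_radical; apply: igen0.
have TD y z : T y -> T z -> T (y + z).
  by move=> Ty Tz h; rewrite mulrDl tauD Ty Tz addr0.
have TM y a : T y -> T (y * a) by move=> Ty h; rewrite -mulrA.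
suff down j : (0 < q)%N -> forall i, (q <= i.+1 + j)%N -> tau (x ^+ i.+1) = 0.
  case: q Txq down => [|q] Txq down; first by case: (radical_proper Txq).
  by have := down q.+1 isT 0%N; rewrite expr1; apply; lia.
move=> q_gt0; elim: j => [|j IH] i le_q.
  have -> : x ^+ i.+1 = x ^+ q * x ^+ (i.+1 - q) by rewrite -exprD subnKC; last lia.
  exact: Txq.
set y := x ^+ i.+1; apply/eqP/negPn/negP => ty0.
have yp : forall p, tau (y ^+ p.+2) = 0.
  move=> p; rewrite -exprM; have -> : (i.+1 * p.+2 = (i.+1 * p.+2 - 1).+1)%N by lia.
  by apply: IH; lia.
have [e Te eT] : exists2 e, T (y ^+ e.+1) & ~ T (y ^+ e).
  have : exists e, `[< T (y ^+ e) >].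
    exists q; apply/asboolP; rewrite -exprM mulnC exprM; case: (i) => [|i']; rewrite ?expr1 //.
    by rewrite exprS; apply: TM.
  move/ex_minnP => [[|e] /asboolP Te emin]; first by case: radical_proper.
  by exists e => // /asboolP /emin; rewrite ltnn.
apply: eT.
have TN z : T z -> T (- z) by move=> Tz h; rewrite -scaleN1r -scalerAl tauZ Tz mulr0.
have TZ a z : T z -> T (a *: z) by move=> Tz h; rewrite -scalerAl tauZ Tz mulr0.
have Tsum I (r : seq I) (P : pred I) (F : I -> A) :
  (forall i, P i -> T (F i)) -> T (\sum_(i <- r | P i) F i).
  by move=> IF; elim/big_ind: _.
have := ch_eq CH y; rewrite big_ord_recr /= subnn expr0 mulr1.
move/(congr1 ( *%R^~ (y ^+ e))); rewrite mulrDl mul0r mulr_suml => E.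
pose u := (-1) ^+ n * chi (ch_coef tr n y).
have u0 : u != 0.
  rewrite /u ch_coef_lead // !mulf_neq0 ?signr_eq0 ?expf_neq0 ?invr_eq0 //.
  rewrite -[n`!]prednK ?fact_gt0 //; exact: natr_neq0.
rewrite -[y ^+ e]scale1r -(mulVf u0) -scalerA; apply: TZ.
have -> : u *: y ^+ e = iota ((-1) ^+ n * ch_coef tr n y) * y ^+ e -
    (iota ((-1) ^+ n * ch_coef tr n y) * y ^+ e - u *: y ^+ e) by rewrite subKr.
apply: TD; last first.
  apply: TN; apply: fiber_radical.
  have <- : chi ((-1) ^+ n * ch_coef tr n y) = u by rewrite rmorphM rmorph_sign.
  exact: fiber_chi.
move/eqP: E; rewrite addrC addr_eq0 => /eqP ->; apply: TN; apply: Tsum => l _.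
rewrite -mulrA -exprD (iotaC CH); apply: (TM); have ltl := ltn_ord l.
have -> : (n - l + e = e.+1 + (n - l).-1)%N by lia.
by rewrite exprD; apply: TM.
Qed.

Lemma character_trace_form : trace_form tau.
Proof.
split=> //; first exact: tau_nilpotent.
move=> x; pose g : {poly k} :=
  \sum_(j < n.+1) ((-1) ^+ j * chi (ch_coef tr j x)) *: 'X^(n - j).
exists g.
  apply: contra_neq (oner_neq0 k) => g0; have := congr1 (fun p : {poly k} => p`_n) g0.
  rewrite coef0 coef_sum big_ord_recl /= expr0 ch_coef0 rmorph1 mul1r scale1r subn0.
  rewrite coefXn eqxx big1 ?addr0 // => j _; rewrite coefZ coefXn gtn_eqF ?mulr0 //.
  by rewrite /bump /= ltn_subrL (ch_degree_gt0 CH).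
pose c (j : nat) := (-1) ^+ j * ch_coef tr j x.
have -> : horner_alg x g =
    - \sum_(j < n.+1) (iota (c j) * x ^+ (n - j) - chi (c j) *: x ^+ (n - j)).
  rewrite sumrB (ch_eq CH x) sub0r opprK rmorph_sum; apply: eq_bigr => j _ /=.
  by rewrite linearZ /= rmorphXn /= horner_algX mulr_algl rmorphM rmorph_sign.
apply: fiber_radical; apply: igenN; apply: igen_sum => j _.
exact: fiber_chi.
Qed.
End CharacterTrace.

(** * Gram determinants *)

Lemma det_mul_narrow (K : comNzRingType) j l (X : 'M[K]_(l, j)) (Y : 'M[K]_(j, l)) :
  (j < l)%N -> \det (X *m Y) = 0.
Proof.
move=> /subnKC; move: (l - j.+1)%N => p e.
move: X Y; rewrite -e addSnnS => X Y.
have -> : X *m Y = row_mx X 0 *m col_mx Y (0 : 'M_(p.+1, j + p.+1)).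
  by rewrite mul_row_col mulmx0 addr0.
rewrite det_mulmx (expand_det_col _ (rshift j ord0)) big1 ?mul0r // => i _.
by rewrite row_mxEr mxE mul0r.
Qed.

Section Gram.
Variables (C : comNzRingType) (A : lmodType C) (B : A -> A -> C).
Variables (K : comNzRingType) (chi : {rmorphism C -> K}).
Hypothesis Kdom : forall x y : K, x * y = 0 -> x = 0 \/ y = 0.
Hypothesis K2 : (2%:R : K) <> 0.
Hypothesis Blin : forall c x y z, B (c *: x + y) z = c * B x z + B y z.
Hypothesis Bsym : forall x y, chi (B x y) = chi (B y x).

Definition gram j (a : 'I_j -> A) : 'M[C]_j := \matrix_(r, s) B (a r) (a s).

(** The coordinates of the orthogonal projection of h to the span of a,
    multiplied by the Gram determinant in order to avoid denominators. *)
Definition gram_coord j (a : 'I_j -> A) (h : A) (i : 'I_j) : C :=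
  \sum_m B h (a m) * \adj (gram a) m i.

Definition gram_proj j (a : 'I_j -> A) (h : A) : A :=
  \det (gram a) *: h - \sum_i gram_coord a h i *: a i.

Let b x y := chi (B x y).
Let BD x y z : B (x + y) z = B x z + B y z.
Proof. by rewrite -[x]scale1r Blin mul1r scale1r. Qed.
Let B0 z : B 0 z = 0.
Proof. by apply: (addrI (B 0 z)); rewrite -BD !addr0. Qed.
Let BZ c x z : B (c *: x) z = c * B x z.
Proof. by rewrite -[c *: x]addr0 Blin B0 addr0. Qed.
Let BN x z : B (- x) z = - B x z. Proof. by rewrite -scaleN1r BZ mulN1r. Qed.
Let Bsum (I : Type) (r : seq I) (P : pred I) (F : I -> A) z :
  B (\sum_(i <- r | P i) F i) z = \sum_(i <- r | P i) B (F i) z.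
Proof. exact: (big_morph (B^~ z) (fun x y => BD x y z) (B0 z)). Qed.

Lemma gram_proj_orth j (a : 'I_j -> A) h m : B (gram_proj a h) (a m) = 0.
Proof.
rewrite BD BZ BN Bsum; apply/eqP; rewrite subr_eq0; apply/eqP.
transitivity (\sum_l B h (a l) * (\adj (gram a) *m gram a) l m).
  rewrite mul_adj_mx (bigD1 m) //= !mxE eqxx mulr1n mulrC big1 ?addr0 // => l.
  by move/negPf => ne; rewrite !mxE ne mulr0n mulr0.
under eq_bigr do rewrite mxE mulr_sumr.
rewrite exchange_big; apply: eq_bigr => i _ /=; rewrite BZ mulr_suml.
by apply: eq_bigr => l _; rewrite [gram a i m]mxE mulrA.
Qed.

Definition gram_maximal j (a : 'I_j -> A) :=
  chi (\det (gram a)) <> 0 /\ forall e : 'I_j.+1 -> A, chi (\det (gram e)) = 0.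

Section Maximal.
Variables (j : nat) (a : 'I_j -> A).
Hypothesis amax : gram_maximal a.

Let orth (v : A) := forall m, b v (a m) = 0.

(** The tuple obtained from a by adding v has the Gram determinant b v v times
    that of a, which vanishes by maximality. *)
Let orth_isotropic v : orth v -> b v v = 0.
Proof.
move=> va; have [d0 /(_ (fun i => if unlift ord0 i is Some m then a m else v))] := amax.
set e := (X in gram X); rewrite -det_map_mx (expand_det_row _ ord0) big_ord_recl.
rewrite big1 ?addr0 => [|i _]; last first.
  by rewrite !mxE /e unlift_none liftK -[chi _]/(b v (a i)) va mul0r.
rewrite /cofactor addn0 expr0 mul1r !mxE /e unlift_none.
rewrite (_ : row' ord0 (col' ord0 _) = map_mx chi (gram a) :> 'M_j); last first.
  by apply/matrixP => r s; rewrite !mxE !liftK.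
by rewrite det_map_mx => /Kdom [].
Qed.

(** The orthogonal complement of a maximal tuple is totally isotropic; by
    polarization it is in the radical of the form. *)
Lemma gram_maximalP h y : b (gram_proj a h) y = 0.
Proof.
have bD x z t : b (x + z) t = b x t + b z t by rewrite /b BD rmorphD.
have bC x z : b x z = b z x by rewrite /b Bsym.
have bDr x z t : b t (x + z) = b t x + b t z by rewrite -![b t _]bC bD.
have po x : orth (gram_proj a x) by move=> m; rewrite /b gram_proj_orth rmorph0.
move: (gram_proj a h) (po h) => v vo.
have vw w : orth w -> b v w = 0.
  move=> wo; have : orth (v + w) by move=> m; rewrite bD vo wo addr0.
  move/orth_isotropic; rewrite bD !bDr !orth_isotropic // add0r addr0 (bC w).
  by rewrite -mulr2n -mulr_natl => /Kdom [].
have : b v (\det (gram a) *: y) = 0.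
  rewrite -[_ *: y](subrK (\sum_i gram_coord a y i *: a i)) bDr vw ?add0r; last exact: po.
  by rewrite bC /b Bsum rmorph_sum big1 // => i _; rewrite BZ rmorphM Bsym -/(b _ _) vo mulr0.
by rewrite bC /b BZ rmorphM Bsym => /Kdom [] // /amax.1.
Qed.
End Maximal.

(** Modulo the radical every e p is a combination of j elements, so the Gram
    matrix of e factors through a space of dimension j. *)
Lemma gram_rank_bound j (a : 'I_j -> A) d :
  chi d <> 0 ->
  (forall h, exists c : 'I_j -> C, forall y, b (d *: h - \sum_i c i *: a i) y = 0) ->
  forall l (e : 'I_l -> A), (j < l)%N -> chi (\det (gram e)) = 0.
Proof.
move=> d0 span l e ltjl; have [c cP] := choice (fun p => span (e p)).
have : \det (chi d *: map_mx chi (gram e)) = 0.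
  rewrite (_ : _ *: _ = \matrix_(p, i) chi (c p i) *m \matrix_(i, q) b (a i) (e q)).
    exact: det_mul_narrow.
  apply/matrixP => p q; rewrite !mxE; have /eqP := cP p (e q).
  rewrite /b BD BZ BN Bsum rmorphB rmorphM rmorph_sum subr_eq0 => /eqP ->.
  by apply: eq_bigr => i _; rewrite !mxE BZ rmorphM.
rewrite detZ det_map_mx => /Kdom [] // H; exfalso; elim: (l) H => [|m IH].
  by rewrite expr0 => /eqP; rewrite oner_eq0.
by rewrite exprS => /Kdom [].
Qed.

Lemma gram_maximal_bound j (a : 'I_j -> A) : gram_maximal a ->
  forall l (e : 'I_l -> A), (j < l)%N -> chi (\det (gram e)) = 0.
Proof.
move=> amax; apply: (gram_rank_bound amax.1) => h.
by exists (gram_coord a h) => y; apply: gram_maximalP.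
Qed.

(** If no tuple of size j + 1 had a nonzero Gram determinant, then a tuple of
    size j that has one would be maximal, and would bound the size of e. *)
Lemma gram_subtuple l (e : 'I_l -> A) j : chi (\det (gram e)) <> 0 -> (j <= l)%N ->
  exists a : 'I_j -> A, chi (\det (gram a)) <> 0.
Proof.
move=> e0; elim: j => [|j IH] ltjl.
  exists (fun _ => 0); rewrite det_mx00 rmorph1.
  by apply/eqP; apply: oner_neq0.
have [a a0] := IH (ltnW ltjl); apply: contrapT => nex.
apply: e0; apply: (gram_maximal_bound (a := a)) ltjl; split=> // e'.
by apply: contrapT => e'0; apply: nex; exists e'.
Qed.

Lemma gram_maximal_exists s :
  (forall l (e : 'I_l -> A), (s < l)%N -> chi (\det (gram e)) = 0) ->
  exists j (a : 'I_j -> A), gram_maximal a.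
Proof.
move=> bound; pose P j := `[< exists a : 'I_j -> A, chi (\det (gram a)) <> 0 >].
have exP : exists j, P j.
  exists 0%N; apply/asboolP; exists (fun _ => 0); rewrite det_mx00 rmorph1.
  by apply/eqP; apply: oner_neq0.
have bdP j : P j -> (j <= s)%N.
  by move=> /asboolP [a a0]; rewrite leqNgt; apply/negP => /(bound _ a).
case: (ex_maxnP exP bdP) => j /asboolP [a a0] jmax; exists j, a; split=> // e.
apply: contrapT => e0; have /jmax : P j.+1 by apply/asboolP; exists e.
by rewrite ltnn.
Qed.
End Gram.

(** * Splitting off a matrix block *)

Section Block.
Variables (k : closedFieldType) (E : algType k) (tau : E -> k).
Hypothesis tf : trace_form tau.
Hypothesis nondeg : forall x, radical tau x -> x = 0.
Variables (N : nat) (a : 'I_N -> E) (kappa : 'I_N -> E -> k).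
Hypothesis kappaD : forall i x y, kappa i (x + y) = kappa i x + kappa i y.
Hypothesis kappaZ : forall i c x, kappa i (c *: x) = c * kappa i x.
Hypothesis expand : forall x, x = \sum_i kappa i x *: a i.

Let lreg (x : E) : 'M[k]_N := \matrix_(i, j) kappa i (x * a j).

Let kappa_sum i (I : Type) (r : seq I) (P : pred I) (F : I -> E) :
  kappa i (\sum_(j <- r | P j) F j) = \sum_(j <- r | P j) kappa i (F j).
Proof.
apply: (big_morph (kappa i) (kappaD i)).
by apply: (addrI (kappa i 0)); rewrite -kappaD !addr0.
Qed.

Let lregM x y : lreg (x * y) = lreg x *m lreg y.
Proof.
apply/matrixP => i j; rewrite !mxE -mulrA {1}(expand (y * a j)) mulr_sumr kappa_sum.
by apply: eq_bigr => l _; rewrite !mxE -scalerAr kappaZ mulrC.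
Qed.

Let lreg_inj x y : lreg x = lreg y -> x = y.
Proof.
move=> e; suff H j : x * a j = y * a j.
  rewrite -[x]mulr1 -[y]mulr1 (expand 1) !mulr_sumr; apply: eq_bigr => j _.
  by rewrite -!scalerAr H.
rewrite [LHS]expand [RHS]expand; apply: eq_bigr => i _; congr (_ *: _).
by have /matrixP/(_ i j) := e; rewrite !mxE.
Qed.

(** An idempotent whose left multiplication has minimal rank: for a nonzero
    idempotent below it the rank is the same, which forces equality. *)
Let minimal_idempotent : exists e : E, [/\ e != 0, e * e = e &
  forall e', e' * e' = e' -> e * e' = e' -> e' * e = e' -> e' != 0 -> e' = e].
Proof.
pose P r := `[< exists e : E, [/\ e != 0, e * e = e & \rank (lreg e) = r] >].
have exP : exists r, P r.
  exists (\rank (lreg 1)); apply/asboolP; exists 1.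
  by split; rewrite ?mulr1 ?oner_neq0.
case: (ex_minnP exP) => r /asboolP [e [e0 ee re]] rmin; exists e; split=> // e' ee' l1 l2 e'0.
have le' : (\rank (lreg e) <= \rank (lreg e'))%N.
  by rewrite re; apply: rmin; apply/asboolP; exists e'.
have : (lreg e' <= lreg e)%MS by rewrite -l2 lregM submxMl.
move/mxrank_leqif_eq => [le1]; rewrite eqn_leq le1 le' => /esym.
case/andP => _ /submxP [D De].
by rewrite -l1; apply: lreg_inj; rewrite lregM De -mulmxA -lregM ee' -De.
Qed.

Section MinimalIdempotent.
Variable e : E.
Hypothesis e0 : e != 0.
Hypothesis ee : e * e = e.
Hypothesis emin : forall e', e' * e' = e' -> e * e' = e' -> e' * e = e' -> e' != 0 -> e' = e.

(** The minimal polynomial of x in the corner e E e is a power of a linear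
    polynomial: otherwise Bezout's identity for two coprime factors would give
    an idempotent of the corner different from e. *)
Let local x : x * e = x -> e * x = x ->
  exists (c : k) q, (x - c *: e) ^+ q.+1 = 0.
Proof.
move=> xe ex.
have ce p : horner_alg x p * e = e * horner_alg x p.
  elim/poly_ind: p => [|p c IH]; first by rewrite rmorph0 mul0r mulr0.
  rewrite rmorphD rmorphM /= horner_algX horner_algC mulrDl mulrDr -mulrA xe mulrA.
  by rewrite -IH -(mulrA _ e) ex -scalerAl -scalerAr mul1r mulr1.
pose P m := `[< exists g : {poly k}, [/\ g != 0, size g = m & horner_alg x g * e = 0] >].
have exP : exists m, P m.
  have [g g0 gT] := tf_alg tf x; exists (size g); apply/asboolP; exists g.
  by rewrite (nondeg gT) mul0r.
case: (ex_minnP exP) => m /asboolP [g [g0 sg gx]] gmin.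
have sg1 : size g != 1.
  apply/negP => /size_poly1P [c c0 gE]; move: gx; rewrite gE horner_algC -scalerAl mul1r.
  by move/eqP; rewrite scaler_eq0 (negPf c0) (negPf e0).
have [c gc] := closed_rootP g sg1.
have [q [g1 + gE]] := multiplicity_XsubC g c; rewrite g0 /= => g1c.
case: q gE => [|q] gE.
  by move: gc; rewrite gE expr0 mulr1 (negPf g1c).
exists c, q.
have /Bezout_eq1_coprimepP [[u v] /= uv] : coprimep g1 (('X - c%:P) ^+ q.+1).
  by rewrite coprimep_expr // coprimep_XsubC.
(* The idempotents of the Chinese remainder theorem, modulo g and cut by e,
   for the factorization g = g1 ('X - c) ^ (q + 1). *)
pose e1 := horner_alg x (u * g1) * e; pose e2 := horner_alg x (v * ('X - c%:P) ^+ q.+1) * e.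
have e12 : e1 + e2 = e by rewrite -mulrDl -rmorphD uv rmorph1 mul1r.
have hM (p1 p2 : {poly k}) : horner_alg x p1 * e * (horner_alg x p2 * e) = horner_alg x (p1 * p2) * e.
  by rewrite rmorphM -!mulrA; congr (_ * _); rewrite mulrA -ce -mulrA ee.
have g0M (p : {poly k}) : horner_alg x (p * g) * e = 0 by rewrite rmorphM -mulrA gx mulr0.
have e1e2 : e1 * e2 = 0.
  rewrite hM (_ : u * g1 * _ = u * v * g); first exact: g0M.
  by rewrite gE; ring.
have e11 : e1 * e1 = e1.
  rewrite -[LHS]addr0 -e1e2 -mulrDr e12 /e1 -mulrA; congr (_ * _).
  by rewrite ee.
have ee1 : e * e1 = e1 by rewrite /e1 mulrA -ce -mulrA ee.
have e1e : e1 * e = e1 by rewrite /e1 -mulrA ee.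
have e1n0 : e1 != 0.
  apply/negP => /eqP e10; move: e12; rewrite e10 add0r => e2e.
  have g1x : horner_alg x g1 * e = 0.
    rewrite -[e in LHS]ee mulrA -{2}e2e hM (_ : g1 * _ = v * g); first exact: g0M.
    by rewrite gE; ring.
  have g10 : g1 != 0 by apply: contraTneq g0 => g10; rewrite gE g10 mul0r eqxx.
  have : (m <= size g1)%N by apply: gmin; apply/asboolP; exists g1.
  rewrite -sg gE size_Mmonic ?monic_exp ?monicXsubC // size_exp_XsubC.
  by rewrite addnS /= addnS ltnNge leq_addr.
have e1E := emin e11 ee1 e1e e1n0.
have pw r : (x - c *: e) ^+ r.+1 = horner_alg x (('X - c%:P) ^+ r.+1) * e.
  have y1 : horner_alg x ('X - c%:P) * e = x - c *: e.
    by rewrite rmorphB /= horner_algX horner_algC mulrBl xe -scalerAl mul1r.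
  elim: r => [|r IH]; first by rewrite !expr1 y1.
  by rewrite exprSr IH -y1 hM -exprSr.
rewrite pw -[e in LHS]ee mulrA -{2}e1E hM (_ : _ * (u * g1) = u * g) ?g0M //.
by rewrite gE; ring.
Qed.

(** The corner of a minimal idempotent is the field of scalars. Every element of
    the corner is a scalar plus a nilpotent element by [local], and a nilpotent
    y vanishes: otherwise its products u with elements of the corner would be
    nilpotent too, since a nonzero eigenvalue of u is incompatible with the last
    nonzero power of y, so that y would be in the radical of the form. *)
Lemma minimal_corner x : e * x * e = (tau (x * e) / tau e) *: e.
Proof.
have key y : e * y = y -> y * e = y -> forall q, y ^+ q.+1 = 0 -> y = 0.
  move=> ey ye q yq; apply/eqP/negPn/negP => y0.
  have [p yp yp1] : exists2 p, y ^+ p.+1 != 0 & y ^+ p.+2 = 0.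
    elim: q yq => [|q IH] yq; first by move: y0; rewrite -(expr1 y) yq eqxx.
    by have [/IH //|nz] := eqVneq (y ^+ q.+1) 0; exists q.
  case/eqP: y0; apply: nondeg => w.
  (* The element u is in the corner, so it has a single eigenvalue c. *)
  pose u := y * (e * w * e).
  have eu : e * u = u by rewrite /u mulrA ey.
  have ue : u * e = u by rewrite /u -!mulrA ee.
  have [c [r ur]] := local ue eu.
  have c0 : c = 0.
    apply/eqP/negPn/negP => c0; move: yp; set Y := y ^+ p.+1 => yp.
    have Yy : Y * y = 0 by rewrite -exprSr.
    have Ye : Y * e = Y by rewrite /Y exprSr -mulrA ye.
    have yu i : Y * (u - c *: e) ^+ i = (- c) ^+ i *: Y.
      elim: i => [|i IH]; first by rewrite mulr1 scale1r.
      rewrite exprSr mulrA IH -scalerAl mulrBr /u (mulrA Y) Yy mul0r sub0r.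
      by rewrite -scalerAr Ye -scaleNr scalerA -exprSr.
    have := yu r.+1; rewrite ur mulr0 => /esym/eqP.
    by rewrite scaler_eq0 expf_eq0 oppr_eq0 (negPf c0) (negPf yp).
  rewrite c0 scale0r subr0 in ur.
  have -> : tau (y * w) = tau u.
    by rewrite /u -{1}ye -{1}ey -!mulrA (tfC tf) !mulrA.
  by apply: (tf_nil tf (q := r.+1)); rewrite ur; apply: rad0.
have ux w : e * (e * w * e) = e * w * e by rewrite !mulrA ee.
have xu w : (e * w * e) * e = e * w * e by rewrite -!mulrA ee.
have corner w : exists c : k, e * w * e = c *: e.
  have [c [q yq]] := local (xu w) (ux w); exists c; apply/eqP; rewrite -subr_eq0.
  by apply/eqP; apply: key yq; rewrite ?mulrBr ?mulrBl ?ux ?xu -?scalerAl -?scalerAr ee.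
have tauE w : tau (w * e) = tau (e * w * e) by rewrite -{1}ee mulrA (tfC tf) mulrA.
have te0 : tau e != 0.
  apply/negP => /eqP te0; case/eqP: e0; apply: nondeg => w.
  by rewrite (tfC tf) tauE; have [c ->] := corner w; rewrite (tfZ tf) te0 mulr0.
have [c H] := corner x; rewrite tauE H; congr (_ *: _).
by rewrite (tfZ tf) mulfK.
Qed.

Lemma minimal_trace : tau e != 0.
Proof.
apply/negP => /eqP te0; case/eqP: e0; rewrite -ee -[e * e]mulr1.
by have := minimal_corner 1; rewrite te0 invr0 mulr0 scale0r mulr1 => ->; rewrite mul0r.
Qed.

Let n_le m (v w : 'I_m -> E) :
  (forall i j, w i * v j = (i == j)%:R *: e) -> (m <= N)%N.
Proof.
move=> wv; rewrite leqNgt; apply/negP => ltNm.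
have /eqP := det_mul_narrow (\matrix_(i, l) tau (w i * a l))
  (\matrix_(l, j) kappa l (v j)) ltNm.
rewrite (_ : _ *m _ = (tau e)%:M).
  by rewrite det_scalar expf_eq0 (negPf minimal_trace) andbF.
apply/matrixP => i j; rewrite !mxE.
have := congr1 tau (wv i j); rewrite (tfZ tf) {1}(expand (v j)) mulr_sumr (tf_sum tf).
rewrite mulr_natl => <-; apply: eq_bigr => l _.
by rewrite !mxE -scalerAr (tfZ tf) mulrC.
Qed.

(** A dual pair: v spans part of the left ideal E e, and w is the dual system in
    the right ideal e E, the pairing being the multiplication to e E e = k e. *)
Let dual m (v w : 'I_m -> E) := [/\ forall i, v i * e = v i, forall i, e * w i = w i &
  forall i j, w i * v j = (i == j)%:R *: e].

(** A maximal dual pair spans E e: a nonzero x' in E e orthogonal to w is paired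
    with some y, as the form is nondegenerate, and so extends the pair. *)
Let dual_maximal : exists m (v w : 'I_m -> E), dual v w /\
  forall x, x * e = x -> x = \sum_i v i * w i * x.
Proof.
pose P m := `[< exists v w : 'I_m -> E, dual v w >].
have exP : exists m, P m.
  by exists 0%N; apply/asboolP; exists (fun _ => 0), (fun _ => 0); split=> -[].
have bdP m : P m -> (m <= N)%N by move=> /asboolP [v [w [_ _ /n_le]]].
case: (ex_maxnP exP bdP) => m /asboolP [v [w [ve ew wv]]] mmax.
exists m, v, w; split=> // x xe; apply/eqP; rewrite -subr_eq0; set x' := _ - _.
apply/negPn/negP => x'0.
have x'e : x' * e = x'.
  rewrite mulrBl xe mulr_suml; congr (_ - _); apply: eq_bigr => i _.
  by rewrite -(mulrA _ x) xe.
have wx' j : w j * x' = 0.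
  rewrite mulrBr mulr_sumr (bigD1 j) //= !mulrA wv eqxx scale1r ew big1 ?addr0 ?subrr // => i.
  by rewrite !mulrA wv eq_sym => /negPf ->; rewrite scale0r !mul0r.
have [y ty] : exists y, tau (y * x') != 0.
  apply: contrapT => nex; case/eqP: x'0; apply: nondeg => y; rewrite (tfC tf).
  by apply: contrapT => /eqP t0; apply: nex; exists y.
pose c := tau (x' * y) / tau e.
have c0 : c != 0 by rewrite mulf_neq0 ?invr_eq0 ?minimal_trace // (tfC tf).
have yx' : e * y * x' = c *: e.
  have -> : e * y * x' = e * (y * x') * e by rewrite -!mulrA x'e.
  by rewrite minimal_corner -mulrA x'e (tfC tf).
pose y0 := c^-1 *: (e * y).
have y0x' : y0 * x' = e by rewrite -scalerAl yx' scalerA mulVf ?scale1r.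
have ey0 : e * y0 = y0 by rewrite -scalerAr mulrA ee.
pose w' := y0 - \sum_i y0 * v i * w i.
have ew' : e * w' = w'.
  rewrite mulrBr ey0 mulr_sumr; congr (_ - _); apply: eq_bigr => i _.
  by rewrite !mulrA ey0.
have w'x' : w' * x' = e.
  rewrite mulrBl y0x' mulr_suml big1 ?subr0 // => i _.
  by rewrite -(mulrA _ (w i)) wx' mulr0.
have w'v j : w' * v j = 0.
  rewrite mulrBl mulr_suml (bigD1 j) //= -[y0 * v j * w j * v j]mulrA wv eqxx scale1r.
  rewrite -[y0 * v j * e]mulrA ve big1 ?addr0 ?subrr // => i.
  by rewrite -(mulrA _ (w i)) wv => /negPf ->; rewrite scale0r mulr0.
have /mmax : P m.+1.
  apply/asboolP; exists (fun i => if unlift ord0 i is Some j then v j else x'),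
    (fun i => if unlift ord0 i is Some j then w j else w'); split=> [i|i|i j].
  - by case: unliftP.
  - by case: unliftP.
  case: unliftP => [i' ->|->]; case: unliftP => [j' ->|->];
    rewrite ?wv ?wx' ?w'v ?w'x' ?eqxx ?scale1r ?(inj_eq lift_inj) //.
    by rewrite eq_sym (negPf (neq_lift _ _)) scale0r.
  by rewrite (negPf (neq_lift _ _)) scale0r.
by rewrite ltnn.
Qed.

(** For a maximal dual pair (v, w), the element z = \sum_i v_i w_i is the
    identity of the two-sided ideal generated by e, it is central, and x |->
    (w_i x v_j) identifies that ideal with a matrix algebra. The element u, for
    which e is taken, witnesses that the form is nonzero on the ideal. *)
Lemma minimal_block : exists (m : nat) (rho : {rmorphism E -> 'M[k]_m}) (z u : E),
  [/\ [/\ (0 < m)%N, forall c x, rho (c *: x) = c *: rho x & forall M, exists x, rho x = M],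
      [/\ forall x, z * x = x * z, z * z = z, rho z = 1 & forall x, rho x = 0 <-> z * x = 0]
    & z * u = u /\ tau (u * u) != 0].
Proof.
have [m [v [w [[ve ew wv] full]]]] := dual_maximal.
pose z := \sum_i v i * w i.
have zl x : x * e = x -> z * x = x.
  by move=> xe; rewrite [RHS](full x xe) mulr_suml.
have zr x : e * x = x -> x * z = x.
  move=> ex; apply/eqP; rewrite eq_sym -subr_eq0; apply/eqP.
  apply: nondeg => y; set d := x - _.
  have ed : e * d = d by rewrite mulrBr mulrA ex.
  have -> : tau (d * y) = tau (d * (y * e)) by rewrite -{1}ed -mulrA (tfC tf) -mulrA.
  by rewrite mulrBl -mulrA zl ?subrr ?(tf0 tf) // -mulrA ee.
have zxz x : z * x = z * x * z.
  rewrite {1 2}/z !mulr_suml; apply: eq_bigr => i _.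
  by rewrite -!mulrA; congr (_ * _); rewrite mulrA zr // mulrA ew.
have xzz x : x * z = z * x * z.
  rewrite {1 3}/z !mulr_sumr; apply: eq_bigr => i _.
  by rewrite !mulrA; congr (_ * _); rewrite -mulrA zl // -mulrA ve.
have zC x : z * x = x * z by rewrite zxz -xzz.
pose rho x : 'M[k]_m := \matrix_(i, j) (tau (w i * x * v j) / tau e).
have rhoE x i j : w i * x * v j = rho x i j *: e.
  rewrite mxE -[in RHS](ve j) !mulrA -minimal_corner !mulrA ew.
  by rewrite -(mulrA _ (v j)) ve.
have inj_e (c d : k) : c *: e = d *: e -> c = d.
  by move/(congr1 tau); rewrite !(tfZ tf) => /(mulIf minimal_trace).
have rhoD : zmod_morphism rho.
  by move=> x y; apply/matrixP => i j; rewrite !mxE mulrBr mulrBl (tfB tf) mulrBl.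
have rhoM : monoid_morphism rho.
  split=> [|x y]; apply/matrixP => i j; apply: inj_e; rewrite -rhoE.
    by rewrite mulr1 wv mxE.
  have -> : w i * (x * y) * v j = w i * x * (z * (y * v j)).
    by rewrite zl ?mulrA // -mulrA ve.
  rewrite /z mulr_suml mulr_sumr [(rho x * rho y) i j]mxE scaler_suml.
  apply: eq_bigr => l _; transitivity (w i * x * v l * (w l * y * v j)).
    by rewrite !mulrA.
  by rewrite !rhoE -scalerAl -scalerAr ee scalerA.
pose rho' : {rmorphism E -> 'M[k]_m} := HB.pack rho
  (GRing.isZmodMorphism.Build _ _ rho rhoD) (GRing.isMonoidMorphism.Build _ _ rho rhoM).
exists m, rho', z, e; split; first split.
- case: (m) v w ve ew wv full {z zl zr zxz xzz zC rho rhoE rhoD rhoM rho'} => //.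
  by move=> v w _ _ _ /(_ e ee) e00; move: e0; rewrite e00 big_ord0 eqxx.
- move=> c x; apply/matrixP => i j; apply: inj_e.
  have -> : (c *: rho' x) i j = c * rho x i j by rewrite [LHS]mxE.
  by rewrite -rhoE -scalerA -rhoE -scalerAr -scalerAl.
- move=> M; exists (\sum_i \sum_j M i j *: (v i * w j)).
  apply/matrixP => i j; apply: inj_e; rewrite -rhoE mulr_sumr mulr_suml (bigD1 i) //=.
  rewrite [X in _ + X]big1 ?addr0 => [|i' ne]; last first.
    rewrite mulr_sumr mulr_suml big1 // => j' _.
    by rewrite -scalerAr mulrA wv eq_sym (negPf ne) scale0r mul0r scaler0 mul0r.
  rewrite mulr_sumr mulr_suml (bigD1 j) //= big1 ?addr0 => [|j' ne].
    by rewrite -scalerAr mulrA wv eqxx scale1r ew -scalerAl wv eqxx scale1r.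
  rewrite -scalerAr mulrA wv eqxx scale1r ew -scalerAl wv (negPf ne).
  by rewrite scale0r scaler0.
- split=> //; first by rewrite {1}/z mulr_suml; apply: eq_bigr => i _; rewrite -mulrA zr ?ew.
  + apply/matrixP => i j; apply: inj_e; rewrite -rhoE [(1 : 'M_m) i j]mxE.
    by rewrite zr // wv.
  + move=> x; split=> [rx|zx].
      rewrite zxz /z mulr_suml mulr_suml big1 // => i _.
      rewrite mulr_sumr big1 // => j _.
      have -> : v i * w i * x * (v j * w j) = v i * (w i * x * v j) * w j by rewrite !mulrA.
      rewrite rhoE (_ : rho x = 0) ?mxE ?scale0r ?mulr0 ?mul0r //; exact: rx.
    apply/matrixP => i j; apply: inj_e; rewrite -rhoE [(0 : 'M_m) i j]mxE scale0r.
    by rewrite -[w i]zr // -(mulrA _ z) zx mulr0 mul0r.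
- by split; [rewrite zl | rewrite ee minimal_trace].
Qed.
End MinimalIdempotent.

Lemma simple_block : exists (m : nat) (rho : {rmorphism E -> 'M[k]_m}) (z u : E),
  [/\ [/\ (0 < m)%N, forall c x, rho (c *: x) = c *: rho x & forall M, exists x, rho x = M],
      [/\ forall x, z * x = x * z, z * z = z, rho z = 1 & forall x, rho x = 0 <-> z * x = 0]
    & z * u = u /\ tau (u * u) != 0].
Proof. by have [e [e0 ee emin]] := minimal_idempotent; apply: (minimal_block e0 ee). Qed.
End Block.

(** * The semisimple quotient of an algebra with a trace form *)

Section QuotientAlgebra.
Variables (k : fieldType) (A : algType k) (X : set A).
Hypothesis X1 : ~ ideal_gen X 1.

(** The quotient as a nontrivial algebra: the proof that the ideal is proper is
    a parameter of the type, which lets the structures be inferred. *)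
Definition quo_alg (_ : ~ ideal_gen X 1) : Type := quo X.
Local Notation Q := (quo_alg X1).
HB.instance Definition _ := GRing.PzRing.on Q.

Let pi (x : A) : Q := quo_pi X x.
Let scale (a : k) (q : Q) : Q := pi a%:A * q.

Fact quo_alg_neq0 : (1 : Q) != 0.
Proof. by apply/eqP => /quo_piP; rewrite subr0. Qed.
HB.instance Definition _ := GRing.PzSemiRing_isNonZero.Build Q quo_alg_neq0.

Let piD x y : pi (x + y) = pi x + pi y. Proof. exact: (rmorphD (quo_pi X)). Qed.
Let piM x y : pi (x * y) = pi x * pi y. Proof. exact: (rmorphM (quo_pi X)). Qed.

Fact quo_alg_scaleA a b q : scale a (scale b q) = scale (a * b) q.
Proof. by rewrite /scale mulrA -piM -scalerAl mul1r scalerA. Qed.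
Fact quo_alg_scale1 : left_id 1 scale.
Proof. by move=> q; rewrite /scale scale1r /pi rmorph1 mul1r. Qed.
Fact quo_alg_scaleDr : right_distributive scale +%R.
Proof. by move=> a u v; rewrite /scale mulrDr. Qed.
Fact quo_alg_scaleDl v : {morph scale^~ v : a b / a + b}.
Proof. by move=> a b; rewrite /scale scalerDl piD mulrDl. Qed.
HB.instance Definition _ := GRing.Zmodule_isLmodule.Build k Q
  quo_alg_scaleA quo_alg_scale1 quo_alg_scaleDr quo_alg_scaleDl.

Fact quo_alg_scaleAl (a : k) (u v : Q) : a *: (u * v) = a *: u * v.
Proof. exact: mulrA. Qed.
HB.instance Definition _ := GRing.Lmodule_isLalgebra.Build k Q quo_alg_scaleAl.
Fact quo_alg_scaleAr (a : k) (u v : Q) : a *: (u * v) = u * (a *: v).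
Proof.
rewrite -[u](quo_reprK u) -[v](quo_reprK v); move: (repr _) (repr _) => y x.
rewrite -[LHS]/(pi a%:A * (pi x * pi y)) -[RHS]/(pi x * (pi a%:A * pi y)) -!piM.
by rewrite mulr_algl mulr_algl scalerAr.
Qed.
HB.instance Definition _ := GRing.Lalgebra_isAlgebra.Build k Q quo_alg_scaleAr.

Definition quo_proj (x : A) : Q := pi x.
Fact quo_proj_zmod : zmod_morphism quo_proj. Proof. exact: (rmorphB (quo_pi X)). Qed.
Fact quo_proj_monoid : monoid_morphism quo_proj.
Proof. by split=> [|x y]; [exact: (rmorph1 (quo_pi X)) | exact: piM]. Qed.
HB.instance Definition _ := GRing.isZmodMorphism.Build A Q quo_proj quo_proj_zmod.
HB.instance Definition _ := GRing.isMonoidMorphism.Build A Q quo_proj quo_proj_monoid.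
Fact quo_proj_scalable : scalable quo_proj.
Proof. by move=> a x; rewrite -mulr_algl rmorphM. Qed.
HB.instance Definition _ := GRing.isScalable.Build k A Q *:%R quo_proj quo_proj_scalable.

Lemma quo_projP x y : quo_proj x = quo_proj y <-> ideal_gen X (x - y).
Proof. exact: quo_piP. Qed.
End QuotientAlgebra.

Section Wedderburn.
Variables (k : closedFieldType) (A : algType k).
Hypothesis char0 : [pchar k] =i pred0.

Definition form_gram (tau : A -> k) l (e : 'I_l -> A) : 'M[k]_l :=
  \matrix_(r, s) tau (e r * e s).

Let K2 : (2%:R : k) <> 0. Proof. by apply/eqP; apply: natr_neq0. Qed.

Section Form.
Variable tau : A -> k.
Hypothesis tf : trace_form tau.
Let B x y := tau (x * y).
Let Blin c x y z : B (c *: x + y) z = c * B x z + B y z.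
Proof. by rewrite /B mulrDl (tfD tf) -scalerAl (tfZ tf). Qed.
Let Bsym x y : idfun (B x y) = idfun (B y x). Proof. by rewrite /= /B (tfC tf). Qed.

(** A tuple of maximal size with nonzero Gram determinant is a basis modulo the
    radical, the coordinates kappa being those of the orthogonal projection. *)
Lemma form_expand s : (forall l (e : 'I_l -> A), (s < l)%N -> \det (form_gram tau e) = 0) ->
  exists N (a : 'I_N -> A) (kappa : 'I_N -> A -> k),
  [/\ \det (form_gram tau a) <> 0, forall i x y, kappa i (x + y) = kappa i x + kappa i y,
      forall i c x, kappa i (c *: x) = c * kappa i x,
      forall i x, radical tau x -> kappa i x = 0
    & forall x, radical tau (x - \sum_i kappa i x *: a i)].
Proof.
move=> bd; have [N [a amax]] := gram_maximal_exists (B := B) (chi := idfun) bd.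
set d := \det (gram B a); have d0 : d <> 0 by case: amax.
exists N, a, (fun i x => d^-1 * gram_coord B a x i); split=> //.
- move=> i x y; rewrite -mulrDr -big_split; congr (_ * _); apply: eq_bigr => m _ /=.
  by rewrite /B mulrDl (tfD tf) mulrDl.
- move=> i c x; rewrite mulrCA; congr (_ * _); rewrite mulr_sumr; apply: eq_bigr => m _.
  by rewrite /B -scalerAl (tfZ tf) mulrA.
- move=> i x Tx; rewrite [gram_coord _ _ _ _]big1 ?mulr0 // => m _.
  by rewrite /B Tx mul0r.
move=> x y; have := gram_maximalP (@field_domain k) K2 Blin Bsym amax x y.
rewrite /= -/d /gram_proj -/d => E; apply: (mulfI (x := d)); first exact/eqP.
rewrite mulr0 -(tfZ tf) scalerAl scalerBr scaler_sumr -[RHS]E; congr (tau ((_ - _) * y)).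
by apply: eq_bigr => i _; rewrite scalerA mulrA divff ?mul1r //; apply/eqP.
Qed.

(** A simple block of the quotient by the radical, lifted to A; the relations of
    the central idempotent z hold modulo the radical. *)
Lemma form_block s :
  (forall l (e : 'I_l -> A), (s < l)%N -> \det (form_gram tau e) = 0) -> ~ radical tau 1 ->
  exists (m : nat) (rho : {rmorphism A -> 'M[k]_m}) (z u : A),
  [/\ [/\ (0 < m)%N, forall c x, rho (c *: x) = c *: rho x & forall M, exists x, rho x = M],
      [/\ forall x, radical tau (z * x - x * z), radical tau (z * z - z), rho z = 1
        & forall x, rho x = 0 <-> radical tau (z * x)]
    & radical tau (z * u - u) /\ tau (u * u) != 0].
Proof.
move=> bd T1; have [N [a [kappa [_ kD kZ kT kexp]]]] := form_expand bd.
have radE x : ideal_gen (radical tau) x <-> radical tau x.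
  split=> [|Tx]; last exact: igen_sub.
  apply=> //; split=> [|y w|b y Ty]; [exact: rad0|exact: radD|split].
    exact: radMl.
  exact: radMr.
have X1 : ~ ideal_gen (radical tau) 1 by move/radE.
pose E : algType k := quo_alg X1; pose pi : {lrmorphism A -> E} := @quo_proj k A _ X1.
have piZ (c : k) (x : A) : pi (c *: x) = c *: pi x by apply: linearZ_LR.
have piD (x y : A) : pi (x + y) = pi x + pi y by apply: rmorphD.
have piM (x y : A) : pi (x * y) = pi x * pi y by apply: rmorphM.
have pi1 : pi 1 = 1 by apply: rmorph1.
have piP x y : pi x = pi y <-> radical tau (x - y).
  by split=> [/quo_projP /radE //|h]; apply/quo_projP/radE.
pose t (q : E) := tau (repr (q : quo (radical tau))).
have reprK (q : E) : pi (repr (q : quo (radical tau))) = q by apply: quo_reprK.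
have tpi x : t (pi x) = tau x.
  have /piP /(rad_tau) := reprK (pi x); rewrite (tfB tf) => /eqP.
  by rewrite subr_eq0 => /eqP.
have W (P : E -> Prop) : (forall x, P (pi x)) -> forall q, P q.
  by move=> h q; rewrite -(reprK q).
have radt x : radical t (pi x) <-> radical tau x.
  split=> H y; first by have := H (pi y); rewrite -piM tpi.
  by elim/W: y => y; rewrite -piM tpi.
have tft : trace_form t.
  split.
  - by elim/W=> x; elim/W=> y; rewrite -piD !tpi (tfD tf).
  - by move=> c; elim/W=> x; rewrite -piZ !tpi (tfZ tf).
  - by elim/W=> x; elim/W=> y; rewrite -!piM !tpi (tfC tf).
  - by elim/W=> x q; rewrite -rmorphXn radt tpi; apply: tf_nil.
  elim/W=> x; have [g g0 gx] := tf_alg tf x; exists g => //.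
  suff -> : horner_alg (pi x) g = pi (horner_alg x g) by apply/radt.
  elim/poly_ind: (g) => [|p c IH]; first by rewrite !rmorph0.
  have hE (y : E) : horner_alg y (p * 'X + c%:P) = horner_alg y p * y + c%:A.
    by rewrite rmorphD rmorphM /= horner_algX horner_algC.
  have hA : horner_alg x (p * 'X + c%:P) = horner_alg x p * x + c%:A.
    by rewrite rmorphD rmorphM /= horner_algX horner_algC.
  by rewrite hE hA IH piD piM piZ pi1.
have nd (q : E) : radical t q -> q = 0.
  by elim/W: q => x /radt Tx; rewrite -(rmorph0 pi); apply/piP; rewrite subr0.
pose kq i (q : E) := kappa i (repr (q : quo (radical tau))).
have kpi i x : kq i (pi x) = kappa i x.
  have /piP /(kT i) := reprK (pi x); rewrite kD -scaleN1r kZ mulN1r => /eqP.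
  by rewrite subr_eq0 => /eqP.
have [] := @simple_block k E t tft nd N (fun i => pi (a i)) kq.
- by move=> i; elim/W=> x; elim/W=> y; rewrite -piD !kpi kD.
- by move=> i c; elim/W=> x; rewrite -piZ !kpi kZ.
- elim/W=> x; rewrite (eq_bigr (fun i => pi (kappa i x *: a i))).
    by rewrite -rmorph_sum; apply/piP; apply: kexp.
  by move=> i _; rewrite kpi piZ.
move=> m [rho [zq [uq [[m0 rZ rS] [zC zz z1 zK] [zu uu]]]]].
move: zq uq zC zz z1 zK zu uu; elim/W=> z; elim/W=> u zC zz z1 zK zu uu.
exists m, (rho \o pi), z, u; split; split=> //.
- by move=> c x; rewrite /= piZ rZ.
- by move=> M; have [q <-] := rS M; exists (repr (q : quo (radical tau))); rewrite /= reprK.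
- by move=> x; apply/piP; rewrite !piM.
- by apply/piP; rewrite piM.
- move=> x; rewrite /= zK -piM -(rmorph0 pi); split=> [/piP|h]; first by rewrite subr0.
  by apply/piP; rewrite subr0.
- by apply/piP; rewrite piM.
- by rewrite -tpi rmorphM.
Qed.
End Form.

(** Induction on a bound for the rank of the form. A block is split off, and the
    form tau' = tau ((1 - z) x) has smaller rank, because u is orthogonal to (1
    - z) A and has tau (u ^ 2) nonzero. The representations of A through the
    quotient by the radical of tau' together with the block are all of them. *)
Theorem wedderburn s (tau : A -> k) : trace_form tau ->
  (forall l (e : 'I_l -> A), (s < l)%N -> \det (form_gram tau e) = 0) ->
  exists (I : finType) (m : I -> nat) (rho : forall i, {rmorphism A -> 'M[k]_(m i)}),
  [/\ forall i, (0 < m i)%N, forall i c x, rho i (c *: x) = c *: rho i x,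
      forall M : forall i, 'M[k]_(m i), exists x, forall i, rho i x = M i
    & forall x, (forall i, rho i x = 0) <-> radical tau x].
Proof.
elim: s tau => [|s IH] tau tf bd.
  have full x : radical tau x.
    have sq y : tau (y * y) = 0.
      by have := bd 1%N (fun _ => y) isT; rewrite det_mx11 mxE.
    move=> y; have := sq (x + y); rewrite mulrDl !mulrDr !(tfD tf) !sq add0r addr0.
    by rewrite (tfC tf y) -mulr2n -mulr_natl => /(@field_domain k) [].
  exists void, (of_void nat), (fun v : void => match v with end).
  by split=> [[]|[]|M|x]; [exists 0; case | split=> // _ []].
have [T1|T1] := pselect (radical tau 1).
  exists void, (of_void nat), (fun v : void => match v with end).
  split=> [[]|[]|M|x]; first by exists 0; case.
  by split=> [_|_ []]; rewrite -[x]mul1r; apply: radMr.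
have [m [rho [z [u [[m0 rZ rS] [zC zz z1 zK] [zu uu]]]]]] := form_block tf bd T1.
pose tau' x := tau ((1 - z) * x).
have T'P x : radical tau' x <-> radical tau ((1 - z) * x).
  by split=> H y; have := H y; rewrite /tau' mulrA.
have fC x : radical tau ((1 - z) * x - x * (1 - z)).
  have -> : (1 - z) * x - x * (1 - z) = - (z * x - x * z).
    by rewrite mulrBl mulrBr mul1r mulr1 !opprB addrC addrA subrK.
  exact: radN.
have ff : radical tau ((1 - z) * (1 - z) - (1 - z)).
  by rewrite -{3}(mulr1 (1 - z)) -mulrBr addrAC subrr sub0r mulrN mulrBl mul1r opprB.
have radE x y : radical tau (x - y) -> tau x = tau y.
  by move/rad_tau; rewrite (tfB tf) => /eqP; rewrite subr_eq0 => /eqP.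
have TT' x : radical tau x -> radical tau' x.
  by move=> Tx; apply/T'P; apply: radMl.
(* These ring identities in A replace computations with the idempotent f = 1
   - z in the quotient, where f is central. *)
have telescope1 (f w y P : A) : f * w * P - f * (w * y) =
    f * w * (P - f * y) - f * (f * w - w * f) * y + (f * f - f) * (w * y).
  by rewrite !mulrBr !mulrBl !mulrA opprB !addrA !subrK.
have telescope2 (f w y : A) : f * (w * y) - f * w * (f * y) =
    f * (f * w - w * f) * y - (f * f - f) * w * y.
  by rewrite !mulrBr !mulrBl !mulrA opprB [RHS]addrC !addrA subrK.
have tf' : trace_form tau'.
  split=> [x y|c x|x y|x q|x].
  - by rewrite /tau' mulrDr (tfD tf).
  - by rewrite /tau' -scalerAr (tfZ tf).
  - rewrite /tau' (tfC tf) mulrA [RHS](tfC tf); apply: radE; rewrite -mulrA -mulrBr.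
    by apply: radMl => //; rewrite -opprB; apply: radN.
  - move/T'P => H; apply: (tf_nil tf (q := q.+1)).
    suff: radical tau (((1 - z) * x) ^+ q.+1 - (1 - z) * x ^+ q.+1).
      move=> D; rewrite -[X in radical tau X](subrK ((1 - z) * x ^+ q.+1)).
      by apply: radD => //; rewrite exprSr mulrA; apply: radMr.
    elim: q {H} => [|q IHq]; first by rewrite !expr1 subrr; apply: rad0.
    rewrite exprS [x ^+ q.+2]exprS; set y := x ^+ q.+1 in IHq *; set f := 1 - z in IHq *.
    rewrite telescope1.
    by apply: radD; [|apply: radB|apply: radMr] => //; [apply: radMl | apply: radMr; apply: radMl].
  - by have [g g0 /TT' gx] := tf_alg tf x; exists g.
have [|J [m' [rho' [m'0 r'Z r'S r'K]]]] := IH tau' tf'.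
  move=> l e ltl; pose e' i := if unlift ord0 i is Some j then (1 - z) * e j else u.
  have /eqP := bd l.+1 e' ltl; rewrite (expand_det_row _ ord0) big_ord_recl big1 => [|i _].
    rewrite addr0 mulf_eq0 mxE /e' unlift_none (negPf uu) /= /cofactor addn0 expr0 mul1r.
    move/eqP <-; congr (\det _); apply/matrixP => r q; rewrite !mxE !liftK /tau' /=.
    apply: radE; set f := 1 - z; rewrite -!/f.
    rewrite telescope2.
    by apply: radB => //; apply: radMr; [apply: radMl | apply: radMr].
  rewrite mxE /e' unlift_none liftK.
  have -> : tau (u * ((1 - z) * e i)) = 0; last by rewrite mul0r.
  apply: rad_tau; rewrite mulrA; apply: radMr.
  have -> : u * (1 - z) = (z * u - u * z) - (z * u - u) by rewrite mulrBr mulr1 opprB [RHS]addrC addrA subrK.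
  exact: radB.
have r'z i : rho' i z = 0.
  apply: (r'K z).2; apply/T'P; rewrite mulrBl mul1r -opprB; exact: radN.
exists (option J), (fun o => if o is Some i then m' i else m),
  (fun o => match o return {rmorphism A -> 'M[k]_(if o is Some i then m' i else m)} with
            | Some i => rho' i | None => rho end).
split=> [[i|]|[i|]|M|x] //.
- have [x0 hx0] := rS (M None); have [x1 hx1] := r'S (fun i => M (Some i)).
  exists (z * x0 + (1 - z) * x1) => -[i|].
    by rewrite rmorphD !rmorphM rmorphB rmorph1 r'z mul0r add0r subr0 mul1r hx1.
  by rewrite rmorphD !rmorphM rmorphB rmorph1 z1 subrr mul0r addr0 mul1r hx0.
- split=> [H|Tx [i|]]; last 2 first.
  + by apply: (r'K x).2; apply: TT'.
  + by apply/zK; apply: radMl.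
  have /zK Tz := H None.
  have /r'K /T'P Tf : forall i, rho' i x = 0 by move=> i; apply: (H (Some i)).
  by have := radD tf Tz Tf; rewrite -mulrDl addrC subrK mul1r.
Qed.
End Wedderburn.

(** * Points of affine algebras *)

Section PrimeSets.
Variable R : comNzRingType.

Record prime_set (P : set R) : Prop := PrimeSet {
  ps0 : P 0;
  psD : forall x y, P x -> P y -> P (x + y);
  psM : forall a x, P x -> P (a * x);
  ps1 : ~ P 1;
  psP : forall x y, P (x * y) -> P x \/ P y }.

Variable P : set R.
Hypothesis pP : prime_set P.
Lemma psN x : P x -> P (- x). Proof. by rewrite -mulN1r; apply: psM. Qed.
Lemma psB x y : P x -> P y -> P (x - y).
Proof. by move=> Px Py; apply: (psD pP) => //; apply: psN. Qed.
Lemma psX x n : ~ P x -> ~ P (x ^+ n).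
Proof.
move=> Px; elim: n => [|n IH]; first exact: ps1 pP.
by rewrite exprS => /(psP pP) [].
Qed.
Lemma ps_sum I (r : seq I) (Q : pred I) (F : I -> R) :
  (forall i, Q i -> P (F i)) -> P (\sum_(i <- r | Q i) F i).
Proof. by move=> IF; elim/big_ind: _ => //; [exact: ps0 pP | exact: psD pP]. Qed.
End PrimeSets.

(** Dropping the leading terms of g with coefficients in p reduces a polynomial
    that is nonzero modulo p to one with the same class and a leading
    coefficient outside p; this replaces polynomials over the quotient by p. *)
Lemma trim_poly (R : comNzRingType) (p : set R) (g : {poly R}) :
  p 0 -> (forall x y, p x -> p y -> p (x + y)) ->
  (forall i, p g`_i) \/
  exists g' : {poly R}, [/\ (size g' <= size g)%N, ~ p (lead_coef g') & forall i, p (g - g')`_i].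
Proof.
move=> p0 pD; have := leqnn (size g); move: {2}(size g) => n.
elim: n g => [|n IH] g sg.
  by left=> i; move: sg; rewrite leqn0 size_poly_eq0 => /eqP ->; rewrite coef0.
have [sn|ns] := leqP (size g) n; first exact: IH.
have [pn|npn] := pselect (p g`_n); last first.
  have gn0 : g`_n != 0 by apply/eqP => gn0; apply: npn; rewrite gn0.
  have sgE : size g = n.+1.
    by apply/eqP; rewrite eqn_leq sg ltnNge; apply: contra gn0 => /leq_sizeP ->.
  by right; exists g; split=> // [|i]; rewrite ?lead_coefE ?sgE // subrr coef0.
pose g1 := g - g`_n *: 'X^n.
have pX i : p (g`_n *: 'X^n)`_i.
  by rewrite coefZ coefXn; case: eqP; rewrite ?mulr1 ?mulr0.
have sg1 : (size g1 <= n)%N.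
  apply/leq_sizeP => i; rewrite leq_eqVlt => /orP [/eqP <-|lti].
    by rewrite coefB coefZ coefXn eqxx mulr1 subrr.
  by rewrite coefB coefZ coefXn (leq_sizeP _ _ sg _ lti) gtn_eqF // mulr0 subr0.
have gE : g = g1 + g`_n *: 'X^n by rewrite subrK.
have [all1|[g' [sg' lg' pg']]] := IH g1 sg1.
  by left=> i; rewrite gE coefD; apply: pD.
right; exists g'; split=> // [|i].
  by apply: (leq_trans sg'); apply: (leq_trans sg1); apply: ltnW.
by rewrite gE addrAC coefD; apply: pD.
Qed.

Section NullstellensatzStep.
Variable k : closedFieldType.

(** The Nullstellensatz for the k-algebra R: points of the variety of a prime
    ideal separate the functions that are not in the ideal. The structure of
    k-algebra is given by a ring morphism, so that it passes to polynomial rings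
    by composition. *)
Definition enough_points (R : comNzRingType) (j : {rmorphism k -> R}) :=
  forall (P : set R) b, prime_set P -> ~ P b ->
  exists phi : {rmorphism R -> k},
    [/\ forall x, P x -> phi x = 0, phi b != 0 & forall a, phi (j a) = a].

Variables (R : comNzRingType) (j : {rmorphism k -> R}).
Hypothesis IH : enough_points j.

Let pdiv (f g : {poly R}) : lead_coef g != 0 -> exists (e : nat) q r,
  lead_coef g ^+ e *: f = q * g + r /\ (size r < size g)%N.
Proof.
rewrite lead_coef_eq0 => g0; exists (Pdiv.CommonRing.rscalp f g),
  (Pdiv.CommonRing.rdivp f g), (Pdiv.CommonRing.rmodp f g).
by rewrite Pdiv.ComRing.rdivp_eq Pdiv.CommonRing.ltn_rmodpN0.
Qed.

(** Let p be the trace of P on R. If P is generated by p, then a point of p at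
    which b does not vanish identically is extended by a value that is not a
    root of b. Otherwise let f in P be of minimal degree modulo p; then some
    multiple of b is congruent modulo P to a constant c outside p, and a point
    of p at which c and the leading coefficient of f are nonzero extends to a
    root of f. *)
Lemma enough_points_poly : enough_points (polyC \o j : {rmorphism k -> {poly R}}).
Proof.
move=> P b pP Pb; pose p : set R := [set c | P c%:P].
have pp : prime_set p.
  split=> [|x y px py|a x px||x y]; rewrite /p /=.
  - exact: ps0 pP.
  - by rewrite polyCD; apply: (psD pP).
  - by rewrite polyCM; apply: (psM pP).
  - exact: ps1 pP.
  - by rewrite polyCM => /(psP pP).
have coefP (g : {poly R}) : (forall i, p g`_i) -> P g.
  move=> pg; rewrite -[g]coefK poly_def; apply: (ps_sum pP) => i _.
  by rewrite -mul_polyC mulrC; apply: (psM pP); apply: pg.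
have lead_neq0 (g : {poly R}) : ~ p (lead_coef g) -> lead_coef g != 0.
  by move=> pg; apply/eqP => g0; apply: pg; rewrite g0; apply: (ps0 pp).
have trimP (Q : set {poly R}) (g : {poly R}) : ~ (forall i, p g`_i) -> (forall u, Q g -> (forall i, p (g - u)`_i) -> Q u) ->
    Q g -> exists g' : {poly R}, [/\ Q g', (size g' <= size g)%N & ~ p (lead_coef g')].
  move=> ng QP Qg; have [//|[g' [sg lg pg]]] := trim_poly g (ps0 pp) (psD pp).
  by exists g'; split=> //; apply: (QP g').
have eval (phi : {rmorphism R -> k}) (xi : k) (kills : forall g : {poly R}, P g -> (map_poly phi g).[xi] = 0) :
    (forall a, phi (j a) = a) -> (map_poly phi b).[xi] != 0 ->
    exists psi : {rmorphism {poly R} -> k},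
      [/\ forall x, P x -> psi x = 0, psi b != 0 & forall a, psi ((polyC \o j) a) = a].
  move=> phij nb; exists (horner_eval xi \o map_poly phi); split=> // a.
  by rewrite /= /horner_eval map_polyC hornerC /= phij.
have [allp|] := pselect (forall g : {poly R}, P g -> forall i, p g`_i).
  have [i pbi] : exists i, ~ p (b : {poly R})`_i.
    by apply: contrapT => nex; apply: Pb; apply: coefP => i; apply: contrapT => h; apply: nex; exists i.
  have [phi [phiP phib phij]] := IH pp pbi.
  have : map_poly phi b != 0.
    by apply: contra_neq phib => b0; rewrite -coef_map b0 coef0.
  case/closed_nonrootP => xi nroot; apply: (eval phi xi) => // g Pg.
  suff -> : map_poly phi g = 0 by rewrite horner0.
  by apply/polyP => l; rewrite coef_map coef0; apply: phiP; apply: allp.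
move=> nall; pose F m := `[< exists f : {poly R}, [/\ P f, ~ p (lead_coef f) & size f = m] >].
have exF : exists m, F m.
  have [f0 [Pf0 nf0]] : exists f0 : {poly R}, P f0 /\ ~ forall i, p f0`_i.
    apply: contrapT => nex; apply: nall => g Pg; apply: contrapT => ng.
    by apply: nex; exists g.
  have [|f [Pf _ lf]] := trimP P f0 nf0 _ Pf0; last by exists (size f); apply/asboolP; exists f.
  by move=> u _ /coefP Pu; rewrite -(subKr f0 u); apply: (psB pP).
case: (ex_minnP exF) => m /asboolP [f [Pf lf sf]] fmin.
have small (g : {poly R}) : P g -> (size g < m)%N -> forall i, p g`_i.
  move=> Pg sg; apply: contrapT => ng.
  have [|g' [Pg' sg' lg']] := trimP P g ng _ Pg.
    by move=> u _ /coefP Pu; rewrite -(subKr g u); apply: (psB pP).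
  have : (m <= size g')%N by apply: fmin; apply/asboolP; exists g'.
  by rewrite leqNgt (leq_ltn_trans sg' sg).
have m1 : (1 < m)%N.
  rewrite -sf ltnNge; apply/negP => /size1_polyC fC; apply: lf.
  by rewrite fC lead_coefC; rewrite fC in Pf.
(* The classes of the multiples of b outside P. One of least degree is
   constant: dividing f by it would otherwise give a smaller class, or a
   proper factor of f. *)
pose bQ (g : {poly R}) := ~ P g /\ exists w : {poly R}, P (w * b - g).
have bQP (g u : {poly R}) : bQ g -> (forall i, p (g - u)`_i) -> bQ u.
  move=> [nPg [w Pw]] /coefP Pgu; split.
    by move=> Pu; apply: nPg; rewrite -(subrK u g); apply: (psD pP).
  by exists w; rewrite -(subrK g (w * b)) -addrA; apply: (psD pP).
have bQtrim (g : {poly R}) : bQ g -> exists g' : {poly R}, [/\ bQ g', (size g' <= size g)%N & ~ p (lead_coef g')].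
  move=> Qg; apply: (trimP bQ) => //; last by move=> u; apply: bQP.
  by move=> /coefP; case: Qg.
pose G l := `[< exists g : {poly R}, [/\ bQ g, ~ p (lead_coef g) & size g = l] >].
have exG : exists l, G l.
  have [|g [Qg _ lg]] := bQtrim b; last by exists (size g); apply/asboolP; exists g.
  by split=> //; exists 1; rewrite mul1r subrr; apply: (ps0 pP).
case: (ex_minnP exG) => l /asboolP [g [[nPg [w Pw]] lg sg]] gmin.
have gmin' (g' : {poly R}) : bQ g' -> (l <= size g')%N.
  by move=> /bQtrim [g1 [Q1 s1 l1]]; apply: leq_trans s1; apply: gmin; apply/asboolP; exists g1.
have nPC c : ~ p c -> forall e, ~ P (c ^+ e)%:P.
  by move=> pc e; apply: (psX pp).
have lm : (l <= m)%N.
  rewrite leqNgt; apply/negP => ltml.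
  have [e [q [r [E sr]]]] := pdiv g (lead_neq0 _ lf).
  have : (l <= size r)%N.
    apply: gmin'; split=> [Pr|]; last first.
      exists ((lead_coef f ^+ e)%:P * w).
      have -> : r = (lead_coef f ^+ e)%:P * g - q * f by rewrite mul_polyC E addrC addKr.
      rewrite (_ : _ - _ = (lead_coef f ^+ e)%:P * (w * b - g) + q * f); last by ring.
      by apply: (psD pP); apply: (psM pP).
    have : P ((lead_coef f ^+ e)%:P * g).
      by rewrite mul_polyC E; apply: (psD pP) => //; apply: (psM pP).
    by case/(psP pP) => //; apply: nPC.
  by rewrite leqNgt (leq_trans sr) // sf ltnW.
have l1 : l = 1%N.
  apply/eqP; rewrite eqn_leq; apply/andP; split; last first.
    rewrite -sg size_poly_gt0; apply/eqP => g0; apply: lg.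
    by rewrite g0 lead_coef0; apply: (ps0 pp).
  rewrite leqNgt; apply/negP => l1.
  have [e [q [r [E sr]]]] := pdiv f (lead_neq0 _ lg).
  have [Pr|nPr] := pselect (P r); last first.
    have : (l <= size r)%N.
      apply: gmin'; split=> //; exists (- q * w).
      have -> : r = (lead_coef g ^+ e)%:P * f - q * g by rewrite mul_polyC E addrC addKr.
      rewrite (_ : _ - _ = - (q * (w * b - g)) + - (lead_coef g ^+ e)%:P * f); last by ring.
      by apply: (psD pP); [apply: (psN pP)|]; apply: (psM pP).
    by rewrite leqNgt -sg sr.
  have /(psP pP) [Pq|//] : P (q * g).
    have -> : q * g = (lead_coef g ^+ e)%:P * f - r by rewrite mul_polyC E addrK.
    by apply: (psB pP) => //; apply: (psM pP).
  have qgE : q * g = lead_coef g ^+ e *: f - r by rewrite E addrK.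
  have pM (u v : {poly R}) i : (forall i, p u`_i) -> p (u * v)`_i.
    move=> pu; rewrite coefM; apply: (ps_sum pp) => t _.
    by rewrite mulrC; apply: (psM pp).
  have r0 i : (l <= i.+1)%N -> r`_i = 0.
    by move=> li; apply: (leq_sizeP _ _ (leqnn (size r))); rewrite -ltnS (leq_trans sr) // sg.
  have [allq|[q' [_ lq' pq']]] := trim_poly q (ps0 pp) (psD pp).
    have := pM q g m.-1 allq; rewrite qgE coefB coefZ r0; last lia.
    rewrite subr0 -sf -lead_coefE => /(psP pp) []; last exact: lf.
    exact: (psX pp).
  have Pq' : P q' by rewrite -(subKr q q'); apply: (psB pP) => //; apply: coefP.
  have mq' : (m <= size q')%N by apply: fmin; apply/asboolP; exists q'.
  have : p (lead_coef q' * lead_coef g).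
    rewrite mul_lead_coef; have : (m <= (size q' + size g).-2)%N by rewrite sg; lia.
    move: (_.-2) => i mi; rewrite -[q'](subKr q) mulrBl coefB.
    apply: (psB pp); last exact: pM.
    rewrite qgE coefB coefZ r0; last lia.
    rewrite subr0 (leq_sizeP _ _ (leqnn (size f))) ?mulr0; first exact: (ps0 pp).
    by rewrite sf.
  by case/(psP pp).
have [c gE] : exists c, g = c%:P.
  by exists g`_0; apply: size1_polyC; rewrite sg l1.
move: lg Pw; rewrite {}gE lead_coefC => pc Pw.
have [phi [phiP phic phij]] : exists phi : {rmorphism R -> k},
    [/\ forall x, p x -> phi x = 0, phi (lead_coef f * c) != 0 & forall a, phi (j a) = a].
  by apply: IH => // /(psP pp) [].
move: phic; rewrite rmorphM mulf_eq0 negb_or => /andP [phil phic].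
have [xi xif] : exists xi, root (map_poly phi f) xi.
  by apply/closed_rootP; rewrite size_poly_eq ?phil // sf gtn_eqF.
have kills g' : P g' -> (map_poly phi g').[xi] = 0.
  move=> Pg'; have [e [q [r [E sr]]]] := pdiv g' (lead_neq0 _ lf).
  have Pr : P r.
    have -> : r = (lead_coef f ^+ e)%:P * g' - q * f by rewrite mul_polyC E addrC addKr.
    by apply: (psB pP); apply: (psM pP).
  have r0 : map_poly phi r = 0.
    apply/polyP => i; rewrite coef_map coef0; apply: phiP; apply: small => //.
    by rewrite -sf.
  have := congr1 (fun h => (map_poly phi h).[xi]) E.
  rewrite map_polyZ hornerZ rmorphD rmorphM /= r0 addr0 hornerM (rootP xif) mulr0.
  by move/eqP; rewrite rmorphXn mulf_eq0 expf_eq0 (negPf phil) andbF => /eqP.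
apply: (eval phi xi) => //; apply: contra_neq phic => b0.
have := kills _ Pw; rewrite rmorphB rmorphM /= hornerD hornerM b0 mulr0 add0r.
by rewrite map_polyC hornerN hornerC => /eqP; rewrite oppr_eq0 => /eqP.
Qed.
End NullstellensatzStep.

Lemma enough_points_base (k : closedFieldType) : enough_points (idfun : {rmorphism k -> k}).
Proof.
move=> P b pP Pb; exists idfun; split=> // [x Px|]; last first.
  by apply/eqP => /= b0; apply: Pb; rewrite b0; apply: (ps0 pP).
apply/eqP/negPn/negP => x0; apply: (ps1 pP).
by rewrite -(mulVf x0); apply: (psM pP).
Qed.

(** A polynomial ring in the given elements maps onto the subalgebra that they
    generate. It is built by iterating univariate polynomials, along which the
    Nullstellensatz propagates. *)
Lemma affine_cover (k : closedFieldType) (A : comAlgType k) (s : seq A) :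
  exists (R : comNzRingType) (j : {rmorphism k -> R}) (ev : {rmorphism R -> A}),
    [/\ enough_points j, forall a, ev (j a) = a%:A & forall x, x \in s -> exists p, ev p = x].
Proof.
elim: s => [|x s [R [j [ev [pts evj gens]]]]].
  exists k, idfun, (in_alg A); split=> //; exact: enough_points_base.
exists {poly R}, (polyC \o j), (horner_eval x \o map_poly ev); split.
- exact: enough_points_poly.
- by move=> a; rewrite /= /horner_eval map_polyC hornerC /= evj.
move=> y; rewrite inE => /orP [/eqP ->|/gens [p <-]].
  by exists 'X; rewrite /= /horner_eval map_polyX hornerX.
by exists p%:P; rewrite /= /horner_eval map_polyC hornerC.
Qed.

(** * Discriminants and dual bases in prime Cayley-Hamilton algebras *)

Section Prime.
Variables (k : closedFieldType) (A : algType k) (C : comAlgType k).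
Variables (iota : {lrmorphism C -> A}) (tr : A -> C) (n : nat).
Hypothesis char0 : [pchar k] =i pred0.
Hypothesis CH : cayley_hamilton iota tr n.

Definition disc j (a : 'I_j -> A) : C := \det (\matrix_(r < j, s < j) tr (a r * a s)).

(** The dual tuple of a with respect to the trace form, multiplied by the
    discriminant so as to be defined over C. *)
Definition dual j (a : 'I_j -> A) (i : 'I_j) : A :=
  \sum_m iota (\adj (\matrix_(r < j, s < j) tr (a r * a s)) m i) * a m.

(** The dual basis formula; it says that a is a basis of A over the localization
    of C at the discriminant, when this is nonzero. *)
Definition dual_expansion j (a : 'I_j -> A) :=
  forall h, iota (disc a) * h = \sum_i iota (tr (h * dual a i)) * a i.

Local Notation M := (restr iota A^o : lmodType C).
Let B (x y : M) : C := tr ((x : A) * (y : A)).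
Let Blin c x y z : B (c *: x + y) z = c * B x z + B y z.
Proof.
rewrite /B -[c *: x]/(iota c * (x : A)) mulrDl (trD CH).
by rewrite -mulrA (trZ CH).
Qed.
Let Bsym (K : comNzRingType) (f : {rmorphism C -> K}) x y : f (B x y) = f (B y x).
Proof. by rewrite /B (tr_mulC CH). Qed.

Let coordE j (a : 'I_j -> A) h i : gram_coord B a h i = tr (h * dual a i).
Proof.
rewrite /gram_coord /dual mulr_sumr (tr_sum CH); apply: eq_bigr => m _.
by rewrite mulrA -(iotaC CH) -mulrA (trZ CH) mulrC.
Qed.

Let projE j (a : 'I_j -> A) h : gram_proj B a h =
  iota (disc a) * h - \sum_i iota (tr (h * dual a i)) * a i.
Proof.
rewrite /gram_proj; congr (_ - _).
by apply: eq_bigr => i _; rewrite coordE.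
Qed.

Section Character.
Variables (K : comNzRingType) (chi : {rmorphism C -> K}).
Hypothesis Kdom : forall x y : K, x * y = 0 -> x = 0 \/ y = 0.
Hypothesis K2 : (2%:R : K) <> 0.

Lemma disc_maximal_radical j (a : 'I_j -> A) : chi (disc a) <> 0 ->
  (forall e : 'I_j.+1 -> A, chi (disc e) = 0) ->
  forall h y, chi (tr ((iota (disc a) * h - \sum_i iota (tr (h * dual a i)) * a i) * y)) = 0.
Proof.
move=> a0 amax h y; rewrite -projE.
exact: (gram_maximalP (A := M) (B := B) Kdom K2 Blin (Bsym chi) (conj a0 amax)).
Qed.

Lemma disc_rank_bound j (a : 'I_j -> A) d : chi d <> 0 ->
  (forall h, exists c : 'I_j -> C,
     forall y, chi (tr ((iota d * h - \sum_i iota (c i) * a i) * y)) = 0) ->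
  forall l (e : 'I_l -> A), (j < l)%N -> chi (disc e) = 0.
Proof. exact: (gram_rank_bound (A := M) (B := B) Kdom Blin). Qed.

Lemma disc_subtuple l (e : 'I_l -> A) j : chi (disc e) <> 0 -> (j <= l)%N ->
  exists a : 'I_j -> A, chi (disc a) <> 0.
Proof. exact: (gram_subtuple (A := M) (B := B) Kdom K2 Blin (Bsym chi)). Qed.

Lemma disc_maximal_exists s :
  (forall l (e : 'I_l -> A), (s < l)%N -> chi (disc e) = 0) ->
  exists j (a : 'I_j -> A), chi (disc a) <> 0 /\ forall e : 'I_j.+1 -> A, chi (disc e) = 0.
Proof.
move=> bd; have [j [a [a0 amax]]] := gram_maximal_exists (A := M) (B := B) (chi := chi) bd.
by exists j, a.
Qed.
End Character.

Lemma tr_dual j (a : 'I_j -> A) l i : tr (a l * dual a i) = (l == i)%:R * disc a.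
Proof.
rewrite /dual mulr_sumr (tr_sum CH); set G := (X in \adj X).
transitivity ((G *m \adj G) l i); last by rewrite mul_mx_adj !mxE mulr_natl.
rewrite mxE; apply: eq_bigr => m _.
by rewrite mulrA -(iotaC CH) -mulrA (trZ CH) mulrC [G l m]mxE.
Qed.

Hypothesis Aprime : prime_ring A.

Lemma base_domain (c d : C) : c * d = 0 -> c = 0 \/ d = 0.
Proof.
move=> cd0; have [_ /(_ (iota c) (iota d))] := Aprime.
case=> [x||]; last 2 first.
- by move=> h; left; apply: (iota_inj CH); rewrite rmorph0.
- by move=> h; right; apply: (iota_inj CH); rewrite rmorph0.
by rewrite -mulrA -(iotaC CH) mulrA -rmorphM cd0 rmorph0 mul0r.
Qed.

Lemma central_torsion (z x : A) : (forall y, z * y = y * z) -> z * x = 0 -> z <> 0 -> x = 0.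
Proof.
move=> zC zx z0; have [_ /(_ z x)] := Aprime.
by case=> // y; rewrite zC -mulrA zx mulr0.
Qed.

Lemma base_torsion c x : iota c * x = 0 -> c <> 0 -> x = 0.
Proof.
move=> cx c0; apply: (central_torsion (iotaC CH c) cx) => ic0; apply: c0.
by apply: (iota_inj CH); rewrite rmorph0.
Qed.

Lemma base_two : (2%:R : C) <> 0.
Proof.
move=> C2; have := mulrSn_eq0 char0 (x := 1 : C) (m := 1) C2.
by apply/eqP; apply: oner_neq0.
Qed.

(** If v is in the radical of the trace form, all elements of the right ideal v
    A have characteristic polynomial t ^ n, so v A is nil of bounded index, and
    nilpotent. In a prime ring this forces v = 0: otherwise nonzero products of
    any length of elements of v A exist. *)
Lemma trace_nondegenerate v : (forall y, tr (v * y) = 0) -> v = 0.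
Proof.
move=> tv; apply: contrapT => v0; have [M0 NH] := nagata_higman A n.
have [s [ss sR /eqP]] : exists s : seq A,
    [/\ size s = M0, forall x, x \in s -> exists y, x = v * y & (\prod_(x <- s) x) * v <> 0].
  elim: M0 {NH} => [|m [s [ss sR s0]]].
    by exists [::]; rewrite big_nil mul1r.
  have [_ /(_ v ((\prod_(x <- s) x) * v)) pr] := Aprime.
  have [y ny] : exists y, v * y * ((\prod_(x <- s) x) * v) <> 0.
    apply: contrapT => nex; case: pr => // x.
    by apply: contrapT => h; apply: nex; exists x.
  exists (v * y :: s); rewrite /= ss; split=> //; last by rewrite big_cons -[X in X <> 0]mulrA.
  by move=> x; rewrite inE => /orP [/eqP ->|/sR //]; exists y.
have -> : \prod_(x <- s) x = 0; last by rewrite mul0r eqxx.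
pose R := [set x | exists y, x = v * y].
apply: (NH R [set x | x = 0]) ss sR => [x y|x y|x y|x y|x m|x].
- by move=> [u ->] [w ->]; exists (u + w); rewrite mulrDr.
- by move=> [u ->] [w ->]; exists (u * (v * w)); rewrite mulrA.
- by move=> -> ->; rewrite /= subrr.
- by move=> _ ->; rewrite /= mulr0 mul0r.
- exact: mulrSn_eq0.
move=> [y ->]; rewrite /= (ch_eq_lead CH) big1 ?oppr0 // => j _.
rewrite (_ : ch_coef _ _ _ = 0) ?mulr0 ?rmorph0 ?mul0r //.
apply: (@ch_coef_morph0 _ _ _ tr _ idfun) => i.
by rewrite exprS -mulrA /= tv.
Qed.

Lemma dual_expansion_of_radical j (a : 'I_j -> A) : disc a <> 0 ->
  (forall e : 'I_j.+1 -> A, disc e = 0) -> dual_expansion a.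
Proof.
move=> a0 amax h; apply/eqP; rewrite -subr_eq0; apply/eqP.
apply: trace_nondegenerate => y.
exact: (disc_maximal_radical (chi := idfun) base_domain base_two a0 amax).
Qed.

(** The coordinates with respect to a are computed by taking traces against the
    dual tuple. *)
Lemma dual_expansion_of_span j (a : 'I_j -> A) s : disc a <> 0 -> s <> 0 ->
  (forall h, exists c : 'I_j -> C, iota s * h = \sum_i iota (c i) * a i) -> dual_expansion a.
Proof.
move=> a0 s0 span h; apply/eqP; rewrite -subr_eq0; apply/eqP; apply: (base_torsion _ s0).
have [c cE] := span h.
have gE i : iota s * iota (tr (h * dual a i)) = iota (disc a) * iota (c i).
  rewrite -!rmorphM; congr (iota _); rewrite -(trZ CH) mulrA cE mulr_suml (tr_sum CH).
  rewrite (bigD1 i) //= -mulrA (trZ CH) tr_dual eqxx mul1r mulrC big1 ?addr0 // => l.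
  by rewrite -mulrA (trZ CH) tr_dual => /negPf ->; rewrite mul0r mulr0.
rewrite mulrBr mulr_sumr mulrA -rmorphM mulrC rmorphM -mulrA cE mulr_sumr.
by apply/eqP; rewrite subr_eq0; apply/eqP/eq_bigr => i _; rewrite !mulrA gE.
Qed.

Lemma dual_expansion_sym j (a : 'I_j -> A) : dual_expansion a ->
  forall h, iota (disc a) * h = \sum_i iota (tr (h * a i)) * dual a i.
Proof.
move=> R h; rewrite R; set G := \matrix_(r < j, s < j) tr (a r * a s).
have GT : G^T = G by apply/matrixP => r s; rewrite !mxE (tr_mulC CH).
have adjC r s : \adj G r s = \adj G s r.
  by rewrite -[in RHS]GT -trmx_adj [RHS]mxE.
under [RHS]eq_bigr do rewrite /dual mulr_sumr.
rewrite exchange_big; apply: eq_bigr => m _ /=.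
rewrite /dual -/G mulr_sumr (tr_sum CH) rmorph_sum mulr_suml; apply: eq_bigr => i _.
by rewrite !mulrA -(iotaC CH) -mulrA (trZ CH) rmorphM adjC -!rmorphM mulrC.
Qed.
End Prime.

Section Generic.
Variables (k : closedFieldType) (A : algType k) (C : comAlgType k).
Variables (iota : {lrmorphism C -> A}) (tr : A -> C) (n : nat).
Hypothesis char0 : [pchar k] =i pred0.
Hypothesis CH : cayley_hamilton iota tr n.
Hypothesis Aprime : prime_ring A.
Hypothesis Aaff : affine A.

(** A generating tuple of the C-module A bounds the size of the tuples with
    nonzero discriminant; the empty tuple is not maximal, as it does not expand
    1. *)
Lemma disc_maximum : exists N (a : 'I_N -> A), [/\ (0 < N)%N, disc tr a <> 0 &
  forall l (e : 'I_l -> A), (N < l)%N -> disc tr e = 0].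
Proof.
have [s [g gP]] : exists s (g : 'I_s -> A), forall x, exists c, x = \sum_i iota (c i) * g i.
  by have [h hP] := Aaff; apply: (finite_module char0 CH hP).
have bd l (e : 'I_l -> A) : (s < l)%N -> idfun (disc tr e) = 0.
  apply: (disc_rank_bound CH (base_domain CH Aprime) (a := g) (d := 1)).
    by apply/eqP; apply: oner_neq0.
  move=> h; have [c ->] := gP h; exists c => y.
  by rewrite rmorph1 mul1r subrr mul0r /= (tr0 CH).
have [N [a [a0 amax]]] := disc_maximal_exists (chi := idfun) iota bd.
exists N, a; split=> // [|l e ltNl]; last first.
  apply: contrapT => e0.
  have [b b0] := disc_subtuple CH (chi := idfun) (base_domain CH Aprime) (base_two char0) e0 ltNl.
  by apply: b0; apply: amax.
rewrite lt0n; apply/negP => /eqP N0; move: a a0 amax; rewrite N0 => a a0 amax.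
have := dual_expansion_of_radical char0 CH Aprime a0 amax 1.
rewrite big_ord0 mulr1 /disc det_mx00 rmorph1 => /eqP.
by rewrite oner_eq0.
Qed.

(** The base C need not be generated by the coordinates at hand, but it is so
    after inverting a nonzero discriminant d. Let S be the finitely generated
    subalgebra of C generated by d, by the coordinates of the generators of A,
    and by the structure constants of A with respect to the dual basis. Every
    element of A has coordinates in S up to a power of d, since this property is
    stable under products. In particular every element of C is in S up to a
    power of d, so that a point of S at which d is nonzero extends uniquely to
    C. *)
Lemma characters_separate b : b <> 0 -> exists chi : {rmorphism C -> k},
  (forall a, chi a%:A = a) /\ chi b <> 0.
Proof.
move=> b0; have [N [a [N0 a0 aN]]] := disc_maximum.
have R : dual_expansion iota tr a by apply: (dual_expansion_of_radical char0 CH Aprime a0) => e; apply: aN.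
set d := disc tr a in a0 R.
have [h hP] := Aaff.
pose kp i x := tr (x * dual iota tr a i).
have kpE x : iota d * x = \sum_i iota (kp i x) * a i by apply: R.
have kpZ i c x : kp i (iota c * x) = c * kp i x by rewrite /kp -mulrA (trZ CH).
have kpD i x y : kp i (x + y) = kp i x + kp i y by rewrite /kp mulrDl (trD CH).
have kpS i (I : Type) (r : seq I) (F : I -> A) :
    kp i (\sum_(j <- r) F j) = \sum_(j <- r) kp i (F j).
  by apply: (big_morph (kp i)) => //; rewrite /kp mul0r (tr0 CH).
pose L := d :: [seq kp i x | i <- enum 'I_N, x <- h] ++
  [seq kp i 1 | i <- enum 'I_N] ++
  [seq kp i (a l.1 * a l.2) | i <- enum 'I_N, l <- enum {: 'I_N * 'I_N}].
have [P [j [ev [pts evj gens]]]] := affine_cover L.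
pose S c := exists p, ev p = c.
have Sd : S d by apply: gens; rewrite inE eqxx.
have SD c c' : S c -> S c' -> S (c + c').
  by move=> [p <-] [q <-]; exists (p + q); rewrite rmorphD.
have SM c c' : S c -> S c' -> S (c * c').
  by move=> [p <-] [q <-]; exists (p * q); rewrite rmorphM.
have SX m : S (d ^+ m) by have [p <-] := Sd; exists (p ^+ m); rewrite rmorphXn.
have Ssum (I : Type) (r : seq I) (F : I -> C) : (forall i, S (F i)) -> S (\sum_(i <- r) F i).
  by move=> SF; elim/big_ind: _ => //; exists 0; rewrite rmorph0.
pose W x := exists e, forall i, S (d ^+ e * kp i x).
have Wall x : W x.
  have /(_ (fun x => `[< W x >])) := hP; move=> /(_ _ _ x) => HB.
  apply/asboolP; apply: HB => {x}; last first.
    move=> x xh; apply/asboolP; exists 0%N => i; rewrite mul1r; apply: gens.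
    by rewrite inE mem_cat; apply/orP; right; apply/orP; left; apply/allpairsP;
      exists (i, x); rewrite mem_enum.
  split.
  - apply/asboolP; exists 0%N => i; rewrite mul1r; apply: gens.
    rewrite inE !mem_cat; apply/orP; right; apply/orP; right; apply/orP; left.
    by apply/mapP; exists i; rewrite ?mem_enum.
  - move=> c x y /asboolP [e We] /asboolP [f Wf]; apply/asboolP; exists (e + f)%N => i.
    rewrite kpD -mulr_algl -(iota_alg iota) kpZ mulrDr exprD; apply: (SD).
      rewrite -mulrA mulrCA; apply: (SM) => //.
      rewrite mulrCA; apply: (SM) => //; by exists (j c); rewrite evj.
    by rewrite -mulrA; apply: (SM).
  move=> x y /asboolP [e We] /asboolP [f Wf]; apply/asboolP; exists (e + f + 2)%N => i.
  have -> : d ^+ (e + f + 2) * kp i (x * y) = d ^+ (e + f) * kp i (iota d * x * (iota d * y)).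
    rewrite -(mulrA (iota d)) kpZ (mulrA x) -(iotaC CH) -(mulrA (iota d)) kpZ.
    by rewrite !exprD expr2; ring.
  rewrite !kpE mulr_suml kpS mulr_sumr; apply: (Ssum) => l.
  rewrite mulr_sumr kpS mulr_sumr; apply: (Ssum) => m.
  rewrite mulrA -(mulrA _ (a l)) -(iotaC CH) -!mulrA kpZ kpZ exprD.
  have -> : d ^+ e * d ^+ f * (kp l x * (kp m y * kp i (a l * a m))) =
    (d ^+ e * kp l x) * ((d ^+ f * kp m y) * kp i (a l * a m)) by ring.
  apply: (SM) => //; apply: (SM) => //; apply: gens.
  rewrite inE !mem_cat; apply/orP; right; apply/orP; right; apply/orP; right.
  by apply/allpairsP; exists (i, (l, m)); rewrite !mem_enum.
(* An element c of C is read off as the coordinate, up to d, of c a_0 at the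
   index 0. *)
have /choice [f fP] : forall c, exists ep : nat * P, ev ep.2 = d ^+ ep.1 * c.
  move=> c; pose i0 := Ordinal N0; have [e We] := Wall (iota c * a i0).
  have [p pE] := We i0; exists (e.+1, p).
  by rewrite /= pE kpZ /kp (tr_dual CH) eqxx mul1r exprSr -/d mulrCA mulrC.
have [delta deltaE] := Sd.
have C1 : (1 : C) <> 0 by apply/eqP; apply: oner_neq0.
have pK : prime_set [set p | ev p = 0].
  split=> [|x y /= x0 y0|x y /= y0||x y] /=; rewrite ?rmorph0 ?rmorph1 //.
  - by rewrite rmorphD x0 y0 addr0.
  - by rewrite rmorphM y0 mulr0.
  - by rewrite rmorphM => /(base_domain CH Aprime).
have dX m : d ^+ m <> 0.
  elim: m => [|m IHm]; first by rewrite expr0.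
  by rewrite exprS => /(base_domain CH Aprime) [].
have bn : ~ ev ((f b).2 * delta) = 0.
  rewrite rmorphM fP deltaE => /(base_domain CH Aprime) [] //.
  by case/(base_domain CH Aprime) => //; apply: dX.
have [phi [phiK phin phij]] := pts _ _ pK bn.
move: phin; rewrite rmorphM mulf_eq0 negb_or => /andP [phib phid].
have phiE p q : ev p = ev q -> phi p = phi q.
  move=> pq; apply/eqP; rewrite -subr_eq0 -rmorphB; apply/eqP; apply: phiK.
  by rewrite /= rmorphB pq subrr.
pose chi c := phi (f c).2 / phi delta ^+ (f c).1.
have dn m : phi delta ^+ m != 0 by rewrite expf_neq0.
have chiE c e q : ev q = d ^+ e * c -> chi c = phi q / phi delta ^+ e.
  move=> qE; apply/eqP; rewrite /chi eqr_div // -!rmorphXn -!rmorphM; apply/eqP/phiE.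
  by rewrite !rmorphM !rmorphXn deltaE fP qE; ring.
have chiB : zmod_morphism chi.
  move=> x y; rewrite (chiE (x - y) ((f x).1 + (f y).1)%N
    ((f x).2 * delta ^+ (f y).1 - (f y).2 * delta ^+ (f x).1)).
    by rewrite rmorphB !rmorphM !rmorphXn exprD /chi; field; rewrite !dn.
  by rewrite rmorphB !rmorphM !rmorphXn deltaE !fP exprD; ring.
have chiM : monoid_morphism chi.
  split=> [|x y]; first by rewrite (chiE 1 0%N 1) ?rmorph1 ?mulr1 // divr1.
  rewrite (chiE (x * y) ((f x).1 + (f y).1)%N ((f x).2 * (f y).2)).
    by rewrite rmorphM exprD /chi; field; rewrite !dn.
  by rewrite rmorphM !fP exprD; ring.
pose chi' : {rmorphism C -> k} := HB.pack chi
  (GRing.isZmodMorphism.Build _ _ chi chiB) (GRing.isMonoidMorphism.Build _ _ chi chiM).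
exists chi'; split=> [c|].
  by rewrite /= (chiE _ 0%N (j c)) ?evj ?mul1r // phij divr1.
by apply/eqP; rewrite /= /chi mulf_neq0 ?invr_eq0.
Qed.

(** At a character that does not kill d, the coordinates of x, which are traces
    of multiples of x, vanish. *)
Lemma radical_fiber N (a : 'I_N -> A) (chi : {rmorphism C -> k}) :
  (forall c, chi c%:A = c) -> dual_expansion iota tr a -> chi (disc tr a) <> 0 ->
  forall x, radical (chi \o tr) x -> ideal_gen (iota @` chi_ker chi) x.
Proof.
move=> chi_alg R d0 x Tx; set d := disc tr a in d0.
have -> : x = ((chi d)^-1)%:A * (iota d * x - (iota d * x - chi d *: x)).
  by rewrite subKr mulr_algl scalerA mulVf ?scale1r //; apply/eqP.
apply: igenMl; apply: igenB; last exact: fiber_chi.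
rewrite R; apply: igen_sum => i _; apply: igenMr; apply: fiber_ker.
exact: Tx.
Qed.
End Generic.

(** * Commutativity from a discriminant that is nonzero at the augmentation *)

Lemma det_cramer (R : comNzRingType) (V : lmodType R) s (M : 'M[R]_s) (g y : 'I_s -> V) :
  (forall p, \sum_q M p q *: g q = y p) ->
  forall p, \det M *: g p = \sum_q \adj M p q *: y q.
Proof.
move=> My p; under eq_bigr do rewrite -My scaler_sumr.
rewrite exchange_big /= (bigD1 p) //= [X in _ + X]big1 ?addr0 => [|q ne].
  under eq_bigr do rewrite scalerA.
  rewrite -scaler_suml; congr (_ *: _).
  by have := congr1 (fun N : 'M_s => N p p) (mul_adj_mx M); rewrite !mxE eqxx mulr1n.
under eq_bigr do rewrite scalerA.
rewrite -scaler_suml.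
have := congr1 (fun N : 'M_s => N p q) (mul_adj_mx M); rewrite !mxE eq_sym (negPf ne).
by move=> ->; rewrite mulr0n scale0r.
Qed.

Section FiberOverCharacter.
Variables (k : closedFieldType) (A : algType k) (C : comAlgType k).
Variables (iota : {lrmorphism C -> A}) (tr : A -> C) (n : nat).
Hypothesis char0 : [pchar k] =i pred0.
Hypothesis CH : cayley_hamilton iota tr n.
Hypothesis Aprime : prime_ring A.
Hypothesis Aaff : affine A.
Variable chi : {rmorphism C -> k}.
Local Notation mA := (ideal_gen (iota @` chi_ker chi)).
Local Notation tau := (chi \o tr).

Lemma fiber_span s (g : 'I_s -> A) :
  (forall x, exists c, x = \sum_q iota (c q) * g q) ->
  forall x, mA x -> exists c, (forall q, chi (c q) = 0) /\ x = \sum_q iota (c q) * g q.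
Proof.
move=> gP x mx.
apply: (mx [set x | exists c, (forall q, chi (c q) = 0) /\ x = \sum_q iota (c q) * g q])
  => [|_ [c c0 <-]].
  split=> [|y z [c [c0 ->]] [d [d0 ->]]|a y [c [c0 ->]]].
  - exists (fun _ => 0); split=> [q|]; first by rewrite rmorph0.
    by rewrite big1 // => q _; rewrite rmorph0 mul0r.
  - exists (fun q => c q + d q); split=> [q|]; first by rewrite rmorphD c0 d0 addr0.
    by rewrite -big_split; apply: eq_bigr => q _; rewrite rmorphD mulrDl.
  have sum_in (z : 'I_s -> A) : exists e, (forall q, chi (e q) = 0) /\
      \sum_q iota (c q) * z q = \sum_q iota (e q) * g q.
    have [e eP] := choice (fun q => gP (z q)).
    exists (fun l => \sum_q c q * e q l); split=> [l|].
      by rewrite rmorph_sum big1 // => q _; rewrite rmorphM c0 mul0r.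
    under eq_bigr do rewrite eP mulr_sumr.
    rewrite exchange_big; apply: eq_bigr => l _; rewrite rmorph_sum mulr_suml.
    by apply: eq_bigr => q _; rewrite rmorphM mulrA.
  split.
    have [e [e0 eE]] := sum_in (fun q => a * g q); exists e; split=> //.
    rewrite -eE mulr_sumr; apply: eq_bigr => q _.
    by rewrite mulrA -(iotaC CH) mulrA.
  have [e [e0 eE]] := sum_in (fun q => g q * a); exists e; split=> //.
  by rewrite -eE mulr_suml; apply: eq_bigr => q _; rewrite mulrA.
have [e eE] := gP 1; exists (fun q => c * e q); split=> [q|].
  by rewrite rmorphM c0 mul0r.
rewrite -[LHS]mulr1 eE mulr_sumr; apply: eq_bigr => q _.
by rewrite rmorphM mulrA.
Qed.

Let K2 : (2%:R : k) <> 0. Proof. by apply/eqP; apply: natr_neq0. Qed.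

(** A maximal tuple at chi spans the fiber modulo its radical, hence spans the
    fiber, when the radical vanishes there. By Nakayama's lemma in its
    determinant form, it spans A up to the determinant of a matrix that is
    congruent to a nonzero scalar. *)
Lemma dual_expansion_at_character : (forall x, radical tau x -> mA x) ->
  exists N (a : 'I_N -> A), dual_expansion iota tr a /\ chi (disc tr a) <> 0.
Proof.
move=> Tm; have [N0 [_ [_ _ bd]]] := disc_maximum char0 CH Aprime Aaff.
have [N [a [a0 amax]]] : exists j (a : 'I_j -> A),
    chi (disc tr a) <> 0 /\ forall e : 'I_j.+1 -> A, chi (disc tr e) = 0.
  by apply: (disc_maximal_exists iota (s := N0)) => l e /bd ->; rewrite rmorph0.
set d := disc tr a in a0.
exists N, a; split=> //.
have [s [g gP]] : exists s (g : 'I_s -> A),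
    forall w, exists c : 'I_s -> C, w = \sum_i iota (c i) * g i.
  by have [h hP] := Aaff; apply: (finite_module char0 CH hP).
pose c p i : C := tr (g p * dual iota tr a i).
have /choice [mu muP] : forall p, exists mu : 'I_s -> C, (forall q, chi (mu q) = 0) /\
    iota d * g p - \sum_i iota (c p i) * a i = \sum_q iota (mu q) * g q.
  move=> p; apply: (fiber_span gP); apply: Tm => y.
  exact: (disc_maximal_radical (chi := chi) CH (@field_domain k) K2 a0 amax).
pose V : lmodType C := restr iota A^o.
have sV (e : C) (v : A) : e *: (v : V) = iota e * v :> A by [].
(* The generators g satisfy M g = combinations of a, and the entries of mu
   vanish at chi. *)
pose M : 'M[C]_s := d%:M - \matrix_(p, q) mu p q.
have My p : \sum_q M p q *: (g q : V) = \sum_i c p i *: (a i : V).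
  transitivity (iota d * g p - \sum_q iota (mu p q) * g q : A); last first.
    by rewrite -(muP p).2 subKr.
  rewrite (eq_bigr (fun q => (d *+ (p == q)) *: (g q : V) - (mu p q) *: (g q : V))).
    rewrite sumrB; congr (_ - _); rewrite (bigD1 p) //= eqxx mulr1n big1 ?addr0 // => q ne.
    by rewrite eq_sym (negPf ne) mulr0n scale0r.
  by move=> q _; rewrite !mxE scalerBl.
have sE p : iota (\det M) * g p = \sum_i iota (\sum_q \adj M p q * c q i) * a i.
  rewrite -sV (det_cramer My); under eq_bigr do rewrite scaler_sumr.
  rewrite exchange_big; apply: eq_bigr => i _ /=.
  rewrite rmorph_sum mulr_suml; apply: eq_bigr => q _.
  by rewrite scalerA sV.
have s0 : chi (\det M) <> 0.
  rewrite -det_map_mx (_ : map_mx _ M = (chi d)%:M).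
    by apply/eqP; rewrite det_scalar expf_neq0 //; apply/eqP.
  apply/matrixP => p q; rewrite !mxE rmorphB rmorphMn.
  by rewrite (muP p).1 subr0.
have nz e : chi e <> 0 -> e <> 0 by move=> e0 eE; apply: e0; rewrite eE rmorph0.
apply: (dual_expansion_of_span CH Aprime (nz _ a0) (nz _ s0)) => h.
have [e eE] := gP h.
exists (fun i => \sum_p e p * \sum_q \adj M p q * c q i).
rewrite eE mulr_sumr; transitivity (\sum_p iota (e p) * (iota (\det M) * g p)).
  by apply: eq_bigr => p _; rewrite mulrA -rmorphM mulrC rmorphM mulrA.
under eq_bigr do rewrite sE mulr_sumr.
rewrite exchange_big; apply: eq_bigr => i _ /=.
rewrite rmorph_sum mulr_suml; apply: eq_bigr => p _.
by rewrite rmorphM mulrA.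
Qed.
End FiberOverCharacter.

Section Augmented.
Variables (k : closedFieldType) (A : algType k) (C : comAlgType k).
Variables (iota : {lrmorphism C -> A}) (tr : A -> C) (n : nat).
Hypothesis char0 : [pchar k] =i pred0.
Hypothesis CH : cayley_hamilton iota tr n.
Hypothesis Aprime : prime_ring A.
Hypothesis Aaff : affine A.
Variable eps : {rmorphism A -> k}.
Hypothesis eps_alg : forall a, eps a%:A = a.

Local Notation chi := (eps \o iota : {rmorphism C -> k}).
Local Notation mA := (ideal_gen (iota @` chi_ker chi)).
Local Notation tau := (chi \o tr).

Let chi_alg a : chi a%:A = a. Proof. by rewrite /= iota_alg eps_alg. Qed.
Let epsZ a x : eps (a *: x) = a * eps x.
Proof. by rewrite -mulr_algl rmorphM eps_alg. Qed.
Let tf := character_trace_form char0 CH chi_alg.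

Section CentralIntegral.
Variables (N : nat) (a : 'I_N -> A).
Hypothesis R : dual_expansion iota tr a.
Hypothesis d0 : chi (disc tr a) <> 0.

Let d := disc tr a.
Let b := dual iota tr a.

(** The element that represents the linear form eps, up to the scalar chi d,
    with respect to the trace form; it is an integral of the fiber at eps. *)
Let u := \sum_i eps (a i) *: b i.

Let u_tau x : tau (x * u) = chi d * eps x.
Proof.
have E := congr1 eps (R x); rewrite rmorphM in E.
rewrite -[RHS]/(eps (iota (disc tr a)) * eps x) E mulr_sumr (tf_sum tf) rmorph_sum; apply: eq_bigr => i _.
by rewrite -scalerAr (tfZ tf) rmorphM [LHS]mulrC.
Qed.

Let radf x : radical tau x -> mA x.
Proof. exact: (radical_fiber chi_alg R d0). Qed.

(** Both sides represent the same linear form with respect to tau, which is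
    nondegenerate on the fiber. *)
Let u_l x : mA (x * u - eps x *: u).
Proof.
apply: radf => h; rewrite mulrBl (tfB tf) -scalerAl (tfZ tf).
by rewrite (tfC tf (x * u)) (tfC tf u) mulrA !u_tau rmorphM; ring.
Qed.
Let u_r x : mA (u * x - eps x *: u).
Proof.
apply: radf => h; rewrite mulrBl (tfB tf) -scalerAl (tfZ tf) -mulrA.
by rewrite !(tfC tf u) !u_tau rmorphM; ring.
Qed.

(** If eps u were 0, the square of u would be 0 in the fiber, and tau u = chi d
    would vanish. *)
Let eps_u : eps u != 0.
Proof.
apply/negP => /eqP u0.
have Tuu : radical tau (u ^+ 2).
  have := u_l u; rewrite u0 scale0r subr0 -expr2.
  exact: (fiber_radical CH).
have /eqP := tau_nilpotent char0 CH chi_alg Tuu.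
by rewrite -[u]mul1r u_tau rmorph1 mulr1 => /eqP.
Qed.

(** A Casimir element: it is central by the two forms of the dual basis formula. *)
Let z := \sum_i a i * u * b i.

Let zC x : z * x = x * z.
Proof.
apply/eqP; rewrite -subr_eq0; apply/eqP; apply: (base_torsion CH Aprime (c := d)); last first.
  by move=> dn; apply: d0; rewrite -/d dn rmorph0.
rewrite mulrBr; apply/eqP; rewrite subr_eq0; apply/eqP.
transitivity (\sum_l \sum_i a l * u * (iota (tr (b l * x * a i)) * b i)).
  rewrite /z mulr_suml mulr_sumr; apply: eq_bigr => l _; rewrite -mulr_sumr.
  rewrite -(dual_expansion_sym CH R) -/d.
  by rewrite [RHS]mulrA -(iotaC CH) !mulrA.
rewrite exchange_big /z !mulr_sumr; apply: eq_bigr => i _ /=.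
have -> : iota d * (x * (a i * u * b i)) = iota d * (x * a i) * u * b i by rewrite !mulrA.
rewrite R !mulr_suml; apply: eq_bigr => l _.
have -> : tr (b l * x * a i) = tr (x * a i * b l) by rewrite -mulrA (tr_mulC CH).
by rewrite mulrA -(iotaC CH) !mulrA.
Qed.

Let z_u : mA (z - eps u *: u).
Proof.
have -> : z - eps u *: u = \sum_i (a i * u * b i - (eps (a i) * eps (b i)) *: u).
  rewrite sumrB; congr (_ - _); rewrite -scaler_suml; congr (_ *: _).
  by rewrite /u rmorph_sum; apply: eq_bigr => i _; rewrite epsZ.
apply: igen_sum => i _.
have -> : a i * u * b i - (eps (a i) * eps (b i)) *: u =
    (a i * u - eps (a i) *: u) * b i + (eps (a i))%:A * (u * b i - eps (b i) *: u).
  by rewrite mulrBl mulr_algl scalerBr scalerA -scalerAl addrA subrK.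
by apply: igenD; [apply: igenMr | apply: igenMl].
Qed.

(** Modulo the fiber ideal z is proportional to the integral u, which
    annihilates the augmentation ideal. *)
Let z_absorb x : mA (z * (x - (eps x)%:A)).
Proof.
have -> : z * (x - (eps x)%:A) = (z - eps u *: u) * (x - (eps x)%:A) +
    (eps u)%:A * (u * x - eps x *: u).
  have -> : u * x - eps x *: u = u * (x - (eps x)%:A) by rewrite mulrBr -scalerAr mulr1.
  by rewrite mulrBl mulr_algl scalerAl subrK.
by apply: igenD; [apply: igenMr | apply: igenMl].
Qed.

Let eps_z : eps z != 0.
Proof.
have -> : eps z = eps u * eps u.
  have {2}-> : eps u = \sum_i eps (a i) * eps (b i).
    by rewrite /u rmorph_sum; apply: eq_bigr => i _; rewrite epsZ.
  rewrite /z rmorph_sum mulr_sumr; apply: eq_bigr => i _.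
  by rewrite !rmorphM; ring.
by rewrite mulf_neq0.
Qed.

Let comm_z : commr_rmorph iota z. Proof. by move=> c; rewrite /GRing.comm zC. Qed.
Let ev : {rmorphism {poly C} -> A} := horner_morph comm_z.

Let ev_central p y : ev p * y = y * ev p.
Proof.
elim/poly_ind: p => [|p c IH]; first by rewrite rmorph0 mul0r mulr0.
rewrite rmorphD rmorphM /= horner_morphX horner_morphC mulrDl mulrDr (iotaC CH).
by rewrite -mulrA zC mulrA IH mulrA.
Qed.

(** The augmentation ideal is generated over C by the elements g' p = g p - eps
    (g p), and z maps it to its multiples by the kernel of chi. Let M be the
    characteristic matrix X - mu of the action of z, with coefficients in
    polynomials over C that act on A through X |-> z. Its adjugate expresses det
    M times g' p by elements of C and z, so this product is central. At eps, det
    M is a power of eps z, which is nonzero; so det M is not a zero divisor, and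
    g' p is central. *)
Lemma commutative_of_central_integral (x y : A) : x * y = y * x.
Proof.
have [s [g gP]] : exists s (g : 'I_s -> A),
    forall w, exists c : 'I_s -> C, w = \sum_i iota (c i) * g i.
  by have [h hP] := Aaff; apply: (finite_module char0 CH hP).
have /choice [mu muP] : forall p, exists c : 'I_s -> C, (forall q, chi (c q) = 0) /\
    z * (g p - (eps (g p))%:A) = \sum_q iota (c q) * g q.
  by move=> p; apply: (fiber_span CH gP); apply: z_absorb.
pose V : lmodType {poly C} := restr ev A^o.
have sV (p : {poly C}) (v : A) : p *: (v : V) = ev p * v :> A by [].
pose g' p : A := g p - (eps (g p))%:A.
pose M := char_poly_mx (\matrix_(p, q) mu p q).
pose c p : C := \sum_q mu p q * (eps (g q))%:A.
have My p : \sum_q M p q *: (g' q : V) = (c p)%:P *: ((1 : A) : V).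
  transitivity (z * g' p - \sum_q iota (mu p q) * g' q : A).
    rewrite /M /char_poly_mx.
    rewrite (eq_bigr (fun q => ('X *+ (p == q)) *: (g' q : V) - (mu p q)%:P *: (g' q : V))); last first.
      by move=> q _; rewrite !mxE scalerBl.
    rewrite sumrB; congr (_ - _).
      rewrite (bigD1 p) //= eqxx mulr1n big1 ?addr0 => [|q ne].
        by rewrite sV /ev /= horner_morphX.
      by rewrite eq_sym (negPf ne) mulr0n scale0r.
    by apply: eq_bigr => q _; rewrite sV /ev /= horner_morphC.
  rewrite sV /ev /= horner_morphC mulr1 (muP p).2 -sumrB.
  rewrite /c rmorph_sum; apply: eq_bigr => q _.
  by rewrite -mulrBr subKr rmorphM; congr (_ * _); rewrite [RHS](iota_alg iota).
have sE p : ev (\det M) * g' p = ev (\sum_q \adj M p q * (c q)%:P).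
  rewrite -sV (det_cramer My).
  rewrite rmorph_sum; apply: eq_bigr => q _.
  by rewrite scalerA sV mulr1.
have s0 : ev (\det M) <> 0.
  have : eps (ev (\det M)) != 0.
    rewrite -[eps _]/((eps \o ev) (\det M)) -det_map_mx.
    rewrite (_ : map_mx _ M = (eps z)%:M) ?det_scalar ?expf_neq0 //.
    apply/matrixP => p q; rewrite !mxE rmorphB rmorphMn /= /ev /= horner_morphX horner_morphC.
    by have /= -> := (muP p).1 q; rewrite subr0.
  by apply: contra_neq_not => ->; rewrite rmorph0.
have slide (c0 v w : A) : (forall y, c0 * y = y * c0) -> c0 * v * w = w * (c0 * v) ->
    c0 * (v * w - w * v) = 0.
  by move=> cC e; rewrite mulrBr (mulrA c0 v) e (mulrA w) -cC mulrA subrr.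
have gC p w : g p * w = w * g p.
  have g'C : g' p * w = w * g' p.
    apply/eqP; rewrite -subr_eq0; apply/eqP.
    apply: (central_torsion Aprime (ev_central (\det M))) s0.
    apply: slide; first exact: ev_central.
    by rewrite sE ev_central.
  move: g'C; rewrite /g' mulrBl mulrBr -scalerAl mul1r -scalerAr mulr1.
  exact: addIr.
have [c1 ->] := gP x; rewrite mulr_suml mulr_sumr; apply: eq_bigr => i _.
by rewrite -mulrA gC mulrA (iotaC CH) -mulrA.
Qed.
End CentralIntegral.
End Augmented.

(** * Matrix representations and irreducible modules *)

Section LinearMaps.
Variable R : pzRingType.

Definition linear_pack (V W : lmodType R) (f : V -> W) (fl : linear f) : {linear V -> W} :=
  HB.pack f (GRing.isLinear.Build R V W *:%R f fl).

Lemma bijective_of_inj_surj (V W : Type) (f : V -> W) :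
  injective f -> (forall w, exists v, f v = w) -> bijective f.
Proof.
move=> finj /choice [g gK]; exists g => // v.
by apply: finj; rewrite gK.
Qed.

Lemma module_iso_sym (V W : lmodType R) : module_iso V W -> module_iso W V.
Proof.
move=> [f [g fK gK]].
have gl : linear g by move=> a u v; apply: (can_inj fK); rewrite linearP !gK.
by exists (linear_pack gl); exists f.
Qed.

Lemma module_iso_trans (V W X : lmodType R) :
  module_iso V W -> module_iso W X -> module_iso V X.
Proof. by move=> [f fb] [g gb]; exists (g \o f); apply: bij_comp. Qed.

Lemma schur (V W : lmodType R) (f : {linear V -> W}) v0 :
  irreducible V -> irreducible W -> f v0 != 0 -> bijective f.
Proof.
move=> [_ Virr] [_ Wirr] fv0; apply: bijective_of_inj_surj.
  have [||H] := Virr (fun v => f v == 0).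
  - split; first by rewrite unfold_in linear0.
    by move=> a u v; rewrite !unfold_in linearP => /eqP -> /eqP ->; rewrite scaler0 addr0.
  - move=> ker0 u v uv; apply/eqP; rewrite -subr_eq0; apply/eqP/ker0.
    by rewrite unfold_in linearB uv subrr.
  by move: (H v0); rewrite unfold_in (negPf fv0).
move=> w; have [||H] := Wirr (fun w => `[< exists v, f v = w >]).
- split; first by apply/asboolP; exists 0; rewrite linear0.
  move=> a u v /asboolP [u' <-] /asboolP [v' <-]; apply/asboolP.
  by exists (a *: u' + v'); rewrite linearP.
- by move=> H; move: fv0; rewrite (H (f v0)) ?eqxx //; apply/asboolP; exists v0.
by have /asboolP := H w.
Qed.
End LinearMaps.

Lemma completely_reducible_of_no_submodule (R : pzRingType) (M : lmodType R) :
  (forall N : {pred M}, GRing.submod_closed N ->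
     (forall x, x \in N -> x = 0) \/ (forall x, x \in N)) ->
  completely_reducible M.
Proof.
move=> irr N N_sub; have N0 := N_sub.1; have [N_0|NT] := irr N N_sub.
  exists (fun=> true); split=> [|x Nx _|x]; [by split|exact: N_0|].
  by exists 0, x; rewrite add0r.
exists (fun y => y == 0); split=> [|x _ /eqP //|x].
  split=> [|b u v]; first exact/eqP.
  by move=> /eqP -> /eqP ->; apply/eqP; rewrite scaler0 addr0.
by exists x, 0; split; rewrite ?addr0 //; apply/eqP.
Qed.

(** The vectors annihilated by T form a submodule L. A vector of a complement of
    L that is annihilated by all products of p + 1 elements of T is sent by T to
    vectors that are annihilated by all products of p elements, hence to 0 by
    induction; so it is in L too, and vanishes. *)
Lemma reducible_nilpotent (R : pzRingType) (M : lmodType R) (T : set R) :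
  completely_reducible M -> (forall a x, T x -> T (x * a)) ->
  (exists q, forall s : seq R, size s = q -> (forall r, r \in s -> T r) ->
     forall x : M, (\prod_(r <- s) r) *: x = 0) ->
  forall t (x : M), T t -> t *: x = 0.
Proof.
move=> red TM [q nil] t x Tt.
pose L : {pred M} := fun y => `[< forall t, T t -> t *: y = 0 >].
have LP y : y \in L <-> forall t, T t -> t *: y = 0 by split=> /asboolP.
have [|K [[K0 KL] LK dec]] := red L.
  split; first by apply/LP => r _; rewrite scaler0.
  move=> a u v /LP Lu /LP Lv; apply/LP => r Tr.
  by rewrite scalerDr scalerA Lu ?Lv ?addr0 //; apply: TM.
have KZ a y : y \in K -> a *: y \in K by move=> Ky; rewrite -[_ *: _]addr0; apply: KL.
have H p y : y \in K -> (forall s : seq R, size s = p -> (forall r, r \in s -> T r) ->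
    (\prod_(r <- s) r) *: (y : M) = 0) -> y = 0.
  elim: p y => [|p IH] y Ky Hy.
    by have := Hy [::] erefl; rewrite big_nil scale1r; apply.
  apply: LK => //; apply/LP => r Tr; apply: IH; first exact: KZ.
  move=> s ss sT; have := Hy (s ++ [:: r]); rewrite big_cat big_seq1 -scalerA; apply.
    by rewrite size_cat ss addn1.
  by move=> r'; rewrite mem_cat inE => /orP [/sT //|/eqP ->].
have [y [z [/LP Ly Kz ->]]] := dec x.
rewrite scalerDr (Ly _ Tt) add0r (H q z Kz) ?scaler0 // => s ss sT.
exact: nil.
Qed.

Section MatrixModule.
Variables (k : fieldType) (R : pzRingType) (m : nat) (rho : {rmorphism R -> 'M[k]_m}).

(** Column vectors on which R acts through rho; rho is a parameter of the type
    so that the module structure can be inferred. *)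
Definition mx_module (_ : {rmorphism R -> 'M[k]_m}) : Type := 'cV[k]_m.
Local Notation V := (mx_module rho).
HB.instance Definition _ := GRing.Zmodule.on V.

Let scale (r : R) (v : V) : V := rho r *m (v : 'cV[k]_m).
Fact mx_module_scaleA a b v : scale a (scale b v) = scale (a * b) v.
Proof. by rewrite /scale mulmxA rmorphM. Qed.
Fact mx_module_scale1 : left_id 1 scale.
Proof. by move=> v; rewrite /scale rmorph1 mul1mx. Qed.
Fact mx_module_scaleDr : right_distributive scale +%R.
Proof. by move=> a u v; rewrite /scale mulmxDr. Qed.
Fact mx_module_scaleDl v : {morph scale^~ v : a b / a + b}.
Proof. by move=> a b; rewrite /scale rmorphD mulmxDl. Qed.
HB.instance Definition _ := GRing.Zmodule_isLmodule.Build R V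
  mx_module_scaleA mx_module_scale1 mx_module_scaleDr mx_module_scaleDl.

Lemma mx_module_scaleE (r : R) (v : V) : r *: v = rho r *m (v : 'cV[k]_m) :> 'cV[k]_m.
Proof. by []. Qed.

Hypothesis m_gt0 : (0 < m)%N.
Hypothesis rho_surj : forall M, exists r, rho r = M.

Lemma mx_module_irreducible : irreducible (V : lmodType R).
Proof.
split.
  exists (const_mx 1 : 'cV[k]_m); apply/eqP => /matrixP /(_ (Ordinal m_gt0) 0).
  by rewrite !mxE => /eqP; rewrite oner_eq0.
move=> N [N0 NL]; have [[x [xN x0]]|nex] := pselect (exists x : V, x \in N /\ x <> 0).
  right=> y; have [i xi] : exists i, (x : 'cV[k]_m) i 0 != 0.
    apply: contrapT => nex; apply: x0; apply/matrixP => i j; rewrite [RHS]mxE ord1.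
    by apply: contrapT => /eqP xi; apply: nex; exists i.
  have [r rE] := rho_surj (((x : 'cV[k]_m) i 0)^-1 *: ((y : 'cV[k]_m) *m delta_mx 0 i)).
  suff -> : y = r *: x + 0 by apply: NL.
  rewrite addr0; apply: etrans (esym (mx_module_scaleE r x)).
  rewrite rE -scalemxAl -mulmxA.
  have -> : (delta_mx 0 i : 'rV[k]_m) *m (x : 'cV[k]_m) = ((x : 'cV[k]_m) i 0)%:M.
    by apply/matrixP => p q; rewrite !ord1 -rowE !mxE.
  by rewrite mul_mx_scalar scalerA mulVf // scale1r.
left=> x xN; apply: contrapT => x0; apply: nex.
by exists x.
Qed.

Lemma mx_module_dim (phi : {rmorphism k -> R}) :
  (forall a, rho (phi a) = a%:M) -> has_dim (restr phi (V : lmodType R)) m.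
Proof.
move=> rhophi; pose f (v : restr phi (V : lmodType R)) : 'rV[k]_m := (v : 'cV[k]_m)^T.
have fl : linear f.
  move=> a u v; rewrite /f -[a *: u + v]/((rho (phi a) *m (u : 'cV[k]_m) + v) : 'cV[k]_m).
  by rewrite rhophi mul_scalar_mx linearP.
exists (linear_pack fl); exists (fun v : 'rV[k]_m => v^T : 'cV[k]_m).
  by move=> v; apply: trmxK.
by move=> v; apply: trmxK.
Qed.
End MatrixModule.

Section MatrixFamily.
Variables (k : fieldType) (R : pzRingType) (phi : {rmorphism k -> R}).
Hypothesis phiC : forall a r, phi a * r = r * phi a.
Variables (I : finType) (m : I -> nat) (rho : forall i, {rmorphism R -> 'M[k]_(m i)}).
Hypothesis m_gt0 : forall i, (0 < m i)%N.
Hypothesis rho_phi : forall i a, rho i (phi a) = a%:M.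
Hypothesis rho_surj : forall M : forall i, 'M[k]_(m i), exists r, forall i, rho i r = M i.

(** The hypotheses describe an algebra whose quotient by a nilpotent ideal is a
    product of matrix algebras; its irreducible modules are the column modules
    of the factors. *)
Let ker : set R := [set r | forall i, rho i r = 0].
Hypothesis ker_nilpotent : exists q, forall s : seq R, size s = q ->
  (forall r, r \in s -> ker r) -> \prod_(r <- s) r = 0.

Local Notation V i := (mx_module (rho i) : lmodType R).

Lemma family_surj i M : exists r, rho i r = M.
Proof.
pose F j : 'M[k]_(m j) := if i =P j is ReflectT e then ecast j 'M[k]_(m j) e M else 0.
have [r rF] := rho_surj F; exists r; rewrite rF /F.
by case: eqP => // e; rewrite eq_axiomK.
Qed.

Lemma family_unit i (p q : 'I_(m i)) :
  exists r, rho i r = delta_mx p q /\ forall j, j != i -> rho j r = 0.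
Proof.
pose F j : 'M[k]_(m j) :=
  if i =P j is ReflectT e then ecast j 'M[k]_(m j) e (delta_mx p q) else 0.
have [r rF] := rho_surj F; exists r; rewrite rF /F; split.
  by case: eqP => // e; rewrite eq_axiomK.
move=> j ne; rewrite rF /F; case: eqP => // e.
by rewrite e eqxx in ne.
Qed.

Lemma family_irreducible i : irreducible (V i).
Proof. by apply: mx_module_irreducible => // M; apply: family_surj. Qed.

Lemma family_distinct i j : module_iso (V i) (V j) -> i = j.
Proof.
move=> [f [g fK _]]; apply/eqP; apply: contrapT => /negP ne.
pose F l : 'M[k]_(m l) := if l == i then 1%:M else 0.
have [r rF] := rho_surj F.
have [[v /eqP v0] _] := family_irreducible i; apply: v0; apply: (can_inj fK).
have ri : r *: v = v by rewrite -[LHS]/(rho i r *m _) rF /F eqxx mul1mx.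
rewrite linear0 -ri linearZ -[LHS]/(rho j r *m _) rF /F eq_sym (negPf ne).
exact: mul0mx.
Qed.

(** The diagonal matrix units sum to the identity, so one of them does not
    annihilate x. For such a matrix unit e_(p0, p0) of the block i, the vectors
    e_(p, p0) x span a copy of the column module, and Schur's lemma applies. *)
Lemma family_complete (M : lmodType R) : irreducible M -> exists i, module_iso M (V i).
Proof.
move=> Mirr; have [[x x0] _] := Mirr.
have kerMr a r : ker r -> ker (r * a) by move=> kr i; rewrite rmorphM kr mul0r.
have kerM (t : R) (y : M) : ker t -> t *: y = 0.
  apply: (reducible_nilpotent (completely_reducible_of_no_submodule Mirr.2)) => //.
  have [q nil] := ker_nilpotent.
  by exists q => s ss sk z; rewrite nil // scale0r.
have kerE r r' (y : M) : (forall i, rho i r = rho i r') -> r *: y = r' *: y.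
  move=> e; apply/eqP; rewrite -subr_eq0 -scalerBl; apply/eqP; apply: kerM => i.
  by rewrite rmorphB e subrr.
pose U i (p q : 'I_(m i)) := sval (cid (family_unit p q)).
have UE i (p q : 'I_(m i)) : rho i (U i p q) = delta_mx p q.
  by rewrite /U; case: cid => r [].
have U0 i j (p q : 'I_(m i)) : j != i -> rho j (U i p q) = 0.
  by rewrite /U; case: cid => r [_ /= r0]; apply: r0.
have sum1 : \sum_i \sum_p U i p p *: x = x.
  rewrite -[RHS]scale1r; under eq_bigr do rewrite -scaler_suml.
  rewrite -scaler_suml; apply: kerE => j.
  rewrite rmorph_sum rmorph1 (bigD1 j) //= [X in _ + X]big1 ?addr0 => [|i ne]; last first.
    by rewrite rmorph_sum big1 // => p _; rewrite U0 // eq_sym.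
  rewrite rmorph_sum; apply/matrixP => p q; rewrite summxE mxE.
  rewrite (bigD1 p) //= UE mxE eqxx /= big1 ?addr0 => [|p' ne]; first by rewrite eq_sym.
  by rewrite UE mxE eq_sym (negPf ne).
have [i [p0 nz]] : exists i p, U i p p *: x != 0.
  apply: contrapT => nex; case/eqP: x0; rewrite -sum1 big1 // => i _; rewrite big1 // => p _.
  by apply: contrapT => /eqP h; apply: nex; exists i, p.
exists i; apply: module_iso_sym.
pose f (v : V i) : M := \sum_p phi ((v : 'cV[k]_(m i)) p 0) *: (U i p p0 *: x).
have fl : linear f.
  move=> r v w; rewrite /f scaler_sumr.
  transitivity (\sum_p phi ((rho i r *m (v : 'cV[k]_(m i))) p 0) *: (U i p p0 *: x) + f w).
    rewrite -big_split; apply: eq_bigr => p _ /=.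
    rewrite -scalerDl -rmorphD; congr (phi _ *: _).
    by rewrite -[r *: v + w]/((rho i r *m (v : 'cV[k]_(m i))) + w : 'cV[k]_(m i)) [LHS]mxE.
  congr (_ + _).
  transitivity (\sum_q \sum_p phi (rho i r p q) *: (phi ((v : 'cV[k]_(m i)) q 0) *: (U i p p0 *: x))).
    rewrite exchange_big; apply: eq_bigr => p _ /=; rewrite mxE rmorph_sum scaler_suml.
    by apply: eq_bigr => q _; rewrite rmorphM [RHS]scalerA.
  apply: eq_bigr => q _; rewrite [RHS]scalerA -phiC -[RHS]scalerA.
  transitivity (phi ((v : 'cV[k]_(m i)) q 0) *: \sum_p (phi (rho i r p q) * U i p p0) *: x).
    rewrite scaler_sumr; apply: eq_bigr => p _.
    by rewrite [RHS]scalerA mulrA phiC -mulrA -[RHS]scalerA; congr (_ *: _); rewrite -scalerA.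
  congr (_ *: _); rewrite -scaler_suml scalerA; apply: kerE => j.
  rewrite rmorph_sum rmorphM; have [->|ne] := eqVneq j i; last first.
    by rewrite U0 // mulr0 big1 // => p _; rewrite rmorphM U0 // mulr0.
  rewrite UE; apply/matrixP => s t; rewrite summxE.
  have -> : (rho i r * delta_mx q p0) s t = rho i r s q * (t == p0)%:R.
    rewrite [LHS]mxE (bigD1 q) //= [delta_mx _ _ _ _]mxE eqxx big1 ?addr0 // => q' ne.
    by rewrite [delta_mx _ _ _ _]mxE (negPf ne) mulr0.
  rewrite (bigD1 s) //= rmorphM rho_phi UE -mulmxE mul_scalar_mx !mxE eqxx.
  rewrite big1 ?addr0 // => p ne.
  by rewrite rmorphM rho_phi UE -mulmxE mul_scalar_mx !mxE eq_sym (negPf ne) mulr0.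
exists (linear_pack fl); apply: (@schur R (V i) M (linear_pack fl) (delta_mx p0 0 : 'cV[k]_(m i))) => //.
  exact: family_irreducible.
rewrite /= /f (bigD1 p0) //= mxE !eqxx rmorph1 scale1r big1 ?addr0 // => p ne.
by rewrite mxE (negPf ne) rmorph0 scale0r.
Qed.
End MatrixFamily.

(** * The square dimension is the rank of the trace form *)

Lemma linear_injective_dim (k : fieldType) d d' (f : {linear 'rV[k]_d -> 'rV[k]_d'}) :
  injective f -> (d <= d')%N.
Proof.
move=> finj; have : row_free (lin1_mx f).
  apply: inj_row_free => v; rewrite mul_rV_lin1 => fv; apply: finj.
  by rewrite fv linear0.
by rewrite -row_leq_rank => /leq_trans; apply; apply: rank_leq_col.
Qed.

Lemma has_dim_le (k : fieldType) (V W : lmodType k) (f : {linear V -> W}) d d' :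
  injective f -> has_dim V d -> has_dim W d' -> (d <= d')%N.
Proof.
move=> finj [g [g' gK g'K]] [h [h' hK _]].
have g'l : linear g' by move=> a u v; apply: (can_inj gK); rewrite linearP !g'K.
pose F : {linear 'rV[k]_d -> 'rV[k]_d'} := h \o (f \o linear_pack g'l).
apply: (@linear_injective_dim k d d' F).
by move=> u v /= /(can_inj hK) /finj /(can_inj g'K).
Qed.

Lemma restr_iso_dim (k : fieldType) (R : pzRingType) (phi : {rmorphism k -> R})
  (V W : lmodType R) d d' : module_iso V W ->
  has_dim (restr phi V) d -> has_dim (restr phi W) d' -> d = d'.
Proof.
have le (V1 W1 : lmodType R) d1 d2 : module_iso V1 W1 ->
    has_dim (restr phi V1) d1 -> has_dim (restr phi W1) d2 -> (d1 <= d2)%N.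
  move=> [f [g fK _]]; pose f' (v : restr phi V1) : restr phi W1 := f (v : V1).
  have fl : linear f'.
    by move=> a u v; rewrite /f' -[a *: u + v]/(phi a *: (u : V1) + (v : V1)) linearP.
  by apply: (@has_dim_le k _ _ (linear_pack fl)); apply: (can_inj fK).
move=> VW Vd Wd; apply/eqP; rewrite eqn_leq (le _ _ _ _ VW Vd Wd).
exact: le (module_iso_sym VW) Wd Vd.
Qed.

Lemma leq_sum_inj (n n' : nat) (f : 'I_n -> 'I_n') (F : 'I_n' -> nat) :
  injective f -> (\sum_i F (f i) <= \sum_j F j)%N.
Proof.
move=> finj; rewrite -big_enum -(big_map f xpredT F) big_uniq /=; last first.
  by rewrite map_inj_uniq ?enum_uniq.
by rewrite [leqRHS](bigID (mem [seq f i | i <- enum 'I_n])) leq_addr.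
Qed.

(** Two complete lists of irreducible modules correspond to each other up to
    isomorphism. *)
Lemma is_square_dim_unique (k : fieldType) (A : algType k) (C : comAlgType k)
  (iota : {lrmorphism C -> A}) (m : set C) N N' :
  is_square_dim iota m N -> is_square_dim iota m N' -> N = N'.
Proof.
have le N1 N2 : is_square_dim iota m N1 -> is_square_dim iota m N2 -> (N1 <= N2)%N.
  move=> [n [V [d [Virr Vdist Vall Vdim ->]]]] [n' [V' [d' [V'irr V'dist V'all V'dim ->]]]].
  have [f fP] := choice (fun i => V'all _ (Virr i)).
  have finj : injective f.
    move=> i j fij; apply: Vdist; apply: module_iso_trans (fP i) _.
    by rewrite fij; apply: module_iso_sym.
  rewrite (eq_bigr (fun i => d' (f i) ^ 2)%N); first exact: leq_sum_inj (fun j => d' j ^ 2)%N finj.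
  by move=> i _; congr (_ ^ 2)%N; apply: restr_iso_dim (fP i) (Vdim i) (V'dim (f i)).
by move=> h h'; apply/eqP; rewrite eqn_leq !le.
Qed.

Section Representations.
Variables (k : closedFieldType) (A : algType k) (C : comAlgType k).
Variables (iota : {lrmorphism C -> A}) (tr : A -> C) (n : nat).
Hypothesis char0 : [pchar k] =i pred0.
Hypothesis CH : cayley_hamilton iota tr n.
Variable chi : {rmorphism C -> k}.
Hypothesis chi_alg : forall a, chi a%:A = a.
Local Notation mA := (ideal_gen (iota @` chi_ker chi)).
Local Notation tau := (chi \o tr).
Let tf := character_trace_form char0 CH chi_alg.

Lemma chi_ker_maximal : maxSpec C (chi_ker chi).
Proof.
split.
- split=> [|x y x0 y0|c x x0]; rewrite /chi_ker /=; first exact: rmorph0.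
    by rewrite rmorphD x0 y0 addr0.
  by rewrite !rmorphM x0 mulr0 mul0r.
- move=> e; have : chi_ker chi 1 by rewrite e.
  by rewrite /chi_ker /= rmorph1 => /eqP; rewrite oner_eq0.
move=> J [J0 JD JM] mJ; have [[x [Jx cx]]|nex] := pselect (exists x, J x /\ chi x <> 0).
  right; apply/seteqP; split=> // y _.
  pose e := chi y / chi x; have -> : y = e%:A * x + (y - e%:A * x) by rewrite addrC subrK.
  apply: JD; first by have [] := JM e%:A x Jx.
  apply: mJ; rewrite /chi_ker /= rmorphB rmorphM chi_alg divfK ?subrr //.
  exact/eqP.
left; apply/seteqP; split=> // x Jx; apply: contrapT => cx; apply: nex.
by exists x.
Qed.

(** The radical is nil of index n modulo the fiber ideal. *)
Lemma radical_nilpotent : exists q, forall s : seq A, size s = q ->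
  (forall x, x \in s -> radical tau x) -> mA (\prod_(x <- s) x).
Proof.
have [q NH] := nagata_higman A n; exists q => s ss sT.
apply: (NH (radical tau) mA) ss sT.
- exact: (radD tf).
- by move=> x y Tx Ty; apply: radMr.
- by move=> x y; apply: igenB.
- by move=> x y _ my; split; [apply: igenMl | apply: igenMr].
- move=> x m mx; have -> : x = (m.+1%:R^-1)%:A * (x *+ m.+1).
    by rewrite mulr_algl -scaler_nat scalerA mulVf ?scale1r // natr_neq0.
  exact: igenMl.
exact: (radical_nil CH).
Qed.

Variables (N : nat) (a : 'I_N -> A).
Hypothesis a0 : chi (disc tr a) <> 0.
Hypothesis amax : forall e : 'I_N.+1 -> A, chi (disc tr e) = 0.

Let K2 : (2%:R : k) <> 0. Proof. by apply/eqP; apply: natr_neq0. Qed.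

Let bound l (e : 'I_l -> A) : (N < l)%N -> \det (form_gram tau e) = 0.
Proof.
move=> ltNl; have -> : \det (form_gram tau e) = chi (disc tr e).
  by rewrite -det_map_mx; congr determinant; apply/matrixP => r s; rewrite !mxE.
apply: contrapT => e0.
have [b b0] := disc_subtuple CH (@field_domain k) K2 e0 ltNl.
by apply: b0; apply: amax.
Qed.

Let span x : exists c : 'I_N -> k, radical tau (x - \sum_i c i *: a i).
Proof.
exists (fun i => (chi (disc tr a))^-1 * chi (tr (x * dual iota tr a i))).
move=> h; have d0 : chi (disc tr a) != 0 by apply/eqP.
have := disc_maximal_radical (chi := chi) CH (@field_domain k) K2 a0 amax x h.
move: (disc tr a) d0 => d d0.
rewrite mulrBl mulr_suml (trB CH) (tr_sum CH) -mulrA (trZ CH) rmorphB rmorphM rmorph_sum.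
move/eqP; rewrite subr_eq0 => /eqP E.
rewrite mulrBl (tfB tf) mulr_suml (tf_sum tf); apply: (mulfI d0).
rewrite mulr0 mulrBr -[chi _ * tau (x * h)]/(chi d * chi (tr (x * h))) E mulr_sumr.
apply/eqP; rewrite subr_eq0; apply/eqP/eq_bigr => i _.
rewrite -mulrA (trZ CH) rmorphM -scalerAl (tfZ tf) !mulrA mulfV // mul1r.
by [].
Qed.

(** The representations of the quotient by the radical, with the count of its
    dimension: the matrix coefficients give an isomorphism from the span of the
    maximal tuple a to the product of the matrix algebras. *)
Lemma character_representations :
  exists (I : finType) (m : I -> nat) (rho : forall i, {rmorphism A -> 'M[k]_(m i)}),
  [/\ forall i, (0 < m i)%N, forall i c x, rho i (c *: x) = c *: rho i x,
      forall M : forall i, 'M[k]_(m i), exists x, forall i, rho i x = M i,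
      forall x, (forall i, rho i x = 0) <-> radical tau x
    & N = (\sum_i m i ^ 2)%N].
Proof.
have [I [m [rho [m0 rZ rS rK]]]] := wedderburn char0 tf bound.
exists I, m, rho; split=> //.
pose J := {i : I & 'I_(m i) * 'I_(m i)}%type.
have <- : #|{: J}| = (\sum_i m i ^ 2)%N.
  rewrite card_tagged sumnE big_map -big_enum /=; apply: eq_bigr => i _.
  by rewrite card_prod card_ord mulnn.
pose F (x : A) : 'rV[k]_#|{: J}| :=
  \row_t rho (tag (enum_val t)) x (tagged (enum_val t)).1 (tagged (enum_val t)).2.
pose X : 'M[k]_(N, #|{: J}|) := \matrix_l F (a l).
have FX (c : 'rV[k]_N) : c *m X = F (\sum_l c 0 l *: a l).
  apply/rowP => t; rewrite !mxE rmorph_sum summxE; apply: eq_bigr => l _.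
  by rewrite !mxE rZ mxE.
have FT x : F x = 0 <-> radical tau x.
  rewrite -rK; split=> [F0 i|r0]; last by apply/rowP => t; rewrite !mxE r0 mxE.
  apply/matrixP => p q; have /rowP /(_ (enum_rank (Tagged _ (p, q) : J))) := F0.
  by rewrite !mxE enum_rankK.
have F_eq x y : radical tau (x - y) -> F x = F y.
  move=> /FT; rewrite /F => /rowP e; apply/rowP => t; have := e t; rewrite !mxE rmorphB !mxE.
  by move/eqP; rewrite subr_eq0 => /eqP.
have rfree : row_free X.
  apply: inj_row_free => c; rewrite FX => /FT T; apply/rowP => i; rewrite mxE.
  have tdual l : tau (c 0 l *: a l * dual iota tr a i) = c 0 l * chi ((l == i)%:R * disc tr a).
    by rewrite -scalerAl (tfZ tf) -(tr_dual CH).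
  have /eqP := T (dual iota tr a i); rewrite mulr_suml (tf_sum tf) (bigD1 i) //.
  rewrite tdual eqxx mul1r big1 ?addr0 => [|l ne]; last first.
    by rewrite tdual (negPf ne) mul0r rmorph0 mulr0.
  by rewrite /= addr0 mulf_eq0 => /orP [/eqP //|/eqP].
have rfull : row_full X.
  apply/row_fullP.
  (* A matrix unit is the image of some x, which is congruent to a
     combination of a modulo the radical. *)
  have row t : exists c : 'rV[k]_N, c *m X = delta_mx 0 t.
    pose M i : 'M[k]_(m i) := \matrix_(p, q) (enum_val t == Tagged _ (p, q) :> J)%:R.
    have [x xM] := rS M; have [c cT] := span x.
    exists (\row_l c l); rewrite FX -(F_eq x).
      apply/rowP => s; rewrite !mxE xM mxE eqxx /=.
      have -> : Tagged (fun i => 'I_(m i) * 'I_(m i))%type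
        ((tagged (enum_val s)).1, (tagged (enum_val s)).2) = enum_val s :> J.
        by rewrite -surjective_pairing taggedK.
      by rewrite (inj_eq enum_val_inj) eq_sym.
    by under eq_bigr do rewrite mxE.
  have [D DP] := choice row.
  exists (\matrix_t D t); apply/row_matrixP => t.
  by rewrite row_mul rowK DP row1.
move: rfree rfull; rewrite -row_leq_rank -col_leq_rank => le1 le2.
apply/eqP; rewrite eqn_leq (leq_trans le1 (rank_leq_col _)).
exact: leq_trans le2 (rank_leq_row _).
Qed.

Section FactorFiber.
Variables (m : nat) (rho : {rmorphism A -> 'M[k]_m}).
Hypothesis rho_fiber : forall x, mA x -> rho x = 0.

Definition factor_fun (x : fiber iota (chi_ker chi)) : 'M[k]_m := rho (repr x).

Lemma factor_funE x : factor_fun (quo_pi _ x) = rho x.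
Proof.
rewrite /factor_fun; apply/eqP; rewrite -subr_eq0 -rmorphB; apply/eqP.
by apply: rho_fiber; apply/quo_piP; rewrite quo_reprK.
Qed.

Lemma factor_exists : exists rho' : {rmorphism fiber iota (chi_ker chi) -> 'M[k]_m},
  forall x, rho' (quo_pi _ x) = rho x.
Proof.
have W (P : fiber iota (chi_ker chi) -> Prop) : (forall x, P (quo_pi _ x)) -> forall q, P q.
  by move=> h q; rewrite -(quo_reprK q).
have fB : zmod_morphism factor_fun.
  by elim/W=> x; elim/W=> y; rewrite -rmorphB !factor_funE rmorphB.
have fM : monoid_morphism factor_fun.
  split; first by rewrite -(rmorph1 (quo_pi _)) factor_funE rmorph1.
  by elim/W=> x; elim/W=> y; rewrite -rmorphM !factor_funE rmorphM.
pose f : {rmorphism fiber iota (chi_ker chi) -> 'M[k]_m} := (HB.pack factor_fun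
  (GRing.isZmodMorphism.Build (fiber iota (chi_ker chi)) 'M[k]_m factor_fun fB)
  (GRing.isMonoidMorphism.Build (fiber iota (chi_ker chi)) 'M[k]_m factor_fun fM)).
by exists f => x; apply: factor_funE.
Qed.
End FactorFiber.

Theorem square_dim_rank : square_dim iota (chi_ker chi) = N.
Proof.
have [I [m [rho [m0 rZ rS rK NE]]]] := character_representations.
suff isN : is_square_dim iota (chi_ker chi) N.
  apply: (is_square_dim_unique _ isN).
  by apply: (xgetPex 0%N (P := [set M | is_square_dim iota (chi_ker chi) M])); exists N.
pose R := fiber iota (chi_ker chi); pose pi : {rmorphism A -> R} := quo_pi (iota @` chi_ker chi).
have W (P : R -> Prop) : (forall x, P (pi x)) -> forall q, P q.
  by move=> h q; rewrite -(quo_reprK q); apply: h.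
have rf i x : mA x -> rho i x = 0 by move/(fiber_radical CH) => Tx; exact: (rK x).2 Tx i.
pose rho' i : {rmorphism R -> 'M[k]_(m i)} := sval (cid (factor_exists (rf i))).
have rE i x : rho' i (pi x) = rho i x by rewrite /rho'; case: cid => r rP /=; apply: rP.
pose phi := fiber_scalar iota (chi_ker chi).
have phiC (c : k) r : phi c * r = r * phi c.
  elim/W: r => x; rewrite -[phi c]/(pi c%:A) -!rmorphM; congr (pi _).
  by rewrite mulr_algl mulr_algr.
have rphi i (c : k) : rho' i (phi c) = c%:M.
  by rewrite -[phi c]/(pi c%:A) rE rZ rmorph1 scalemx1.
have rS' (M : forall i, 'M[k]_(m i)) : exists r, forall i, rho' i r = M i.
  by have [x xM] := rS M; exists (pi x) => i; rewrite rE.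
have nil : exists q, forall s : seq R, size s = q ->
    (forall r, r \in s -> forall i, rho' i r = 0) -> \prod_(r <- s) r = 0.
  have [q nilq] := radical_nilpotent; exists q => s ss sk.
  have -> : \prod_(r <- s) r = pi (\prod_(x <- [seq repr r | r <- s]) x).
    rewrite rmorph_prod big_map; apply: eq_bigr => r _; exact: esym (quo_reprK r).
  rewrite -(rmorph0 pi); apply/quo_piP; rewrite subr0; apply: nilq; first by rewrite size_map.
  move=> x /mapP [r rs ->]; apply/rK => i; rewrite -rE.
  by have := sk r rs i; rewrite -{1}(quo_reprK r).
exists #|I|, (fun j => mx_module (rho' (enum_val j)) : lmodType R), (fun j => m (enum_val j)).
split.
- by move=> j; apply: family_irreducible.
- by move=> i j /(family_distinct m0 rS') /enum_val_inj.
- move=> M Mirr; have [i iso] := family_complete phiC m0 rphi rS' nil Mirr.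
  by exists (enum_rank i); rewrite enum_rankK.
- by move=> j; apply: mx_module_dim.
rewrite [LHS]NE (reindex (@enum_val I predT)) //.
by apply: onW_bij; apply: enum_val_bij.
Qed.
End Representations.

(** * Sums over coproducts *)

Section Counit.
Variables (k : fieldType) (H : hopfAlgType k).
HB.instance Definition _ :=
  GRing.isLinear.Build k H k *%R (@counit k H) (@counit_scalar k H).
HB.instance Definition _ :=
  GRing.isMonoidMorphism.Build H k (@counit k H) (@counit_monoid_morphism k H).
HB.instance Definition _ :=
  GRing.isLinear.Build k H H *:%R (@antipode k H) (@antipode_linear k H).
End Counit.

Section TensorLift.
Variables (k : fieldType).

Lemma tlift_comp (V W U U' : lmodType k) (f : V -> W -> U) (g : U -> U') x :
  linear g -> g (tlift f x) = tlift (fun v w => g (f v w)) x.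
Proof.
move=> gl; rewrite /tlift /formal_sum.
exact: (raddf_sum (linear_pack gl : {additive U -> U'})).
Qed.

(** The lift of a function to the tensor product is a finite sum over a
    representative, so such identities hold without any bilinearity of the
    functions. *)
Lemma tlift_comb (V W U : lmodType k) (f g h : V -> W -> U) a x :
  (forall v w, h v w = a *: f v w + g v w) -> tlift h x = a *: tlift f x + tlift g x.
Proof.
move=> hE; rewrite /tlift /formal_sum scaler_sumr -big_split.
by apply: eq_bigr => p _; apply: hE.
Qed.

Lemma eq_tlift (V W U : lmodType k) (f g : V -> W -> U) x :
  (forall v w, f v w = g v w) -> tlift f x = tlift g x.
Proof. by move=> fg; rewrite /tlift /formal_sum; apply: eq_bigr => p _. Qed.

Lemma tlift_exchange (V W V' W' U : lmodType k) (f : V -> W -> V' -> W' -> U) x y :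
  tlift (fun v w => tlift (f v w) y) x =
  tlift (fun v' w' => tlift (fun v w => f v w v' w') x) y.
Proof. exact: exchange_big. Qed.

Lemma tlift_map (V W V' W' U : lmodType k) (f : V' -> V) (g : W' -> W) (F : V -> W -> U) x :
  bilin F -> tlift F (tmap f g x) = tlift (fun v w => F (f v) (g w)) x.
Proof.
move=> Fb; rewrite (tlift_comp _ _ (tliftP Fb)).
by apply: eq_tlift => v w; rewrite tlift_pure.
Qed.
End TensorLift.

Section Sweedler.
Variables (k : fieldType) (H : hopfAlgType k).
Local Notation S := (@antipode k H).
Local Notation eps := (@counit k H).

(** A sum over the coproduct of h, in Sweedler's notation \sum F (h_1, h_2). *)
Definition sw (U : lmodType k) (F : H -> H -> U) (h : H) : U := tlift F (comul h).

Lemma sw_linear (U : lmodType k) (F : H -> H -> U) : bilin F -> linear (sw F).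
Proof. by move=> Fb a x y; rewrite /sw linearP tliftP. Qed.

Lemma sw_assoc (U : lmodType k) (F : H -> H -> H -> U) :
  (forall b c, linear (fun a => F a b c)) -> (forall a c, linear (fun b => F a b c)) ->
  (forall a b, linear (F a b)) -> forall h,
  sw (fun a b => sw (fun a1 a2 => F a1 a2 b) a) h = sw (fun a b => sw (F a) b) h.
Proof.
move=> F1 F2 F3 h.
have Fab a : bilin (F a) by split=> *; [apply: F3 | apply: F2].
pose Phi (x : tens H (tens H H)) : U := tlift (fun a y => tlift (F a) y) x.
have Phib : bilin (fun a (y : tens H H) => tlift (F a) y).
  split=> [a|y]; first exact: tliftP.
  by move=> c a a'; apply: tlift_comb => b b'; apply: F1.
have Phil : linear Phi by apply: tliftP.
have := congr1 Phi (comulA h).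
rewrite /tassoc /tmap (tlift_comp _ (comul h) Phil).
have inner (w : H) : bilin (fun u v => pure u (pure v w) : tens H (tens H H)).
  have [p1 p2] := pure_bilin H (tens H H); have [q1 q2] := pure_bilin H H.
  split=> [u a v v'|v a u u'] /=; last exact: p2.
  by rewrite q2 p1.
have outer : bilin (fun (x : tens H H) (w : H) =>
    tlift (fun u v => pure u (pure v w) : tens H (tens H H)) x).
  split=> [x a w w'|w]; last exact: tliftP.
  apply: tlift_comb => u v; have [p1 p2] := pure_bilin H (tens H H).
  by have [q1 q2] := pure_bilin H H; rewrite q1 p1.
rewrite (tlift_comp _ (comul h) (tliftP outer)) (tlift_comp _ (comul h) Phil) => E.
transitivity (tlift (fun v w => Phi (tlift
  (fun (x : tens H H) (w : H) => tlift (fun u v0 => pure u (pure v0 w) : tens H (tens H H)) x)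
    (pure (comul v) (id w)))) (comul h)).
  apply: eq_tlift => a b; rewrite tlift_pure // (tlift_comp _ _ Phil).
  by apply: eq_tlift => u v; rewrite /Phi !tlift_pure.
rewrite {}E; apply: eq_tlift => a b.
by rewrite /Phi tlift_pure.
Qed.

Lemma sw_mul (U : lmodType k) (F : H -> H -> U) : bilin F -> forall x y,
  sw F (x * y) = sw (fun x1 x2 => sw (fun y1 y2 => F (x1 * y1) (x2 * y2)) y) x.
Proof.
move=> Fb x y; rewrite /sw rmorphM.
rewrite -[comul x * comul y]/(tlift (fun a b => tmap ( *%R a) ( *%R b) (comul y)) (comul x)).
rewrite (tlift_comp _ _ (tliftP Fb)); apply: eq_tlift => a b.
by rewrite tlift_map.
Qed.

Lemma sw_counitl (U : lmodType k) (g : H -> U) h : linear g ->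
  sw (fun a b => eps a *: g b) h = g h.
Proof.
move=> gl; rewrite -[h in RHS]counitl (tlift_comp _ _ gl).
by apply: eq_tlift => a b; rewrite [RHS](linearZ_LR (linear_pack gl)).
Qed.

Lemma sw_counitr (U : lmodType k) (g : H -> U) h : linear g ->
  sw (fun a b => eps b *: g a) h = g h.
Proof.
move=> gl; rewrite -[h in RHS]counitr (tlift_comp _ _ gl).
by apply: eq_tlift => a b; rewrite [RHS](linearZ_LR (linear_pack gl)).
Qed.

Lemma sw_antipodel (U : lmodType k) (g : H -> U) h : linear g ->
  sw (fun a b => g (S a * b)) h = eps h *: g 1.
Proof.
move=> gl; rewrite -(linearZ_LR (linear_pack gl)) /= -antipodel (tlift_comp _ _ gl).
exact: eq_tlift.
Qed.

Lemma sw_antipoder (U : lmodType k) (g : H -> U) h : linear g ->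
  sw (fun a b => g (a * S b)) h = eps h *: g 1.
Proof.
move=> gl; rewrite -(linearZ_LR (linear_pack gl)) /= -antipoder (tlift_comp _ _ gl).
exact: eq_tlift.
Qed.

Lemma sw_comp (U U' : lmodType k) (F : H -> H -> U) (g : U -> U') h : linear g ->
  g (sw F h) = sw (fun a b => g (F a b)) h.
Proof. by move=> gl; apply: tlift_comp. Qed.

Lemma eq_sw (U : lmodType k) (F G : H -> H -> U) h :
  (forall a b, F a b = G a b) -> sw F h = sw G h.
Proof. exact: eq_tlift. Qed.

Let mulrlin (x : H) : linear ( *%R x).
Proof. by move=> a u v; rewrite mulrDr scalerAr. Qed.
Let mullin (x : H) : linear ( *%R^~ x).
Proof. by move=> a u v; rewrite mulrDl scalerAl. Qed.

Lemma antipode1 : S 1 = 1.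
Proof.
have := antipodel (1 : H); rewrite (rmorph1 (@comul k H)) (rmorph1 (@counit k H)).
rewrite scale1r tlift_pure ?mulr1 //.
split=> [a c u v|b c u v]; first exact: mulrlin.
by rewrite linearP mulrDl scalerAl.
Qed.

(** The convolution inverse of the multiplication is computed in two ways: S (x
    y) and S y S x are both obtained from S (x_1 y_1) x_2 y_2 S y_3 S x_3, by
    collapsing the factors from the right or from the left. *)
Lemma antipodeM (x y : H) : S (x * y) = S y * S x.
Proof.
pose F (x1 x2 x3 y1 y2 y3 : H) := S (x1 * y1) * (x2 * y2) * (S y3 * S x3).
transitivity (sw (fun x1 x' => sw (fun x2 x3 =>
    sw (fun y1 y' => sw (fun y2 y3 => F x1 x2 x3 y1 y2 y3) y') y) x') x).
  have -> : S (x * y) = sw (fun x1 x' => eps x' *: S (x1 * y)) x.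
    by rewrite (sw_counitr (g := fun x1 => S (x1 * y))) // => a u v; rewrite mulrDl -scalerAl linearP.
  apply: eq_sw => x1 x'.
  transitivity (sw (fun x2 x3 => S (x1 * y) * (x2 * S x3)) x').
    rewrite (sw_antipoder (g := fun z => S (x1 * y) * z)) ?mulr1 //; exact: mulrlin.
  apply: eq_sw => x2 x3.
  have -> : S (x1 * y) * (x2 * S x3) = sw (fun y1 y' => eps y' *: (S (x1 * y1) * (x2 * S x3))) y.
    rewrite (sw_counitr (g := fun y1 => S (x1 * y1) * (x2 * S x3))) // => a u v.
    by rewrite mulrDr -scalerAr linearP mulrDl scalerAl.
  apply: eq_sw => y1 y'.
  have gl : linear (fun z => S (x1 * y1) * (x2 * z * S x3)).
    by move=> a u v; rewrite mulrDr mulrDl mulrDr -!scalerAr -scalerAl -scalerAr.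
  have := sw_antipoder y' gl; rewrite mulr1 => <-.
  by apply: eq_sw => y2 y3; rewrite /F !mulrA.
transitivity (sw (fun x' x3 => sw (fun x1 x2 =>
    sw (fun y1 y' => sw (fun y2 y3 => F x1 x2 x3 y1 y2 y3) y') y) x') x).
  rewrite sw_assoc // => [x2 x3|x1 x3|x1 x2] a u v; rewrite /F; apply: tlift_comb => y1 y';
    apply: tlift_comb => y2 y3.
  - by rewrite mulrDl -scalerAl linearP !mulrDl -!scalerAl.
  - by rewrite mulrDl mulrDr mulrDl -scalerAl -scalerAr -scalerAl.
  - by rewrite linearP !mulrDr -!scalerAr.
transitivity (sw (fun x' x3 => sw (fun x1 x2 =>
    sw (fun y' y3 => sw (fun y1 y2 => F x1 x2 x3 y1 y2 y3) y') y) x') x).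
  apply: eq_sw => x' x3; apply: eq_sw => x1 x2.
  rewrite sw_assoc // => [y2 y3|y1 y3|y1 y2] a u v; rewrite /F.
  - by rewrite mulrDr -scalerAr linearP !mulrDl -!scalerAl.
  - by rewrite !mulrDr -!scalerAr mulrDl -scalerAl.
  - by rewrite linearP mulrDl mulrDr -scalerAl -scalerAr.
have -> : S y * S x = sw (fun x' x3 => eps x' *: (S y * S x3)) x.
  by rewrite (sw_counitl (g := fun x3 => S y * S x3)) // => a u v; rewrite linearP mulrDr scalerAr.
apply: eq_sw => x' x3.
transitivity (sw (fun y' y3 => sw (fun x1 x2 => sw (fun y1 y2 => F x1 x2 x3 y1 y2 y3) y') x') y).
  exact: tlift_exchange.
have -> : eps x' *: (S y * S x3) = sw (fun y' y3 => eps y' *: (eps x' *: (S y3 * S x3))) y.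
  rewrite (sw_counitl (g := fun y3 => eps x' *: (S y3 * S x3))) // => a u v.
  by rewrite linearP mulrDl scalerDr -scalerAl !scalerA mulrC.
apply: eq_sw => y' y3.
have gl : linear (fun z : H => z * (S y3 * S x3)) by apply: mullin.
rewrite scalerA mulrC -rmorphM -[S y3 * S x3 in RHS]mul1r -(sw_antipodel _ gl).
rewrite sw_mul; first by apply: eq_sw => x1 x2; apply: eq_sw => y1 y2; rewrite /F !mulrA.
split=> [a c u v|b c u v] /=; first by rewrite mulrDr mulrDl -scalerAr -scalerAl.
by rewrite linearP !mulrDl -!scalerAl.
Qed.
End Sweedler.

(** * The base of a Cayley-Hamilton Hopf algebra *)

Lemma matrix_coordinates (k : fieldType) (A : algType k) (I : finType) (m : I -> nat)
  (rho : forall i, {rmorphism A -> 'M[k]_(m i)}) :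
  (forall i c x, rho i (c *: x) = c *: rho i x) ->
  (forall M : forall i, 'M[k]_(m i), exists x, forall i, rho i x = M i) ->
  exists u : {i : I & 'I_(m i) * 'I_(m i)}%type -> A, forall y i,
    rho i (y - \sum_t rho (tag t) y (tagged t).1 (tagged t).2 *: u t) = 0.
Proof.
move=> rZ rS; pose J := {i : I & 'I_(m i) * 'I_(m i)}%type.
have /choice [u uE] : forall t : J, exists x, forall i,
    rho i x = \matrix_(p, q) (t == Tagged _ (p, q) :> J)%:R by move=> t; apply: rS.
exists u => y i; rewrite rmorphB rmorph_sum; apply/eqP; rewrite subr_eq0; apply/eqP.
apply/matrixP => p q; rewrite summxE (bigD1 (Tagged _ (p, q) : J)) //= big1 => [|t ne].
  by rewrite addr0 rZ uE !mxE eqxx mulr1.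
by rewrite rZ uE !mxE (negPf ne) mulr0.
Qed.

Section HopfBase.
Variables (k : closedFieldType) (H : hopfAlgType k) (C : comAlgType k).
Variables (iota : {lrmorphism C -> H}) (tr : H -> C) (n : nat).
Hypothesis char0 : [pchar k] =i pred0.
Hypothesis CH : cayley_hamilton iota tr n.
Hypothesis HS : hopf_subalgebra iota.
Local Notation S := (@antipode k H).
Local Notation eps := (@counit k H).
Local Notation chi0 := (eps \o iota : {rmorphism C -> k}).

Lemma counit_alg (a : k) : eps a%:A = a.
Proof. by rewrite linearZ /= (rmorph1 (@counit k H)) mulr1. Qed.

Lemma sw_base c : exists x : tens C C, forall (U : lmodType k) (F : H -> H -> U),
  bilin F -> sw F (iota c) = tlift (fun a b => F (iota a) (iota b)) x.
Proof.
have [x cE] := HS.1 c; exists x => U F Fb.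
by rewrite /sw cE tlift_map.
Qed.

(** On C the antipode is multiplicative, because C is commutative. It is an
    involution for the same reason: in S (S c_1) S c_2 c_3 the last two factors
    collapse to a counit, which leaves S (S c), while the first two are equal to
    S (S c_1 c_2) and collapse as well, which leaves c. *)
Lemma base_antipode : exists SC : {rmorphism C -> C},
  [/\ forall c, S (iota c) = iota (SC c), forall a, SC a%:A = a%:A & involutive SC].
Proof.
have [SC SE] := choice HS.2.
have inj := iota_inj CH.
have SB : zmod_morphism SC.
  by move=> x y; apply: inj; rewrite -SE [iota (x - y)]rmorphB linearB /= !SE -rmorphB.
have SM : monoid_morphism SC.
  split=> [|x y]; apply: inj; first by rewrite -SE !rmorph1 antipode1.
  by rewrite -SE [iota (x * y)]rmorphM antipodeM !SE -rmorphM mulrC.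
pose SC' : {rmorphism C -> C} := HB.pack SC
  (GRing.isZmodMorphism.Build _ _ SC SB) (GRing.isMonoidMorphism.Build _ _ SC SM).
exists SC'; split=> //.
  by move=> a; apply: inj; rewrite /= -SE !iota_alg linearZ /= antipode1.
move=> c; apply: inj; rewrite /= -!SE.
have Sl : linear S by apply: antipode_linear.
have step a : sw (fun c1 c2 => S (S c1) * S c2) (iota a) = eps (iota a) *: (1 : H).
  rewrite -[1 in RHS]antipode1 -(sw_antipodel _ Sl).
  have [x xE] := sw_base a; rewrite !xE.
  - by apply: eq_tlift => u v; rewrite antipodeM !SE -!rmorphM mulrC.
  - split=> [u e v w|u e v w] /=; first by rewrite mulrDr -scalerAr linearP.
    by rewrite linearP mulrDl -scalerAl linearP.
  split=> [u e v w|u e v w] /=; first by rewrite linearP mulrDr -scalerAr.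
  by rewrite !linearP mulrDl -scalerAl.
have S2l : linear (fun h => S (S h)) by move=> e u v; rewrite !linearP.
rewrite -(sw_counitr _ S2l).
transitivity (sw (fun c1 c' => sw (fun c2 c3 => S (S c1) * S c2 * c3) c') (iota c)).
  apply: eq_sw => c1 c'.
  have gl : linear (fun z : H => S (S c1) * z).
    by move=> e u v; rewrite mulrDr scalerAr.
  have := sw_antipodel c' gl; rewrite mulr1 => <-.
  by apply: eq_sw => c2 c3; rewrite mulrA.
rewrite -(sw_assoc (F := fun c1 c2 c3 => S (S c1) * S c2 * c3)); last 3 first.
- by move=> b d e u v; rewrite !linearP !mulrDl -!scalerAl.
- by move=> b d e u v; rewrite linearP mulrDr mulrDl -scalerAr -scalerAl.
- by move=> b d e u v; rewrite mulrDr -scalerAr.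
have bil : bilin (fun c1 c2 => S (S c1) * S c2).
  split=> [u e v w|u e v w] /=; first by rewrite linearP mulrDr -scalerAr.
  by rewrite !linearP mulrDl -scalerAl.
have idl : linear (fun h : H => h) by [].
rewrite -[RHS](sw_counitl _ idl).
have [x xE] := sw_base c; rewrite !xE.
- apply: eq_tlift => u v; rewrite -[RHS]mulr_algl -step.
  have gl : linear (fun z : H => z * iota v) by move=> e w w'; rewrite mulrDl scalerAl.
  by rewrite (sw_comp _ _ gl).
- split=> [u e v w|u e v w] /=; first by rewrite scalerDr !scalerA mulrC.
  by rewrite linearP scalerDl -scalerA.
split=> [u e v w|u e v w] /=.
  by apply: tlift_comb => a b; rewrite mulrDr -scalerAr.
have gl (z : H) : linear (fun z' : H => z' * z) by move=> e' w' w''; rewrite mulrDl scalerAl.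
by rewrite -!(sw_comp _ _ (gl u)) (sw_linear bil) mulrDl -scalerAl.
Qed.
End HopfBase.

(** * The Chevalley property and the identity fiber *)

Section TensorAction.
Variables (k : fieldType) (H : hopfAlgType k) (V W : lmodType H).

Lemma tensor_act_pure (x : H) (v : restr (in_alg H) V) (w : restr (in_alg H) W) :
  x *: (pure v w : hopf_tens V W) =
  sw (fun a b => pure (a *: (v : V) : restr (in_alg H) V) (b *: (w : W) : restr (in_alg H) W)) x.
Proof.
rewrite -[LHS]/(outer_act (comul x) (pure v w)) /outer_act /tact /sw.
apply: eq_tlift => a b; rewrite /tmap tlift_pure //.
exact: (tact_bilin_in (act_bilin V) (act_bilin W)).
Qed.

Lemma tensor_act_bilin (v : restr (in_alg H) V) (w : restr (in_alg H) W) :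
  bilin (fun a b => pure (a *: (v : V) : restr (in_alg H) V) (b *: (w : W) : restr (in_alg H) W)).
Proof.
have [p1 p2] := pure_bilin (restr (in_alg H) V) (restr (in_alg H) W).
have [a1 a2] := act_bilin V; have [b1 b2] := act_bilin W.
split=> [a e b b'|b e a a'] /=; first by rewrite (b2 w) p1.
by rewrite (a2 v) p2.
Qed.
End TensorAction.

Section Chevalley.
Variables (k : closedFieldType) (H : hopfAlgType k) (C : comAlgType k).
Variables (iota : {lrmorphism C -> H}) (tr : H -> C) (n : nat).
Hypothesis char0 : [pchar k] =i pred0.
Hypothesis CH : cayley_hamilton iota tr n.
Hypothesis HS : hopf_subalgebra iota.
Hypothesis Hprime : prime_ring H.
Hypothesis Haff : affine H.
Local Notation S := (@antipode k H).
Local Notation eps := (@counit k H).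
Local Notation chi0 := (eps \o iota : {rmorphism C -> k}).
Local Notation mH := (ideal_gen (iota @` chi_ker chi0)).

Let chi0_alg a : chi0 a%:A = a. Proof. by rewrite /= iota_alg counit_alg. Qed.

Section TensorOfModules.
Variables (SC : {rmorphism C -> C}) (chi : {rmorphism C -> k}).
Hypothesis SCE : forall c, S (iota c) = iota (SC c).
Hypothesis chi_alg : forall a, chi a%:A = a.

(** The characters chi and chi o S of C are inverse to each other for
    convolution. Since the defining sum of the antipode takes values in H, the
    retraction tr / n of H to C is applied to it before chi. *)
Lemma convolution_counit c (x : tens C C) :
  (forall (U : lmodType k) (F : H -> H -> U), bilin F ->
     sw F (iota c) = tlift (fun a b => F (iota a) (iota b)) x) ->
  tlift (fun a b => chi a * chi (SC b) : k^o) x = eps (iota c).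
Proof.
move=> xE; have idl : linear (fun h : H => h) by [].
have := sw_antipoder (iota c) idl; rewrite xE; last first.
  split=> [u e v w|u e v w] /=; first by rewrite linearP mulrDr -scalerAr.
  by rewrite mulrDl -scalerAl.
move=> E; pose f (h : H) : k^o := (n%:R)^-1 * chi (tr h).
have fl : linear f.
  by move=> e u v; rewrite /f (trD CH) (tr_scale CH) rmorphD (chiZ chi_alg) mulrDr mulrCA.
have n0 := ch_degree_neq0 char0 CH.
have fi b : f (iota b) = chi b.
  by rewrite /f -[iota b]mulr1 (trZ CH) (tr_one CH) rmorphM rmorph_nat mulrCA mulVf ?mulr1.
have := congr1 f E; rewrite (tlift_comp _ _ fl) => F; transitivity (f (eps (iota c) *: 1)).
  by rewrite -F; apply: eq_tlift => a b; rewrite SCE -(rmorphM iota) fi rmorphM.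
rewrite [LHS](linearZ_LR (linear_pack fl)) /= -(rmorph1 iota) fi rmorph1.
exact: mulr1.
Qed.

Variables (m m' : nat) (rho : {rmorphism H -> 'M[k]_m}) (rho' : {rmorphism H -> 'M[k]_m'}).
Hypothesis rho_base : forall c, rho (iota c) = (chi c)%:M.
Hypothesis rho'_base : forall c, rho' (iota c) = (chi (SC c))%:M.
Local Notation V := (mx_module rho : lmodType H).
Local Notation W := (mx_module rho' : lmodType H).

(** An element c of C acts on V (x) W by chi (c_1) chi (S c_2) = eps c, so V (x)
    W is a module over the identity fiber. *)
Lemma tensor_fiber x (t : hopf_tens V W) : mH x -> x *: t = 0.
Proof.
move=> mx; suff: [set h : H | forall t : hopf_tens V W, h *: t = 0] x by apply.
apply: mx => [|_ [c c0 <-] {}t].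
  split=> [t'|y z y0 z0 t'|y z z0 /=]; first by rewrite scale0r.
    by rewrite scalerDl y0 z0 addr0.
  by split=> t'; rewrite -scalerA z0 ?scaler0.
move: t; elim/tens_ind=> [|v w t IH]; first exact: scaler0.
rewrite -[pure v w + t]/((pure v w : hopf_tens V W) + (t : hopf_tens V W)) scalerDr IH addr0.
rewrite tensor_act_pure; have [y yE] := sw_base HS c; rewrite yE; last exact: tensor_act_bilin.
have [p1 p2] := pure_bilin (restr (in_alg H) V) (restr (in_alg H) W).
have pZl e (v1 : restr (in_alg H) V) (w1 : restr (in_alg H) W) : pure (e *: v1) w1 = e *: pure v1 w1.
  exact: (bilin_scalel _ _ _ (pure_bilin _ _)).
have pZr e (v1 : restr (in_alg H) V) (w1 : restr (in_alg H) W) : pure v1 (e *: w1) = e *: pure v1 w1.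
  have z0 : pure v1 (0 : restr (in_alg H) W) = 0.
    by have := p1 v1 (-1) 0 0; rewrite scaler0 addr0 scaleN1r addNr.
  by have := p1 v1 e w1 0; rewrite z0 !addr0.
have actV a : iota a *: (v : V) = (chi a *: v : restr (in_alg H) V) :> V.
  rewrite -[LHS]/(rho (iota a) *m (v : 'cV[k]_m)) -[RHS]/(rho (chi a)%:A *m (v : 'cV[k]_m)).
  by rewrite -(iota_alg iota) !rho_base chi_alg.
have SCa e : chi (SC e%:A) = e.
  rewrite -[RHS]chi_alg; congr (chi _); apply: (iota_inj CH).
  by rewrite -SCE !iota_alg linearZ /= antipode1.
have actW a : iota a *: (w : W) = (chi (SC a) *: w : restr (in_alg H) W) :> W.
  rewrite -[LHS]/(rho' (iota a) *m (w : 'cV[k]_m')) -[RHS]/(rho' (chi (SC a))%:A *m (w : 'cV[k]_m')).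
  by rewrite -[_%:A in RHS](iota_alg iota) !rho'_base SCa.
transitivity (tlift (fun a b => (chi a * chi (SC b) : k^o)) y *: pure v w).
  pose g (e : k^o) := e *: pure v w.
  have gl : linear g by move=> e a b; rewrite /g scalerDl -scalerA.
  rewrite -[RHS]/(g _) (tlift_comp _ _ gl); apply: eq_tlift => a b.
  by rewrite actV actW pZl pZr scalerA.
by rewrite (convolution_counit yE) (c0 : eps (iota c) = 0) scale0r.
Qed.

Hypothesis m_gt0 : (0 < m)%N.
Hypothesis m'_gt0 : (0 < m')%N.
Hypothesis rho_surj : forall M, exists x, rho x = M.
Hypothesis rho'_surj : forall M, exists x, rho' x = M.
Hypothesis rhoZ : forall c x, rho (c *: x) = c *: rho x.
Hypothesis rho'Z : forall c x, rho' (c *: x) = c *: rho' x.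
Hypothesis chev : chevalley_property H.

(** The radical at the counit is nilpotent modulo the identity fiber ideal, so
    it acts nilpotently on V (x) W, and by 0 if the tensor product is completely
    reducible. The conclusion expresses this by matrix coefficients. *)
Lemma radical_kills_tensor x p q r s : radical (chi0 \o tr) x ->
  sw (fun a b => rho a p q * rho' b r s : k^o) x = 0.
Proof.
move=> Tx.
have finV : finite_dim V.
  by exists m; apply: mx_module_dim => a; rewrite /= rhoZ rmorph1 scalemx1.
have finW : finite_dim W.
  by exists m'; apply: mx_module_dim => a; rewrite /= rho'Z rmorph1 scalemx1.
have red := chev (mx_module_irreducible m_gt0 rho_surj) finV
  (mx_module_irreducible m'_gt0 rho'_surj) finW.
have kill : forall t (y : hopf_tens V W), radical (chi0 \o tr) t -> t *: y = 0.
  apply: (reducible_nilpotent red); first by move=> a y Ty; apply: radMr.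
  have [l nil] := radical_nilpotent char0 CH chi0_alg.
  by exists l => u su uT y; apply: tensor_fiber; apply: nil.
pose v : restr (in_alg H) V := delta_mx q 0 : 'cV[k]_m.
pose w : restr (in_alg H) W := delta_mx s 0 : 'cV[k]_m'.
have := kill x (pure v w) Tx; rewrite tensor_act_pure => E.
pose F (v : restr (in_alg H) V) (w : restr (in_alg H) W) : k^o :=
  (v : 'cV[k]_m) p 0 * (w : 'cV[k]_m') r 0.
have rsV a (y : restr (in_alg H) V) : a *: y = a *: (y : 'cV[k]_m) :> 'cV[k]_m.
  by rewrite -[LHS]/(rho a%:A *m (y : 'cV[k]_m)) rhoZ rmorph1 scalemx1 mul_scalar_mx.
have rsW a (y : restr (in_alg H) W) : a *: y = a *: (y : 'cV[k]_m') :> 'cV[k]_m'.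
  by rewrite -[LHS]/(rho' a%:A *m (y : 'cV[k]_m')) rho'Z rmorph1 scalemx1 mul_scalar_mx.
have Fb : bilin F.
  split=> [y e z z'|y e z z'] /=; rewrite /F.
    rewrite -[e *: z + z']/((e *: z : 'cV[k]_m') + (z' : 'cV[k]_m')) rsW !mxE mulrDr.
    by rewrite mulrCA.
  rewrite -[e *: z + z']/((e *: z : 'cV[k]_m) + (z' : 'cV[k]_m)) rsV !mxE mulrDl.
  by rewrite -mulrA.
have := congr1 (tlift F) E; rewrite (sw_comp _ _ (tliftP Fb)).
have -> : tlift F 0 = 0.
  by have := tliftP Fb (-1) 0 0; rewrite scaler0 addr0 scaleN1r addNr.
move=> <-; apply: eq_sw => a b; rewrite tlift_pure // /F.
rewrite -[a *: (v : V)]/(rho a *m delta_mx q 0 : 'cV[k]_m).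
rewrite -[b *: (w : W)]/(rho' b *m delta_mx s 0 : 'cV[k]_m').
by rewrite -!colE !mxE.
Qed.
End TensorOfModules.

Let representation_base (chi : {rmorphism C -> k}) (m : nat) (rho : {rmorphism H -> 'M[k]_m}) :
  (forall a, chi a%:A = a) -> (forall c x, rho (c *: x) = c *: rho x) ->
  (forall x, radical (chi \o tr) x -> rho x = 0) -> forall c, rho (iota c) = (chi c)%:M.
Proof.
move=> chi_alg rZ r0 c.
have := r0 _ (fiber_radical CH (fiber_chi (iota := iota) chi_alg c 1)).
rewrite mulr1 rmorphB rZ rmorph1 => /eqP; rewrite subr_eq0 => /eqP ->.
by rewrite scalemx1.
Qed.

(** Let chi be a character that kills neither d = disc a nor S d, and chi' = chi
    o S. By [radical_fiber] the fibers at chi and at chi' are products of matrix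
    algebras. Consider G (v, w) = f (v S(w_1)) q (w_2), where q is the
    projection to the identity fiber and f = chi o tr. It depends only on the
    class of v in the fiber at chi, and only on the class of w in the fiber at
    chi'; so it is a combination of products of matrix coefficients of v and w,
    and G (x_1, x_2) = 0 for x in the radical at the counit, by
    [radical_kills_tensor]. The antipode reduces G (x_1, x_2) to f (1) q (x),
    and f (1) is the nonzero degree n. *)
Theorem chevalley_radical : chevalley_property H ->
  forall x, radical (chi0 \o tr) x -> mH x.
Proof.
move=> chev x Tx.
have [N [a [N0 a0 aN]]] := disc_maximum char0 CH Hprime Haff.
have [SC [SCE SCa SCK]] := base_antipode CH HS.
have R : dual_expansion iota tr a.
  by apply: (dual_expansion_of_radical char0 CH Hprime a0) => e; apply: aN.
set d := disc tr a in a0.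
have SCd : SC d <> 0 by move=> sd; apply: a0; rewrite -[d]SCK sd rmorph0.
have dSd : d * SC d <> 0 by case/(base_domain CH Hprime).
have [chi [chi_alg]] := characters_separate char0 CH Hprime Haff dSd.
rewrite rmorphM => /eqP; rewrite mulf_eq0 negb_or => /andP [/eqP chid /eqP chiSd].
pose chi' : {rmorphism C -> k} := chi \o SC.
have chi'_alg e : chi' e%:A = e by rewrite /= SCa chi_alg.
have bd (f : {rmorphism C -> k}) (e : 'I_N.+1 -> H) : f (disc tr e) = 0.
  by rewrite aN ?rmorph0.
have [I [m [rho [m0 rZ rS rK _]]]] := character_representations char0 CH chi_alg chid (bd chi).
have [I' [m' [rho' [m'0 r'Z r'S r'K _]]]] :=
  character_representations char0 CH chi'_alg (chiSd : chi' (disc tr a) <> 0) (bd chi').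
have [u uE] := matrix_coordinates rZ rS.
have [u' u'E] := matrix_coordinates r'Z r'S.
pose U : lmodType k := restr (fiber_scalar iota (chi_ker chi0)) (fiber iota (chi_ker chi0))^o.
pose q (h : H) : U := quo_pi (iota @` chi_ker chi0) h.
have ql : linear q.
  move=> e v w; rewrite /q -[e *: v]mulr_algl rmorphD rmorphM.
  by [].
have q0 h : mH h -> q h = 0.
  by move=> mh; rewrite /q -(rmorph0 (quo_pi _)); apply/quo_piP; rewrite subr0.
pose f (h : H) : k^o := chi (tr h).
have fl : linear f by move=> e v w; rewrite /f (trD CH) (tr_scale CH) rmorphD (chiZ chi_alg).
(* The map that recovers x from its coproduct. *)
pose G (v w : H) : U := sw (fun w1 w2 => f (v * S w1) *: q w2) w.
have inner v : bilin (fun w1 w2 => f (v * S w1) *: q w2).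
  split=> [w e y y'|w e y y'] /=.
    by rewrite ql scalerDr !scalerA mulrC.
  by rewrite linearP mulrDr -scalerAr fl scalerDl -scalerA.
have Gb : bilin G.
  split=> [v|w e v v']; first exact: sw_linear.
  by apply: tlift_comb => w1 w2; rewrite mulrDl -scalerAl fl scalerDl -scalerA.
have G1 v w : ideal_gen (iota @` chi_ker chi) v -> G v w = 0.
  move=> mv; rewrite /G /sw /tlift /formal_sum big1 // => p _.
  have -> : f (v * S p.1) = 0; last by rewrite scale0r.
  exact: (rad_tau (fiber_radical CH (igenMr _ mv))).
have n0 := ch_degree_neq0 char0 CH.
have fi c : f (iota c) = n%:R * chi c.
  by rewrite /f -[iota c]mulr1 (trZ CH) (tr_one CH) rmorphM rmorph_nat mulrC.
have fC c v : f (v * iota c) = chi c * f v.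
  by rewrite /f -(iotaC CH) (trZ CH) rmorphM.
have qC c v : q (iota c * v) = eps (iota c) *: q v.
  apply/eqP; rewrite -subr_eq0; apply/eqP.
  have -> : q (iota c * v) - eps (iota c) *: q v = q (iota c * v - eps (iota c) *: v).
    by rewrite addrC -scaleNr -ql scaleNr addrC.
  by apply: q0; apply: (fiber_chi chi0_alg).
(* An element c of C contributes the factor \sum chi (S c_1) eps (c_2) = chi
   (S c). *)
have Gbase c v h : chi' c = 0 -> G v (iota c * h) = 0.
  move=> c0; rewrite /G sw_mul; last exact: inner.
  have [y yE] := sw_base HS c; rewrite yE; last first.
    split=> [w e z z'|w e z z']; apply: tlift_comb => h1 h2.
      by rewrite mulrDl -scalerAl ql scalerDr !scalerA mulrC.
    by rewrite mulrDl -scalerAl linearP mulrDr -scalerAr fl scalerDl -scalerA.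
  have factor e b : sw (fun h1 h2 => f (v * S (iota e * h1)) *: q (iota b * h2)) h =
      (eps (iota b) * chi (SC e)) *: G v h.
    have sl : linear (fun z : U => (eps (iota b) * chi (SC e)) *: z).
      by move=> r z z'; rewrite scalerDr !scalerA mulrC.
    rewrite (sw_comp _ _ sl); apply: eq_sw => h1 h2.
    by rewrite antipodeM SCE mulrA fC qC !scalerA; congr (_ *: _); rewrite [LHS]mulrC mulrA.
  rewrite (eq_tlift _ factor).
  have gl : linear (fun e : k^o => e *: G v h) by move=> r z z'; rewrite scalerDl -scalerA.
  rewrite -(tlift_comp (fun e b => eps (iota b) * chi (SC e) : k^o) _ gl).
  have fSl : linear (fun z => f (S z)) by move=> e z z'; rewrite linearP fl.
  have E : sw (fun e b => eps b *: f (S e)) (iota c) = 0.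
    rewrite (sw_counitr _ fSl); transitivity (f (iota (SC c))); first by rewrite -SCE.
    by rewrite fi (c0 : chi (SC c) = 0) mulr0.
  move: E; rewrite yE; last first.
    split=> [w e z z'|w e z z'] /=; first by rewrite linearP scalerDl -scalerA.
    by rewrite fSl scalerDr !scalerA mulrC.
  move=> E.
  have : tlift (fun e b => n%:R * (eps (iota b) * chi (SC e)) : k^o) y = 0.
    rewrite -E; apply: eq_tlift => e b; transitivity (eps (iota b) *: f (iota (SC e)) : k^o).
      by rewrite fi; apply: mulrCA.
    by rewrite -SCE.
  have nl : linear (fun e : k^o => n%:R * e : k^o) by move=> r z z'; rewrite mulrDr mulrCA.
  rewrite -(tlift_comp (fun e b => eps (iota b) * chi (SC e) : k^o) _ nl).
  by move/eqP; rewrite mulf_eq0 (negPf n0) /= => /eqP ->; rewrite scale0r.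
have G2 v w : ideal_gen (iota @` chi_ker chi') w -> G v w = 0.
  move=> mw; suff /(_ v 1 1) : [set w : H | forall v a b, G v (a * w * b) = 0] w.
    by rewrite mul1r mulr1.
  have G0 z : G z 0 = 0 by have := Gb.1 z (-1) 0 0; rewrite scaler0 addr0 scaleN1r addNr.
  apply: mw => [|_ [c c0 <-] v' e b]; last by rewrite -(iotaC CH) -mulrA; apply: Gbase.
  split=> [v' e b|y z y0 z0 v' e b|y z z0]; first by rewrite mulr0 mul0r G0.
    have := Gb.1 v' 1 (e * y * b) (e * z * b); rewrite !scale1r mulrDr mulrDl => ->.
    by rewrite y0 z0 addr0.
  split=> v' e b; first by rewrite (_ : e * (y * z) * b = e * y * z * b) ?z0 // !mulrA.
  by rewrite (_ : e * (z * y) * b = e * z * (y * b)) ?z0 // !mulrA.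
pose kp (t : {i : I & 'I_(m i) * 'I_(m i)}%type) (y : H) := rho (tag t) y (tagged t).1 (tagged t).2.
pose kp' (t : {i : I' & 'I_(m' i) * 'I_(m' i)}%type) (y : H) := rho' (tag t) y (tagged t).1 (tagged t).2.
have Gl v w : G v w = \sum_t kp t v *: G (u t) w.
  have mv : ideal_gen (iota @` chi_ker chi) (v - \sum_t kp t v *: u t).
    by apply: (radical_fiber chi_alg R chid); apply/rK; apply: uE.
  pose g : {linear H -> U} := linear_pack (Gb.2 w).
  have gE z : G z w = g z by [].
  have := G1 _ w mv; rewrite gE (linearB g) (linear_sum g) => /(canRL (subrK _)).
  rewrite add0r -gE => ->; apply: eq_bigr => t _; exact: (linearZ_LR g).
have Gr v w : G v w = \sum_t kp' t w *: G v (u' t).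
  have mw : ideal_gen (iota @` chi_ker chi') (w - \sum_t kp' t w *: u' t).
    by apply: (radical_fiber chi'_alg R chiSd); apply/r'K; apply: u'E.
  pose g : {linear H -> U} := linear_pack (Gb.1 v).
  have gE z : G v z = g z by [].
  have := G2 v _ mw; rewrite gE (linearB g) (linear_sum g) => /(canRL (subrK _)).
  rewrite add0r -gE => ->; apply: eq_bigr => t _; exact: (linearZ_LR g).
have swG0 : sw G x = 0.
  have GE v w : G v w = \sum_t \sum_t' (kp t v * kp' t' w) *: G (u t) (u' t').
    rewrite Gl; apply: eq_bigr => t _; rewrite Gr scaler_sumr.
    by apply: eq_bigr => t' _; rewrite scalerA.
  rewrite (eq_sw _ GE) /sw /tlift /formal_sum exchange_big big1 // => t _.
  rewrite exchange_big big1 // => t' _; rewrite -scaler_suml.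
  have := radical_kills_tensor SCE chi_alg
    (representation_base chi_alg (rZ _) (fun y Ty => (rK y).2 Ty _))
    (representation_base chi'_alg (r'Z _) (fun y Ty => (r'K y).2 Ty _))
    (m0 (tag t)) (m'0 (tag t')) (fun M => family_surj rS M) (fun M => family_surj r'S M) (rZ _) (r'Z _) chev
    (tagged t).1 (tagged t).2 (tagged t').1 (tagged t').2 Tx.
  by rewrite /sw /tlift /formal_sum => ->; rewrite scale0r.
have swGE : sw G x = f 1 *: q x.
  have hl : linear (fun z => f 1 *: q z) by move=> e z z'; rewrite ql scalerDr !scalerA mulrC.
  rewrite -(sw_counitl _ hl) /G.
  rewrite -(sw_assoc (F := fun w1 w2 w3 => f (w1 * S w2) *: q w3)); last 3 first.
  - by move=> b c e z z'; rewrite mulrDl -scalerAl fl scalerDl -scalerA.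
  - by move=> b c e z z'; rewrite linearP mulrDr -scalerAr fl scalerDl -scalerA.
  - by move=> b c e z z'; rewrite ql scalerDr !scalerA mulrC.
  apply: eq_sw => v w.
  have wl : linear (fun z => f z *: q w) by move=> e z z'; rewrite fl scalerDl -scalerA.
  exact: (sw_antipoder v wl).
have qx : q x = 0.
  move: swGE; rewrite swG0 => /esym/eqP; rewrite scaler_eq0.
  rewrite /f (tr_one CH) rmorph_nat (negPf n0) /=.
  by move/eqP.
by have /quo_piP : q x = q 0; [rewrite qx /q rmorph0 | rewrite subr0].
Qed.
End Chevalley.

(** * Conditions that force commutativity *)

Section SemisimpleFiber.
Variables (k : closedFieldType) (A : algType k) (C : comAlgType k).
Variables (iota : {lrmorphism C -> A}) (tr : A -> C) (n : nat).
Hypothesis char0 : [pchar k] =i pred0.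
Hypothesis CH : cayley_hamilton iota tr n.
Variable chi : {rmorphism C -> k}.
Hypothesis chi_alg : forall a, chi a%:A = a.
Local Notation mA := (ideal_gen (iota @` chi_ker chi)).
Local Notation tau := (chi \o tr).
Let tf := character_trace_form char0 CH chi_alg.

(** The radical is nilpotent modulo the fiber ideal, so it acts by 0 on the
    fiber, if the latter is a completely reducible module over itself. *)
Lemma semisimple_radical : semisimple (fiber iota (chi_ker chi)) ->
  forall x, radical tau x -> mA x.
Proof.
move=> ss x Tx; pose T : set (fiber iota (chi_ker chi)) := [set t | radical tau (repr t)].
have Tpi y : radical tau y -> T (quo_pi _ y).
  move=> Ty; have /quo_piP my := quo_reprK (quo_pi (iota @` chi_ker chi) y).
  rewrite /T /=; rewrite -[repr _](subrK y); apply: (radD tf) => //.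
  exact: (fiber_radical CH my).
have TM a t : T t -> T (t * a).
  move=> Tt; rewrite -[t]quo_reprK -[a]quo_reprK -rmorphM; apply: Tpi.
  exact: radMr.
have nil : exists q, forall s : seq (fiber iota (chi_ker chi)), size s = q ->
    (forall r, r \in s -> T r) ->
    forall y : (fiber iota (chi_ker chi))^o, (\prod_(r <- s) r) *: y = 0.
  have [q qE] := radical_nilpotent char0 CH chi_alg; exists q => s sq sT y.
  have -> : \prod_(r <- s) r = quo_pi (iota @` chi_ker chi) (\prod_(r <- map repr s) r).
    by rewrite big_map rmorph_prod; apply: eq_bigr => r _; rewrite [RHS]quo_reprK.
  have -> : quo_pi (iota @` chi_ker chi) (\prod_(r <- map repr s) r) = 0.
    rewrite -(rmorph0 (quo_pi _)); apply/quo_piP; rewrite subr0; apply: qE.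
      by rewrite size_map.
    by move=> r /mapP [t ts ->]; apply: sT.
  exact: scale0r.
have := reducible_nilpotent ss TM nil (1 : (fiber iota (chi_ker chi))^o) (Tpi _ Tx).
rewrite [_ *: _]mulr1 -(rmorph0 (quo_pi _)) => /quo_piP.
by rewrite subr0.
Qed.
End SemisimpleFiber.

Section Conclusions.
Variables (k : closedFieldType) (H : hopfAlgType k) (C : comAlgType k).
Variables (iota : {lrmorphism C -> H}) (tr : H -> C) (n : nat).
Hypothesis char0 : [pchar k] =i pred0.
Hypothesis CH : cayley_hamilton iota tr n.
Hypothesis Hprime : prime_ring H.
Hypothesis Haff : affine H.
Local Notation eps := (@counit k H).
Local Notation chi0 := (eps \o iota : {rmorphism C -> k}).
Local Notation mH := (ideal_gen (iota @` chi_ker chi0)).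

Let chi0_alg a : chi0 a%:A = a. Proof. by rewrite /= iota_alg counit_alg. Qed.
Lemma commutative_of_radical : (forall x, radical (chi0 \o tr) x -> mH x) ->
  forall x y : H, x * y = y * x.
Proof.
move=> T0 x y.
have [N [a [R a0]]] := dual_expansion_at_character char0 CH Hprime Haff T0.
exact: (commutative_of_central_integral char0 CH Hprime Haff (@counit_alg k H) R a0).
Qed.

(** For a discriminant of the largest size, being nonzero at the counit is
    sufficient. *)
Lemma commutative_of_generic_disc N (a : 'I_N -> H) : chi0 (disc tr a) <> 0 ->
  (forall e : 'I_N.+1 -> H, disc tr e = 0) -> forall x y : H, x * y = y * x.
Proof.
move=> a0 amax x y.
have R : dual_expansion iota tr a.
  by apply: (dual_expansion_of_radical char0 CH Hprime) => // d0; apply: a0; rewrite d0 rmorph0.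
exact: (commutative_of_central_integral char0 CH Hprime Haff (@counit_alg k H) R a0).
Qed.

(** The discriminant ideal of the largest possible size is nonzero, so it is C,
    and is not contained in the kernel of the counit. *)
Lemma commutative_of_trivial_disc :
  (forall j : nat, (0 < j)%N ->
     discriminant_ideal tr j = [set 0] \/ discriminant_ideal tr j = setT) ->
  forall x y : H, x * y = y * x.
Proof.
move=> triv; have [N [a [N0 a0 aN]]] := disc_maximum char0 CH Hprime Haff.
suff [e e0] : exists e : 'I_N -> H, chi0 (disc tr e) <> 0.
  by apply: (commutative_of_generic_disc e0) => e'; apply: aN.
apply: contrapT => none.
have [D0|D1] := triv N N0.
  by apply: a0; have : discriminant_ideal tr N (disc tr a); [apply: igen_sub; exists a | rewrite D0].
have [kid _ _] := chi_ker_maximal chi0_alg.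
have : discriminant_ideal tr N 1 by rewrite D1.
move=> /(_ (chi_ker chi0) kid) ker1.
have : chi_ker chi0 1.
  apply: ker1 => _ [e ->]; apply: contrapT => e0.
  by apply: none; exists e.
by rewrite /chi_ker /= !rmorph1 => /eqP; rewrite oner_eq0.
Qed.

(** At a generic character the square dimension is the largest size of a tuple
    with nonzero discriminant, so this size is also attained at the counit. *)
Lemma commutative_of_constant_square_dim :
  (forall m m' : set C, maxSpec C m -> maxSpec C m' -> square_dim iota m = square_dim iota m') ->
  forall x y : H, x * y = y * x.
Proof.
move=> cst; have [N [a [N0 a0 aN]]] := disc_maximum char0 CH Hprime Haff.
have [chi [chi_alg chia]] := characters_separate char0 CH Hprime Haff a0.
have bd (f : {rmorphism C -> k}) l (e : 'I_l -> H) : (N < l)%N -> f (disc tr e) = 0.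
  by move=> Nl; rewrite aN ?rmorph0.
have [j [e [e0 emax]]] := disc_maximal_exists (chi := chi0) iota (bd chi0).
have Sd := square_dim_rank char0 CH chi_alg chia (fun e => bd chi _ e (ltnSn N)).
have Sd0 := square_dim_rank char0 CH chi0_alg e0 emax.
have jN : j = N by rewrite -Sd -Sd0; apply: cst; apply: chi_ker_maximal.
have [e' e'0] : exists e' : 'I_N -> H, chi0 (disc tr e') <> 0 by rewrite -jN; exists e.
by apply: (commutative_of_generic_disc e'0) => e''; apply: aN.
Qed.
End Conclusions.

(** * Points of commutative algebras *)

(** Krull's theorem. Zorn's lemma is applied to the sets X for which X together
    with J is a proper ideal, so that the empty chain has an upper bound. *)
Lemma prime_above (R : comNzRingType) (J : set R) : ideal J -> ~ J 1 ->
  exists P, prime_set P /\ J `<=` P.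
Proof.
move=> idJ J1; pose proper (I : set R) := ideal I /\ ~ I 1.
have [|M [[[M0 MD MM] M1] Mmax]] := @Zorn_bigcup R (fun X => proper (X `|` J)).
  move=> F FP Ftot.
  have common (x y : R) : (\bigcup_(X in F) X `|` J) x -> (\bigcup_(X in F) X `|` J) y ->
      exists X : set R, [/\ X `<=` \bigcup_(X in F) X, proper (X `|` J), (X `|` J) x & (X `|` J) y].
    have sub (X : set R) : F X -> X `<=` \bigcup_(X in F) X by move=> FX z Xz; exists X.
    move=> [[X FX Xx]|Jx] [[Y FY Yy]|Jy].
    - have [XY|YX] := Ftot X Y FX FY.
        by exists Y; split; [apply: sub|apply: FP|left; apply: XY|left].
      by exists X; split; [apply: sub|apply: FP|left|left; apply: YX].
    - by exists X; split; [apply: sub|apply: FP|left|right].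
    - by exists Y; split; [apply: sub|apply: FP|right|left].
    - by exists set0; split=> //; [rewrite set0U|right|right].
  have up (X : set R) : X `<=` \bigcup_(X in F) X -> X `|` J `<=` \bigcup_(X in F) X `|` J.
    by move=> XF; apply: setSU.
  split; last by move=> u1; have [X [_ [_ X1] Xu _]] := common _ _ u1 u1; apply: X1.
  split; first by right; case: idJ.
    by move=> x y ux uy; have [X [/up XF [[_ XD _] _] Xx Xy]] := common _ _ ux uy; apply/XF/XD.
  move=> b x ux; have [X [/up XF [[_ _ XM] _] Xx _]] := common _ _ ux ux.
  by split; apply: XF; have [] := XM b x Xx.
exists (M `|` J); split; last exact: subsetUr.
split=> // [b x /(MM b) [] //|x y Mxy].
have [Mx|nMx] := pselect ((M `|` J) x); first by left.
right; pose B : set R := [set z | exists m b, (M `|` J) m /\ z = m + b * x].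
have BJ : B `|` J = B.
  by rewrite setUidl // => z Jz; exists z, 0; split; [right|rewrite mul0r addr0].
have MB : M `<` B.
  split=> [z Mz|BM]; first by exists z, 0; split; [left|rewrite mul0r addr0].
  apply: nMx; left; apply: BM.
  by exists 0, 1; split=> //; rewrite mul1r add0r.
have := Mmax _ MB; rewrite BJ /proper => nB.
have [m [b [Mm E]]] : B 1.
  apply: contrapT => B1; apply: nB; split=> //; split.
  - by exists 0, 0; split=> //; rewrite mul0r addr0.
  - move=> _ _ [m [b [Mm ->]]] [m' [b' [Mm' ->]]].
    by exists (m + m'), (b + b'); split; [apply: MD|rewrite mulrDl addrACA].
  move=> c _ [m [b [Mm ->]]].
  suff Bc : B (c * (m + b * x)) by split=> //; rewrite mulrC.
  by exists (c * m), (c * b); split; [case: (MM c _ Mm)|rewrite mulrDr mulrA].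
rewrite -[y]mul1r E mulrDl -mulrA; apply: MD; first by rewrite mulrC; case: (MM y _ Mm).
by case: (MM b _ Mxy).
Qed.

Section CommutativePoints.
Variables (k : closedFieldType) (A : algType k) (C : comAlgType k).
Variables (iota : {lrmorphism C -> A}) (tr : A -> C) (n : nat).
Hypothesis char0 : [pchar k] =i pred0.
Hypothesis CH : cayley_hamilton iota tr n.
Hypothesis Aaff : affine A.
Hypothesis AC : forall x y : A, x * y = y * x.

(** The trace maps the extension of J to J, and maps 1 to the nonzero integer n. *)
Lemma ideal_extension_proper (J : set C) : ideal J -> ~ J 1 -> ~ ideal_gen (iota @` J) 1.
Proof.
move=> [J0 JD JM] J1 /(_ [set x | forall y, J (tr (x * y))]) E.
have : J (tr (1 * 1)).
  apply: E => [|_ [c Jc <-] y]; last by rewrite (trZ CH) mulrC; case: (JM (tr y) c Jc).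
  split=> [y|x z Jx Jz y|a x Jx].
  - by rewrite mul0r (tr0 CH).
  - by rewrite mulrDl (trD CH); apply: JD.
  - by split=> y; rewrite ?(AC a) -mulrA.
rewrite mulr1 (tr_one CH) => Jn; apply: J1.
have [_] := JM (n%:R^-1)%:A _ Jn.
have n0 := ch_degree_neq0 char0 CH.
by rewrite mulr_algr -[X in _ *: X]scaler_nat scalerA mulVf // scale1r.
Qed.

(** The extension of J is pulled back to a polynomial ring that maps onto A; a
    point of a prime above it, given by the Nullstellensatz, factors through A. *)
Lemma character_above (J : set C) : ideal J -> ~ J 1 -> exists theta : {rmorphism A -> k},
  (forall a, theta a%:A = a) /\ forall c, J c -> theta (iota c) = 0.
Proof.
move=> idJ J1; have [s sP] := Aaff.
pose B : comAlgType k := HB.pack A (GRing.PzRing_hasCommutativeMul.Build A AC).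
have [R [j [ev [pts evj evs]]]] := @affine_cover k B s.
have ev_surj : forall x : B, exists p, ev p = x.
  move=> x; suff : x \in [pred y : A | `[< exists p, ev p = y >]] by move/asboolP.
  apply: sP => [|y ys]; last by apply/asboolP; apply: evs.
  split=> [|a y z /asboolP [p pE] /asboolP [q qE]|y z /asboolP [p pE] /asboolP [q qE]].
  - by apply/asboolP; exists 1; rewrite rmorph1.
  - by apply/asboolP; exists (j a * p + q); rewrite rmorphD rmorphM evj pE qE mulr_algl.
  - by apply/asboolP; exists (p * q); rewrite rmorphM pE qE.
have [r rP] := choice ev_surj.
have mI := ideal_extension_proper idJ J1.
have [P [pP JP]] : exists P, prime_set P /\ [set p : R | ideal_gen (iota @` J) (ev p : A)] `<=` P.
  apply: prime_above => [|/=]; last by rewrite rmorph1.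
  split=> [|p q|b p] /=; first by rewrite rmorph0; apply: igen0.
    by rewrite rmorphD; apply: igenD.
  by rewrite !rmorphM => mp; split; [apply: igenMl|apply: igenMr].
have [phi [phiP _ phij]] := pts P 1 pP (ps1 pP).
have phi_ker p q : ev p = ev q -> phi p = phi q.
  move=> e; apply/eqP; rewrite -subr_eq0 -rmorphB; apply/eqP; apply: phiP; apply: JP.
  by rewrite /= rmorphB e subrr; apply: igen0.
pose th (x : A) : k := phi (r x).
have thE p : th (ev p) = phi p by apply: phi_ker; apply: rP.
have thB : {morph th : x y / x - y}.
  by move=> x y; rewrite -[in LHS](rP x) -[in LHS](rP y) -rmorphB thE rmorphB.
have thM : monoid_morphism th.
  split; first by rewrite -(rmorph1 ev) thE rmorph1.
  by move=> x y; rewrite -[in LHS](rP x) -[in LHS](rP y) -rmorphM thE rmorphM.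
pose theta : {rmorphism A -> k} := HB.pack th
  (GRing.isZmodMorphism.Build A k th thB) (GRing.isMonoidMorphism.Build A k th thM).
exists theta; split=> [a|c Jc]; first by rewrite -[RHS]phij -thE evj.
apply: phiP; apply: JP; rewrite /= rP; apply: igen_sub; by exists c.
Qed.
End CommutativePoints.

(** * Translations by characters *)

(** Functions are used here, and not packed morphisms, because the composite of
    a character with the antipode is a character without being a composite of
    ring morphisms. *)
Definition algebra_character (k : fieldType) (A : algType k) (f : A -> k) : Prop :=
  scalar f /\ monoid_morphism f.

Section Translation.
Variables (k : closedFieldType) (H : hopfAlgType k).
Local Notation S := (@antipode k H).
Local Notation eps := (@counit k H).

(** The action of a character by left convolution, an algebra automorphism of H. *)
Definition translate (theta : H -> k) (h : H) : H := sw (fun a b => theta a *: b) h.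

Lemma antipode_character (theta : H -> k) :
  algebra_character theta -> algebra_character (theta \o S).
Proof.
move=> [tl [tM t1]]; split=> [a x y|]; first by rewrite /= linearP tl.
by split=> [|x y] /=; [rewrite antipode1|rewrite antipodeM t1 mulrC].
Qed.

Variable theta : H -> k.
Hypothesis th : algebra_character theta.
Let thl : scalar theta := th.1.
Let th1 : theta 1 = 1 := th.2.1.
Let thM x y : theta (x * y) = theta x * theta y := th.2.2 x y.
Local Notation L := (translate theta).
Local Notation L' := (translate (theta \o S)).

Let tb : bilin (fun a b : H => theta a *: b).
Proof.
split=> [a c x y|a c x y] /=; first by rewrite scalerDr !scalerA mulrC.
by rewrite thl scalerDl scalerA.
Qed.

Lemma translate_linear : linear L. Proof. exact: sw_linear. Qed.

Lemma translateM x y : L (x * y) = L x * L y.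
Proof.
rewrite /translate sw_mul //.
have ml : linear (fun z : H => z * L y) by move=> c u v; rewrite mulrDl scalerAl.
rewrite (sw_comp _ _ ml); apply: eq_sw => x1 x2.
have mr : linear (fun z : H => theta x1 *: x2 * z) by move=> c u v; rewrite mulrDr scalerAr.
rewrite (sw_comp _ _ mr); apply: eq_sw => y1 y2.
by rewrite thM -scalerAl -scalerAr scalerA.
Qed.

Lemma translate1 : L 1 = 1.
Proof. by rewrite /translate /sw rmorph1 tlift_pure // th1 scale1r. Qed.

Lemma counit_translate h : eps (L h) = theta h.
Proof.
have el : linear (eps : H -> k^o) by move=> c u v; rewrite linearP.
have tl : linear (theta : H -> k^o) by move=> c u v; rewrite thl.
rewrite -[eps _]/((eps : H -> k^o) _) (sw_comp _ _ el) -[RHS](sw_counitr h tl).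
by apply: (@eq_sw k H k^o) => a b; rewrite linearZ; apply: mulrC.
Qed.

Lemma translateK : cancel L L'.
Proof.
move=> x; have [l' _] := antipode_character th.
have Ll : linear L'.
  apply: sw_linear; split=> [a c u v|a c u v] /=; first by rewrite scalerDr !scalerA mulrC.
  by rewrite linearP thl scalerDl scalerA.
rewrite {2}/translate (sw_comp _ _ Ll).
have idl : linear (fun z : H => z) by [].
rewrite -[RHS](sw_counitl x idl).
transitivity (sw (fun a b => sw (fun b1 b2 => (theta a * theta (S b1)) *: b2) b) x).
  apply: eq_sw => a b; have al : linear (fun z : H => theta a *: z).
    by move=> c u v; rewrite scalerDr !scalerA mulrC.
  rewrite [LHS](linearZ_LR (linear_pack Ll)) /= (sw_comp _ _ al).
  by apply: eq_sw => b1 b2; rewrite scalerA.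
rewrite -(sw_assoc (F := fun a b c => (theta a * theta (S b)) *: c)); last 3 first.
- by move=> b c e u v; rewrite thl mulrDl scalerDl scalerA mulrA.
- by move=> a c e u v; rewrite linearP thl mulrDr scalerDl scalerA mulrCA.
- by move=> a b e u v; rewrite scalerDr !scalerA mulrC.
apply: eq_sw => a b.
have gl : linear (fun z : H => theta z *: b) by move=> e u v; rewrite thl scalerDl scalerA.
transitivity (sw (fun a1 a2 => theta (a1 * S a2) *: b) a).
  by apply: eq_sw => a1 a2; rewrite thM.
by rewrite (sw_antipoder a gl) th1 scale1r.
Qed.

Lemma translateVK : cancel L' L.
Proof.
move=> x; have Ll := translate_linear.
rewrite {2}/translate (sw_comp _ _ Ll).
have idl : linear (fun z : H => z) by [].
rewrite -[RHS](sw_counitl x idl).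
transitivity (sw (fun a b => sw (fun b1 b2 => (theta (S a) * theta b1) *: b2) b) x).
  apply: eq_sw => a b; have al : linear (fun z : H => theta (S a) *: z).
    by move=> c u v; rewrite scalerDr !scalerA mulrC.
  rewrite [LHS](linearZ_LR (linear_pack Ll)) /= (sw_comp _ _ al).
  by apply: eq_sw => b1 b2; rewrite scalerA.
rewrite -(sw_assoc (F := fun a b c => (theta (S a) * theta b) *: c)); last 3 first.
- by move=> b c e u v; rewrite linearP thl mulrDl scalerDl scalerA mulrA.
- by move=> a c e u v; rewrite thl mulrDr scalerDl scalerA mulrCA.
- by move=> a b e u v; rewrite scalerDr !scalerA mulrC.
apply: eq_sw => a b.
have gl : linear (fun z : H => theta z *: b) by move=> e u v; rewrite thl scalerDl scalerA.
transitivity (sw (fun a1 a2 => theta (S a1 * a2) *: b) a).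
  by apply: eq_sw => a1 a2; rewrite thM.
by rewrite (sw_antipodel a gl) th1 scale1r.
Qed.

Variables (C : comAlgType k) (iota : {lrmorphism C -> H}).
Hypothesis HS : hopf_subalgebra iota.

Lemma translate_base c : exists c', L (iota c) = iota c'.
Proof.
have [y yE] := sw_base HS c; rewrite /translate yE //.
exists (tlift (fun a b => theta (iota a) *: b) y).
rewrite (tlift_comp _ _ (linearP iota)); apply: eq_tlift => a b.
by rewrite linearZ.
Qed.

(** A translation preserves C, so it carries the ideal of the fiber at psi to
    that of the fiber at phi as soon as it carries psi to phi. *)
Lemma translate_fiber (phi psi : H -> k) x : (forall h, phi (L h) = psi h) ->
  ideal_gen (iota @` [set c | psi (iota c) = 0]) x ->
  ideal_gen (iota @` [set c | phi (iota c) = 0]) (L x).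
Proof.
move=> phiL mx; pose I := [set h | ideal_gen (iota @` [set c | phi (iota c) = 0]) (L h)].
apply: (mx I) => [|_ [c c0 <-]]; last first.
  have [c' c'E] := translate_base c; rewrite /I /= c'E; apply: igen_sub.
  by exists c' => //; rewrite /= -c'E phiL.
have LD u v : L (u + v) = L u + L v by have := translate_linear 1 u v; rewrite !scale1r.
split=> [|u v|a u]; rewrite /I /=.
- have := LD 0 0; rewrite addr0 => /esym/(canRL (addrK _)); rewrite subrr => ->.
  exact: igen0.
- by rewrite LD; apply: igenD.
- by rewrite !translateM => mu; split; [apply: igenMl|apply: igenMr].
Qed.
End Translation.

Section HomogeneousFibers.
Variables (k : closedFieldType) (H : hopfAlgType k) (C : comAlgType k).
Variables (iota : {lrmorphism C -> H}) (tr : H -> C) (n : nat).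
Hypothesis char0 : [pchar k] =i pred0.
Hypothesis CH : cayley_hamilton iota tr n.
Hypothesis HS : hopf_subalgebra iota.
Local Notation eps := (@counit k H).
Local Notation chi0 := (eps \o iota : {rmorphism C -> k}).

(** The translation by theta carries the fiber at theta to the identity fiber,
    and carries the radical to the radical: if y is in the radical at theta,
    then its translate has its n-th power in the ideal of the identity fiber, so
    its trace is 0 at the counit by [tau_nilpotent]. *)
Lemma radical_translate (theta : {rmorphism H -> k}) : (forall a, theta a%:A = a) ->
  (forall x, radical (chi0 \o tr) x -> ideal_gen (iota @` chi_ker chi0) x) ->
  forall x, radical ((theta \o iota) \o tr) x ->
    ideal_gen (iota @` chi_ker (theta \o iota)) x.
Proof.
move=> theta_alg T0 x Tx.
have th : algebra_character theta.
  split; last by split; [exact: rmorph1|exact: rmorphM].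
  by move=> a u v; rewrite -mulr_algl rmorphD rmorphM theta_alg.
have th' := antipode_character th.
have chi0_alg a : chi0 a%:A = a by rewrite /= iota_alg counit_alg.
pose L := translate theta.
rewrite -[x](translateK th).
apply: (translate_fiber th' HS (phi := theta) (psi := eps)).
  by move=> h; rewrite -[in RHS](translateVK th h) (counit_translate th).
apply: T0 => h; rewrite -[h](translateVK th) -translateM //.
have := radMr (translate (theta \o @antipode k H) h) Tx.
move: (x * _) => y Ty.
apply: (tau_nilpotent char0 CH chi0_alg (q := n)); apply: (fiber_radical CH).
have LX m : L (y ^+ m) = L y ^+ m.
  elim: m => [|m IH]; first by rewrite !expr0; apply: (translate1 th).
  by rewrite !exprS -IH; apply: (translateM th).
rewrite -[translate _ _]/(L y) -LX; apply: (translate_fiber th HS (phi := eps) (psi := theta)).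
  by move=> h'; rewrite (counit_translate th).
exact: (radical_nil CH Ty).
Qed.
End HomogeneousFibers.

(** * Commutative Hopf algebras *)

(** Each element of A acts by a scalar, its eigenspaces being submodules; so
    every line is a submodule. *)
Lemma commutative_irreducible (k : closedFieldType) (A : algType k) (V : lmodType A) :
  (forall x y : A, x * y = y * x) -> irreducible V ->
  (exists d, has_dim (restr (in_alg A) V) d) ->
  exists v0 : V, forall v, exists a : k, v = a%:A *: v0.
Proof.
move=> AC [[x0 x0N] irr] [d [f [g fK gK]]].
have f_eq0 (v : restr (in_alg A) V) : f v = 0 -> v = 0.
  by move=> fv; rewrite -[v]fK fv -(linear0 f) fK.
have d0 : (0 < d)%N.
  rewrite lt0n; apply/eqP => d0; move/eqP: x0N; apply; apply: f_eq0.
  by apply/rowP => -[i i_d]; exfalso; rewrite d0 in i_d.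
have scal h : exists a : k, forall v : V, h *: v = a%:A *: v.
  pose F (r : 'rV[k]_d) : 'rV[k]_d := f (h *: (g r : V)).
  have gl : linear g by move=> a u v; rewrite -[u in LHS]gK -[v in LHS]gK -linearP fK.
  have Fl : linear F.
    move=> a u v; rewrite /F gl -linearP; congr (f _).
    rewrite scalerDr; congr (_ + _).
    by rewrite [LHS]scalerA [RHS]scalerA AC.
  have [a] : exists a, root (char_poly (lin1_mx (linear_pack Fl))) a.
    by apply/closed_rootP; rewrite size_char_poly eqSS -lt0n.
  rewrite -eigenvalue_root_char => /eigenvalueP [r rE r0].
  exists a => v; suff : v \in [pred v : V | h *: v == a%:A *: v] by move/eqP.
  have [|all0|//] := irr [pred v : V | h *: v == a%:A *: v].
    split=> [|b u w]; rewrite !inE; first by rewrite !scaler0.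
    move=> /eqP uE /eqP wE; rewrite !scalerDr wE; apply/eqP; congr (_ + _).
    by rewrite scalerA AC -scalerA uE scalerA AC -scalerA.
  move: rE; rewrite mul_rV_lin1 /= => rE.
  have gr : (g r : V) = 0.
    apply: all0; rewrite inE; apply/eqP/(bij_inj (Bijective fK gK)).
    by rewrite -[LHS]/(F r) rE -[X in _ *: X]gK -linearZ.
  by move: r0; rewrite -[r]gK gr linear0 eqxx.
exists x0 => v; suff : v \in [pred v : V | `[< exists a : k, v = a%:A *: x0 >]] by move/asboolP.
have [|all0|//] := irr [pred v : V | `[< exists a : k, v = a%:A *: x0 >]].
  split=> [|b u w]; first by apply/asboolP; exists 0; rewrite !scale0r.
  move=> /asboolP [a ->] /asboolP [c ->]; apply/asboolP; have [e eE] := scal b.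
  by exists (e * a + c); rewrite scalerA AC -scalerA eE scalerA -scalerDl mulr_algr scalerA -scalerDl.
case/eqP: x0N; apply: all0; apply/asboolP; exists 1.
by rewrite !scale1r.
Qed.

(** The tensor product of two one-dimensional modules is spanned by one vector,
    and has no proper submodules. *)
Lemma commutative_chevalley (k : closedFieldType) (H : hopfAlgType k) :
  (forall x y : H, x * y = y * x) -> chevalley_property H.
Proof.
move=> HC V W irrV dV irrW dW.
have [v0 v0P] := commutative_irreducible HC irrV dV.
have [w0 w0P] := commutative_irreducible HC irrW dW.
pose t0 : hopf_tens V W := pure (v0 : restr (in_alg H) V) (w0 : restr (in_alg H) W).
have t0Z a : a%:A *: t0 = a *: pure (v0 : restr (in_alg H) V) (w0 : restr (in_alg H) W).
  rewrite tensor_act_pure /sw linearZ rmorph1.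
  have tb := tensor_act_bilin (V := V) (W := W) v0 w0.
  rewrite [LHS](linearZ_LR (linear_pack (tliftP tb))) /= tlift_pure //.
  by rewrite !scale1r.
have t0P (t : hopf_tens V W) : exists a : k, t = a%:A *: t0.
  elim/tens_ind: t => [|v w t [a tE]]; first by exists 0; rewrite !scale0r.
  have [b vE] := v0P v; have [c wE] := w0P w; exists (b * c + a).
  rewrite tE !t0Z scalerDl; congr (_ + _); rewrite vE wE.
  have [p1 p2] := pure_bilin (restr (in_alg H) V) (restr (in_alg H) W).
  transitivity (pure (b *: (v0 : restr (in_alg H) V)) (c *: (w0 : restr (in_alg H) W))) => //.
  have z0 (u : restr (in_alg H) V) : pure u (0 : restr (in_alg H) W) = 0.
    by have := p1 u (-1) 0 0; rewrite scaler0 addr0 scaleN1r addNr.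
  rewrite (bilin_scalel _ _ _ (pure_bilin _ _)).
  have -> : pure (v0 : restr (in_alg H) V) (c *: (w0 : restr (in_alg H) W)) =
      c *: pure (v0 : restr (in_alg H) V) (w0 : restr (in_alg H) W).
    by have := p1 v0 c w0 0; rewrite z0 !addr0.
  exact: (scalerA b c (pure (v0 : restr (in_alg H) V) (w0 : restr (in_alg H) W))).
apply: completely_reducible_of_no_submodule => N [N0 NP].
have [[t [tN t0N]]|none] := pselect (exists t, t \in N /\ t != 0); last first.
  by left=> x xN; apply: contrapT => /eqP x0; apply: none; exists x.
right=> x; have [a tE] := t0P t; have [b ->] := t0P x.
have a0 : a != 0 by apply: contra_neq t0N => a0; rewrite tE a0 !scale0r.
have -> : b%:A *: t0 = (b / a)%:A *: t + 0; last exact: NP.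
by rewrite addr0 tE scalerA -scalerAl mul1r scalerA divfK.
Qed.

Lemma commuting_matrices_size (k : fieldType) m :
  (forall M N : 'M[k]_m, M *m N = N *m M) -> (m <= 1)%N.
Proof.
case: m => [|[|m]] // comm; pose i : 'I_m.+2 := lift ord0 ord0.
have := congr1 (fun M : 'M[k]_m.+2 => M ord0 ord0) (comm (delta_mx ord0 i) (delta_mx i ord0)).
rewrite mul_delta_mx mul_delta_mx !mxE eqxx /= => /eqP.
by rewrite oner_eq0.
Qed.

Section CommutativeFiber.
Variables (k : closedFieldType) (A : algType k) (C : comAlgType k).
Variables (iota : {lrmorphism C -> A}) (tr : A -> C) (n : nat).
Hypothesis char0 : [pchar k] =i pred0.
Hypothesis CH : cayley_hamilton iota tr n.
Variable chi : {rmorphism C -> k}.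
Hypothesis chi_alg : forall a, chi a%:A = a.
Local Notation mA := (ideal_gen (iota @` chi_ker chi)).
Local Notation Q := (fiber iota (chi_ker chi)).
Local Notation tau := (chi \o tr).
Let tf := character_trace_form char0 CH chi_alg.
Variables (N : nat) (a : 'I_N -> A).
Hypothesis a0 : chi (disc tr a) <> 0.
Hypothesis amax : forall e : 'I_N.+1 -> A, chi (disc tr e) = 0.
Hypothesis AC : forall x y : A, x * y = y * x.
Hypothesis T0 : forall x, radical tau x -> mA x.

(** The fiber is a product of copies of k, the irreducible representations of a
    commutative algebra being one-dimensional. A submodule is an ideal, and it
    contains the idempotent e of its support, that is, of the set of the
    coordinates t i that are not identically 0 on it. *)
Lemma commutative_semisimple : semisimple Q.
Proof.
have [I [m [rho [m0 rZ rS rK _]]]] := character_representations char0 CH chi_alg a0 amax.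
have m1 i : m i = 1%N.
  apply/eqP; rewrite eqn_leq m0 andbT; apply: (@commuting_matrices_size k) => M M'.
  have [x <-] := family_surj rS M; have [y <-] := family_surj rS M'.
  by have := congr1 (rho i) (AC x y); rewrite !rmorphM.
pose o i : 'I_(m i) := Ordinal (m0 i).
have oE i (p : 'I_(m i)) : p = o i by apply: val_inj; case: p => [[|p]] //=; rewrite m1.
pose th i x : k := rho i x (o i) (o i).
have thE i x : rho i x = (th i x)%:M.
  by apply/matrixP => p q; rewrite mxE (oE _ p) (oE _ q) eqxx mulr1n.
have thB i x y : th i (x - y) = th i x - th i y by rewrite /th rmorphB !mxE.
have thD i x y : th i (x + y) = th i x + th i y by rewrite /th rmorphD !mxE.
have th_0 i : th i 0 = 0 by rewrite /th rmorph0 mxE.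
have thM i x y : th i (x * y) = th i x * th i y.
  by rewrite {1}/th rmorphM !thE -[_ * _]scalar_mxM mxE eqxx mulr1n.
have thK x : (forall i, th i x = 0) -> mA x.
  by move=> x0; apply: (T0); apply/rK => i; rewrite thE x0 raddf0.
have thm i x : mA x -> th i x = 0.
  by move=> mx; rewrite /th (proj2 (rK x) (fiber_radical CH mx)) mxE.
have lift_values (c : I -> k) : exists x, forall i, th i x = c i.
  have [x xE] := rS (fun i => (c i)%:M); exists x => i.
  by rewrite /th xE mxE eqxx mulr1n.
pose t i (z : Q) : k := th i (repr z).
have tE i x : t i (quo_pi _ x) = th i x.
  have /quo_piP my := quo_reprK (quo_pi (iota @` chi_ker chi) x).
  by apply/eqP; rewrite -subr_eq0 -thB; apply/eqP/thm.
have tD i x y : t i (x + y) = t i x + t i y.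
  by rewrite -[x in LHS]quo_reprK -[y in LHS]quo_reprK -rmorphD tE thD.
have tM i x y : t i (x * y) = t i x * t i y.
  by rewrite -[x in LHS]quo_reprK -[y in LHS]quo_reprK -rmorphM tE thM.
have t0 i : t i 0 = 0 by rewrite -(rmorph0 (quo_pi _)) tE th_0.
have tN i x : t i (- x) = - t i x.
  by apply/eqP; rewrite -addr_eq0 -tD addNr t0.
have t_sum i J (r : seq J) (P : pred J) (F : J -> Q) :
    t i (\sum_(j <- r | P j) F j) = \sum_(j <- r | P j) t i (F j).
  by apply: (big_morph (t i)).
have tK x : (forall i, t i x = 0) -> x = 0.
  move=> x0; rewrite -[x]quo_reprK -(rmorph0 (quo_pi _)); apply/quo_piP.
  by rewrite subr0; apply: thK.
move=> /= L [L0 LP].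
have LD x y : x \in L -> y \in L -> x + y \in L.
  by move=> Lx Ly; have := LP 1 x y Lx Ly; rewrite scale1r.
have LM b x : x \in L -> b * (x : Q) \in L.
  by move=> Lx; have := LP b x 0 Lx L0; rewrite addr0.
pose s i := `[< exists y, y \in L /\ t i y != 0 >].
have /choice [y yP] : forall i, exists y, y \in L /\ (s i -> t i y != 0).
  move=> i; case: (boolP (s i)) => [/asboolP [y [Ly ty]]|_]; last by exists 0.
  by exists y.
have /choice [u uE] : forall i, exists x, forall j, th j x = (j == i)%:R / t i (y i).
  by move=> i; apply: lift_values.
pose e : Q := \sum_(i | s i) quo_pi _ (u i) * y i.
have Le : e \in L.
  rewrite /e; elim/big_ind: _ => // i _; apply: LM; exact: (yP i).1.
have te i : t i e = (s i)%:R.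
  rewrite t_sum; have t_i j : t i (quo_pi _ (u j) * y j) = (i == j)%:R * (t i (y j) / t j (y j)).
    by rewrite tM tE uE -mulrA; congr (_ * _); rewrite mulrC.
  under eq_bigr do rewrite t_i.
  case si : (s i); last first.
    rewrite big1 // => j sj; case: eqP => [ij|_]; last by rewrite mul0r.
    by rewrite ij sj in si.
  rewrite (bigD1 i) //= eqxx mul1r divff ?((yP i).2 si) // big1 ?addr0 // => j /andP [_ ji].
  by rewrite eq_sym (negPf ji) mul0r.
exists (fun z : Q^o => [forall i, s i ==> (t i z == 0)]); split.
- split=> [|b x z]; first by apply/forallP => i; rewrite t0 eqxx implybT.
  move=> /forallP x0 /forallP z0; apply/forallP => i; apply/implyP => si.
  have /implyP/(_ si)/eqP xi := x0 i; have /implyP/(_ si)/eqP zi := z0 i.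
  by rewrite tD [t i (b *: x)]tM xi zi mulr0 addr0.
- move=> x Lx /forallP x0; apply: tK => i; apply/eqP; apply: contraT => xi.
  have /implyP := x0 i; rewrite (negPf xi) => /(_ _) -> //.
  by apply/asboolP; exists x.
move=> x; exists (x * e : Q), (x - x * e : Q); split; first exact: LM.
  apply/forallP => i; apply/implyP => si.
  by rewrite tD tN tM te si mulr1 subrr.
by rewrite addrC subrK.
Qed.
End CommutativeFiber.

Section CommutativeHopf.
Variables (k : closedFieldType) (H : hopfAlgType k) (C : comAlgType k).
Variables (iota : {lrmorphism C -> H}) (tr : H -> C) (n : nat).
Hypothesis char0 : [pchar k] =i pred0.
Hypothesis CH : cayley_hamilton iota tr n.
Hypothesis HS : hopf_subalgebra iota.
Hypothesis Hprime : prime_ring H.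
Hypothesis Haff : affine H.
Hypothesis HC : forall x y : H, x * y = y * x.

Lemma commutative_radical (theta : {rmorphism H -> k}) : (forall a, theta a%:A = a) ->
  forall x, radical ((theta \o iota) \o tr) x ->
    ideal_gen (iota @` chi_ker (theta \o iota)) x.
Proof.
move=> theta_alg; apply: (radical_translate char0 CH HS theta_alg).
exact: (chevalley_radical char0 CH HS Hprime Haff (commutative_chevalley HC)).
Qed.

(** At every character of H the radical of the trace form is the fiber ideal, by
    translation to the identity fiber. So there is a tuple that is a basis both
    at this character and generically; its size is therefore the generic rank N. *)
Lemma unramified_everywhere : exists N, (forall l (e : 'I_l -> H), (N < l)%N -> disc tr e = 0) /\
  forall J : set C, ideal J -> ~ J 1 -> exists chi : {rmorphism C -> k},
    [/\ forall a, chi a%:A = a, J `<=` chi_ker chi,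
        forall x, radical (chi \o tr) x -> ideal_gen (iota @` chi_ker chi) x
      & exists a : 'I_N -> H, chi (disc tr a) <> 0].
Proof.
have [N [b [_ b0 bN]]] := disc_maximum char0 CH Hprime Haff.
exists N; split=> // J idJ J1.
have [theta [theta_alg thetaJ]] := character_above char0 CH Haff HC idJ J1.
have T0 := commutative_radical theta_alg.
exists (theta \o iota : {rmorphism C -> k}); split=> //.
  by move=> a; rewrite /= iota_alg theta_alg.
have [j [a [R a0]]] := dual_expansion_at_character char0 CH Hprime Haff T0.
suff jN : j = N by rewrite -jN; exists a.
have da0 : disc tr a <> 0 by move=> d0; apply: a0; rewrite d0 rmorph0.
apply/eqP; rewrite eqn_leq; apply/andP; split; rewrite leqNgt; apply/negP.
  by move/(bN _ a).
(* A tuple with a dual expansion spans, so that no longer tuple has a nonzero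
   discriminant. *)
move=> jN; apply: b0; rewrite -[LHS]/(idfun (disc tr b)).
apply: (disc_rank_bound CH (base_domain CH Hprime) (a := a) (d := disc tr a)) => // h.
by exists (fun i => tr (h * dual iota tr a i)) => y; rewrite R subrr mul0r (tr0 CH).
Qed.

Lemma maximal_ideal_character (N : nat) (m : set C) : 
  (forall J : set C, ideal J -> ~ J 1 -> exists chi : {rmorphism C -> k},
    [/\ forall a, chi a%:A = a, J `<=` chi_ker chi,
        forall x, radical (chi \o tr) x -> ideal_gen (iota @` chi_ker chi) x
      & exists a : 'I_N -> H, chi (disc tr a) <> 0]) ->
  maxSpec C m -> exists chi : {rmorphism C -> k},
    [/\ forall a, chi a%:A = a, m = chi_ker chi,
        forall x, radical (chi \o tr) x -> ideal_gen (iota @` chi_ker chi) x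
      & exists a : 'I_N -> H, chi (disc tr a) <> 0].
Proof.
move=> pts [idm mT mmax].
have m1 : ~ m 1.
  move=> m1; apply: mT; apply/seteqP; split=> // c _.
  by have [_ _ /(_ c 1 m1) []] := idm; rewrite mulr1.
have [chi [chi_alg mchi T0 a]] := pts m idm m1.
exists chi; split=> //; have [idk kT _] := chi_ker_maximal chi_alg.
by case: (mmax _ idk mchi) => // /kT.
Qed.

Lemma commutative_trivial_disc j : (0 < j)%N ->
  discriminant_ideal tr j = [set 0] \/ discriminant_ideal tr j = setT.
Proof.
have [N [bN pts]] := unramified_everywhere => _.
have [Nj|jN] := ltnP N j.
  left; apply/seteqP; split=> [c Dc|_ ->]; last exact: igen0.
  apply: Dc => [|_ [e ->]]; last exact: (bN _ e Nj).
  split=> // [x y -> ->|b x ->]; first exact: addr0.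
  by split; rewrite /= ?mulr0 ?mul0r.
right; apply/seteqP; split=> // c _.
have [D1|D1] := pselect (discriminant_ideal tr j 1).
  by rewrite -[c]mulr1; apply: igenMl.
have [chi [chi_alg Dchi _ [a a0]]] := pts _ (ideal_gen_ideal _) D1.
have K2 : (2%:R : k) <> 0 by apply/eqP; apply: natr_neq0.
have [e e0] := disc_subtuple CH (@field_domain k) K2 a0 jN.
by case: e0; apply: Dchi; apply: igen_sub; exists e.
Qed.

Lemma commutative_square_dim : exists N, forall m, maxSpec C m -> square_dim iota m = N.
Proof.
have [N [bN pts]] := unramified_everywhere; exists N => m /(maximal_ideal_character pts).
move=> [chi [chi_alg -> _ [a a0]]]; apply: (square_dim_rank char0 CH chi_alg a0) => e.
by rewrite bN ?rmorph0.
Qed.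

Lemma commutative_semisimple_fibers (m : set C) : maxSpec C m -> semisimple (fiber iota m).
Proof.
have [N [bN pts]] := unramified_everywhere => /(maximal_ideal_character pts).
move=> [chi [chi_alg -> T0 [a a0]]].
by apply: (commutative_semisimple char0 CH chi_alg a0) => // e; rewrite bN ?rmorph0.
Qed.
End CommutativeHopf.

Theorem corollary4p10 (k : closedFieldType) (H : hopfAlgType k)
    (C : comAlgType k) (iota : {lrmorphism C -> H}) (tr : H -> C)
    (char0 : [pchar k] =i pred0)
    (CH : cayley_hamilton_hopf iota tr)
    (Haff : affine H)
    (Hprime : prime_ring H) :
  [<-> chevalley_property H;
       forall j : nat, (0 < j)%N ->
         discriminant_ideal tr j = [set 0] \/ discriminant_ideal tr j = setT;
       forall m m' : set C, maxSpec C m -> maxSpec C m' ->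
         square_dim iota m = square_dim iota m';
       forall m : set C, maxSpec C m -> semisimple (fiber iota m);
       semisimple (fiber iota (counit_ideal iota));
       forall x y : H, x * y = y * x].
Proof.
have [[n CHn] HS] := CH.
have chi0_alg a : (@counit k H \o iota : {rmorphism C -> k}) a%:A = a.
  by rewrite /= iota_alg counit_alg.
tfae.
- move=> chev; have HC := commutative_of_radical char0 CHn Hprime Haff
    (chevalley_radical char0 CHn HS Hprime Haff chev).
  exact: (commutative_trivial_disc char0 CHn HS Hprime Haff HC).
- move=> triv; have HC := commutative_of_trivial_disc char0 CHn Hprime Haff triv.
  have [N NE] := commutative_square_dim char0 CHn HS Hprime Haff HC.
  by move=> m m' /NE -> /NE ->.
- move=> cst; have HC := commutative_of_constant_square_dim char0 CHn Hprime Haff cst.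
  exact: (commutative_semisimple_fibers char0 CHn HS Hprime Haff HC).
- by apply; apply: (chi_ker_maximal chi0_alg).
- move=> ss; apply: (commutative_of_radical char0 CHn Hprime Haff).
  exact: (semisimple_radical char0 CHn chi0_alg ss).
- exact: commutative_chevalley.
Qed.
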